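(* If $n \leq 5$, then the tropical pure spinor space $\operatorname{TSpin}^{\pm}(n)$ equals the $\Delta$-Dressian $\operatorname{DDr}(n)$, i.e. the Wick relations form a tropical basis of the ideal they generate. If $n \geq 7$, then $\operatorname{TSpin}^{\pm}(n)$ is strictly contained in $\operatorname{DDr}(n)$; in fact, there is a vector $p$ in the even $\Delta$-Dressian $\operatorname{DDr}^+(n)$ whose support consists of all even-sized subsets of $[n]$ and which is not in the tropical spinor variety $\operatorname{TSpin}^+(n)$.
   Context: Let $\mathbb{T} = \mathbb{R} \cup \{\infty\}$ with tropical operations $x \oplus y = \min(x,y)$, $x \odot y = x+y$. Let $K = \mathbb{C}\{\{t\}\}$ be the field of Puiseux series with its valuation $\operatorname{val}$ (least exponent, $\operatorname{val}(0)=\infty$). For a polynomial $P = \sum_a f_a X^a \in K[X_1,\dots,X_N]$, its tropicalization is $\operatorname{trop}(P)(x) = \min_a (\operatorname{val}(f_a) + a\cdot x)$, and its tropical hypersurface $\operatorname{Trop}(\operatorname{trop}(P)) \subseteq \mathbb{T}^N$ is the set of $x$ at which this minimum is attained at least twice or equals $\infty$. For an ideal $I$, its tropical variety is $\bigcap_{P \in I} \operatorname{Trop}(\operatorname{trop}(P))$. A generating set $S$ of $I$ is a tropical basis if $\bigcap_{P\in S}\operatorname{Trop}(\operatorname{trop}(P))$ equals the tropical variety of $I$. Let $\mathcal{P}([n])$ be the set of subsets of $[n]=\{1,\dots,n\}$; write $S\Delta i$ for $S \Delta \{i\}$. Wick relations: use variables $w_S$, $S \in \mathcal{P}([n])$,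 and for a sequence $\rho$ of elements of $[n]$ let $w_\rho = 0$ if $\rho$ has a repeated entry and otherwise $w_\rho = \operatorname{sign}(\pi) w_{\{\rho\}}$, where $\pi$ is the permutation sorting $\rho$ increasingly. For sequences $\sigma=(\sigma_1,\dots,\sigma_r)$, $\tau=(\tau_1,\dots,\tau_s)$ of elements of $[n]$, the Wick relation is $\sum_{i=1}^s (-1)^i w_{\tau_i \sigma_1\cdots\sigma_r} w_{\tau_1\cdots\widehat{\tau_i}\cdots\tau_s} + \sum_{j=1}^r (-1)^j w_{\sigma_1\cdots\widehat{\sigma_j}\cdots\sigma_r} w_{\sigma_j\tau_1\cdots\tau_s}$. The space of pure spinors $\operatorname{Spin}^{\pm}(n) \subseteq \mathbb{P}^{2^n-1}(K)$ is the zero set of all Wick relations (equivalently, the set of Wick coordinate vectors of $n$-dimensional totally isotropic subspaces of $K^{2n}$ for the form $\sum_i x_i y_{i^*} + x_{i^*} y_i$). The tropical pure spinor space $\operatorname{TSpin}^{\pm}(n) \subseteq \mathbb{T}^{\mathcal{P}([n])}$ is the tropical variety of the ideal generated by all Wick relations. The spinor variety $\operatorname{Spin}^+(n)$ is the set of points of $\operatorname{Spin}^{\pm}(n)$ whose support $\{S : w_S \neq 0\}$ consists of even-sized sets, and the tropical spinor variety $\operatorname{TSpin}^+(n)$ is the tropical variety of the ideal of polynomials vanishing on $\operatorname{Spin}^+(n)$. A vector $p \in \mathbb{T}^{\mathcal{P}([n])}$ is a tropical Wick vector if for all $S,T \in \mathcal{P}([n])$ the minimum $\min_{i \in S\Delta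 T}(p_{S\Delta i} + p_{T \Delta i})$ is attained at least twice or equals $\infty$. Its support is $\operatorname{supp}(p)=\{S : p_S \ne \infty\}$. The $\Delta$-Dressian $\operatorname{DDr}(n)$ is the set of all tropical Wick vectors, and the even $\Delta$-Dressian $\operatorname{DDr}^+(n)$ is the set of tropical Wick vectors whose support consists only of even-sized subsets. *)

(* Defs.v *)
(* Tropical numbers are taken over an arbitrary realType R
   (any complete archimedean ordered field, i.e. a copy of the reals), and
   the Puiseux series field C{{t}} is built concretely over C := R[i]. *)
From HB Require Import structures.
From mathcomp Require Import all_boot all_order all_algebra.
From mathcomp Require Import boolp reals complex.

Set Implicit Arguments.
Unset Strict Implicit.
Unset Printing Implicit Defensive.

Import Order.TTheory GRing.Theory Num.Theory.
Local Open Scope ring_scope.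

(* A representation  Puiseux d m c  stands for the Puiseux series           *)
(*      sum_{k >= 0} c k * t^((m + k) / (d+1)).                             *)
(* Every Puiseux series (support in (1/N)Z, bounded below) has such a       *)
(* representation; two representations denote the same element of K iff    *)
(* they have the same coefficient function [pz_coeff] (see [pz_eq]).       *)

Record puiseux (R : realType) := Puiseux {
  pz_den : nat;             (* the denominator is pz_den.+1 *)
  pz_ord : int;             (* starting numerator *)
  pz_coef : nat -> R[i] }.

Definition pz_coeff (R : realType) (x : puiseux R) (q : rat) : R[i] :=
  let r := q * ((pz_den x).+1)%:R in
  if (denq r == 1) && (pz_ord x <= numq r)
  then pz_coef x `|numq r - pz_ord x|%N else 0.

Definition pz_eq (R : realType) (x y : puiseux R) : Prop :=
  forall q, pz_coeff x q = pz_coeff y q.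

Definition pz_zero (R : realType) (x : puiseux R) : Prop :=
  forall q, pz_coeff x q = 0.

(* the valuation: least exponent, None standing for +infinity *)
Definition pz_val (R : realType) (x : puiseux R) : option rat :=
  match pselect (exists k, (fun k => pz_coef x k != 0) k) with
  | left h => Some (((pz_ord x + (ex_minn h)%:Z)%:~R : rat) / ((pz_den x).+1)%:R)
  | right _ => None
  end.

Definition pzC (R : realType) (a : R[i]) : puiseux R :=
  Puiseux 0 0 (fun k => if k == 0%N then a else 0).

Definition pz0 (R : realType) : puiseux R := pzC 0.
Definition pz1 (R : realType) : puiseux R := pzC 1.

(* rewriting a coefficient sequence with denominator N into denominator N*M *)
Definition stretch (R : realType) (c : nat -> R[i]) (M : nat) : nat -> R[i] :=
  fun i => if (M %| i)%N then c (i %/ M)%N else 0.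

Definition pzadd (R : realType) (x y : puiseux R) : puiseux R :=
  let Nx := (pz_den x).+1 in let Ny := (pz_den y).+1 in
  let mx := pz_ord x * Ny%:Z in let my := pz_ord y * Nx%:Z in
  let m := Num.min mx my in
  let sx := `|mx - m|%N in let sy := `|my - m|%N in
  Puiseux (Nx * Ny).-1 m
    (fun k => (if (sx <= k)%N then stretch (pz_coef x) Ny (k - sx) else 0)
            + (if (sy <= k)%N then stretch (pz_coef y) Nx (k - sy) else 0)).

Definition pzopp (R : realType) (x : puiseux R) : puiseux R :=
  Puiseux (pz_den x) (pz_ord x) (fun k => - pz_coef x k).

Definition pzmul (R : realType) (x y : puiseux R) : puiseux R :=
  let Nx := (pz_den x).+1 in let Ny := (pz_den y).+1 in
  Puiseux (Nx * Ny).-1 (pz_ord x * Ny%:Z + pz_ord y * Nx%:Z)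
    (fun k => \sum_(i < k.+1)
                stretch (pz_coef x) Ny i * stretch (pz_coef y) Nx (k - i)).

Definition pzexp (R : realType) (x : puiseux R) (k : nat) : puiseux R :=
  iter k (pzmul x) (pz1 R).

(* Polynomials over K in the variables w_S, S subset of [n] = 'I_n.          *)
(* A polynomial is represented by a finite formal sum of terms              *)
(* (coefficient, monomial); a monomial is an exponent vector.               *)

Definition monom (n : nat) := {ffun {set 'I_n} -> nat}.

Definition monadd (n : nat) (a b : monom n) : monom n := [ffun S => a S + b S]%N.

Definition monS (n : nat) (S : {set 'I_n}) : monom n := [ffun T => nat_of_bool (T == S)].

Definition kpoly (R : realType) (n : nat) := seq (puiseux R * monom n).

Definition pcoef (R : realType) (n : nat) (P : kpoly R n) (a : monom n) : puiseux R :=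
  foldr (@pzadd R) (pz0 R) [seq t.1 | t <- P & t.2 == a].

Definition pmul (R : realType) (n : nat) (P Q : kpoly R n) : kpoly R n :=
  [seq (pzmul t.1 u.1, monadd t.2 u.2) | t <- P, u <- Q].

Definition peq (R : realType) (n : nat) (P Q : kpoly R n) : Prop :=
  forall a, pz_eq (pcoef P a) (pcoef Q a).

Inductive ideal_gen (R : realType) (n : nat) (G : kpoly R n -> Prop) : kpoly R n -> Prop :=
  | ig_gen P : G P -> ideal_gen G P
  | ig_zero : ideal_gen G [::]
  | ig_add P Q : ideal_gen G P -> ideal_gen G Q -> ideal_gen G (P ++ Q)
  | ig_mul F P : ideal_gen G P -> ideal_gen G (pmul F P)
  | ig_eq P Q : ideal_gen G P -> peq P Q -> ideal_gen G Q.

Definition monval (R : realType) (n : nat) (a : monom n) (w : {set 'I_n} -> puiseux R)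
  : puiseux R :=
  foldr (fun S acc => pzmul (pzexp (w S) (a S)) acc) (pz1 R) (enum (@predT {set 'I_n})).

Definition peval (R : realType) (n : nat) (P : kpoly R n) (w : {set 'I_n} -> puiseux R)
  : puiseux R :=
  foldr (@pzadd R) (pz0 R) [seq pzmul t.1 (monval t.2 w) | t <- P].

(* number of inversions of a sequence; sign(pi) = (-1)^inv for the sorting
   permutation pi *)
Fixpoint inversions (n : nat) (s : seq 'I_n) : nat :=
  match s with
  | [::] => 0
  | x :: s' => (count (fun y : 'I_n => (y < x)%N) s' + inversions s')%N
  end.

(* w_rho = wsign rho * w_{ {rho} } *)
Definition wsign (R : realType) (n : nat) (rho : seq 'I_n) : R[i] :=
  if uniq rho then (-1) ^+ inversions rho else 0.

(* the term  e * w_{rho1} * w_{rho2} *)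
Definition wterm (R : realType) (n : nat) (e : R[i]) (rho1 rho2 : seq 'I_n)
  : puiseux R * monom n :=
  (pzC (e * wsign R rho1 * wsign R rho2),
   monadd (monS [set x in rho1]) (monS [set x in rho2])).

Fixpoint picks (T : Type) (s : seq T) : seq (T * seq T) :=
  match s with
  | [::] => [::]
  | x :: s' => (x, s') :: [seq (y.1, x :: y.2) | y <- picks s']
  end.

(* sum_{i=1}^s (-1)^i w_{tau_i sigma} w_{tau \ tau_i}
   + sum_{j=1}^r (-1)^j w_{sigma \ sigma_j} w_{sigma_j tau} *)
Definition wick (R : realType) (n : nat) (sigma tau : seq 'I_n) : kpoly R n :=
  [seq wterm ((-1) ^+ ip.1 : R[i]) (ip.2.1 :: sigma) ip.2.2
     | ip <- zip (iota 1 (size tau)) (picks tau)]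
  ++ [seq wterm ((-1) ^+ jp.1 : R[i]) jp.2.2 (jp.2.1 :: tau)
     | jp <- zip (iota 1 (size sigma)) (picks sigma)].

Definition wick_rels (R : realType) (n : nat) (P : kpoly R n) : Prop :=
  exists sigma tau : seq 'I_n, P = wick R sigma tau.

(* ideal of polynomials vanishing on Spin^+(n) (i.e. on its affine cone) *)
Definition spin_plus_ideal (R : realType) (n : nat) (P : kpoly R n) : Prop :=
  forall w : {set 'I_n} -> puiseux R,
    (forall sigma tau : seq 'I_n, pz_zero (peval (wick R sigma tau) w)) ->
    (forall S : {set 'I_n}, odd #|S| -> pz_zero (w S)) ->
    pz_zero (peval P w).

(* Tropical side: T = R u {oo}, None = oo.                                  *)

Definition tadd (R : realType) (x y : option R) : option R :=
  match x, y with Some a, Some b => Some (a + b) | _, _ => None end.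

Definition tle (R : realType) (x y : option R) : bool :=
  match x, y with
  | _, None => true
  | None, Some _ => false
  | Some a, Some b => a <= b
  end.

Definition min_twice (R : realType) (X : eqType) (s : seq X) (f : X -> option R) : Prop :=
  (forall a, a \in s -> f a = None) \/
  exists a b, [/\ a \in s, b \in s, a != b, f a = f b &
                  forall c, c \in s -> tle (f a) (f c)].

(* a . x  (with 0 * oo = 0) *)
Definition mondot (R : realType) (n : nat) (a : monom n) (x : {set 'I_n} -> option R)
  : option R :=
  if [exists S, (0 < a S)%N && (x S == None)] then None
  else Some (\sum_(S : {set 'I_n}) (a S)%:R * odflt 0 (x S)).

Definition tropterm (R : realType) (n : nat) (P : kpoly R n) (x : {set 'I_n} -> option R)
  (a : monom n) : option R :=
  tadd (omap (fun q : rat => ratr q : R) (pz_val (pcoef P a))) (mondot a x).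

Definition in_trop_hyp (R : realType) (n : nat) (P : kpoly R n) (x : {set 'I_n} -> option R)
  : Prop :=
  min_twice (undup [seq t.2 | t <- P]) (tropterm P x).

Definition trop_variety (R : realType) (n : nat) (I : kpoly R n -> Prop)
  (x : {set 'I_n} -> option R) : Prop :=
  forall P, I P -> in_trop_hyp P x.

Definition TSpinPM (R : realType) (n : nat) (p : {set 'I_n} -> option R) : Prop :=
  trop_variety (ideal_gen (@wick_rels R n)) p.

Definition TSpinPlus (R : realType) (n : nat) (p : {set 'I_n} -> option R) : Prop :=
  trop_variety (@spin_plus_ideal R n) p.

Definition symd (n : nat) (S T : {set 'I_n}) : {set 'I_n} := (S :\: T) :|: (T :\: S).

Definition DDr (R : realType) (n : nat) (p : {set 'I_n} -> option R) : Prop :=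
  forall S T : {set 'I_n},
    min_twice (enum (symd S T))
      (fun i => tadd (p (symd S [set i])) (p (symd T [set i]))).

Definition DDrPlus (R : realType) (n : nat) (p : {set 'I_n} -> option R) : Prop :=
  DDr p /\ forall S, p S != None -> ~~ odd #|S|.

Definition supp (R : realType) (n : nat) (p : {set 'I_n} -> option R) : {set {set 'I_n}} :=
  [set S | p S != None].

(* Main.v *)
(* Everything takes place in the ring [nov R] of functions R -> C with left-finite
   support (formal series in t with real exponents), which contains the Puiseux
   series.

   A Wick relation depends, up to sign, only on the underlying sets S and T, and
   reads sum_{k in S+T} (-1)^(#{j in S+T, j < k}) w_{S+k} w_{T+k} = 0, where + is the
   symmetric difference; in particular translations S |-> S+A preserve the solutions.
   Tropicalizing it gives the inclusion of the tropical pure spinor space in the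
   Delta-Dressian.

   For n >= 7 take p_S = Hamming distance from the trace of S on [7] to the set of
   bases of the dual Fano matroid. Four Wick relations become binomials modulo the
   variables of non-bases; the product of their leading monomials equals the product
   of their trailing monomials, with the opposite sign. The telescoping combination
   of the relations is therefore 2 m + (monomials containing a non-basis), with m a
   product of bases, and its tropicalization has a unique minimum at p.

   For n <= 5 it suffices to lift p to a solution of the Wick relations over [nov R],
   up to replacing infinite values by large ones. Tropical root operations keep the
   exchange property and make all values on the sets of one parity finite. Then a
   torus rescaling turns a spinor on [5] into a circulation a on the complete graph
   K5 (an antisymmetric matrix with zero row sums) whose Pfaffian has a prescribed
   valuation L. A circulation with prescribed valuations is a generic combination of
   cycles. If for some 4 vertices one matching is strictly lightest, the Pfaffian has
   the right valuation automatically. Otherwise the weights form a tree metric, they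
   are lifted to a circulation of rank 2, whose Pfaffian is 0, and adding c t^r times
   a suitable triangle corrects the Pfaffian without changing the other valuations. *)
Require Import Defs.
From HB Require Import structures.
From mathcomp Require Import all_boot all_order all_algebra.
From mathcomp Require Import boolp reals complex.
From mathcomp Require Import ring lra zify.

Set Implicit Arguments.
Unset Strict Implicit.
Unset Printing Implicit Defensive.

Import Order.TTheory GRing.Theory Num.Theory.
Local Open Scope ring_scope.

(** * Series with real exponents *)

Section BigSupport.
Variables (I : choiceType) (V : nmodType).

(** Both sums reduce to the indices with a nonzero term. This frees convolutions from the particular
    list that enumerates a support. *)
Lemma eq_big_support (s1 s2 : seq I) (F : I -> V) :
  uniq s1 -> uniq s2 -> (forall i, F i != 0 -> (i \in s1) = (i \in s2)) ->
  \sum_(i <- s1) F i = \sum_(i <- s2) F i.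
Proof.
move=> u1 u2 s12.
have E s : \sum_(i <- s) F i = \sum_(i <- [seq i <- s | F i != 0]) F i.
  rewrite big_filter [RHS]big_mkcond; apply: eq_bigr => i _.
  by case: eqVneq.
rewrite (E s1) (E s2); apply: perm_big; apply: uniq_perm; rewrite ?filter_uniq //.
by move=> i; rewrite !mem_filter; case: eqVneq => //= /s12 ->.
Qed.

End BigSupport.

Section Novikov.
Variable R : realType.
Local Notation C := R[i].

Definition left_finite (f : R -> C) : Prop :=
  forall B, exists s : seq R, forall r, r < B -> f r != 0 -> r \in s.

(** The support condition is a boolean, so its proofs are equal and a series is determined by its
    coefficients. *)
Record nov := Nov { nfun :> R -> C; nfun_lf : `[< left_finite nfun >] }.

HB.instance Definition _ := gen_eqMixin nov.
HB.instance Definition _ := gen_choiceMixin nov.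

Lemma nov_lf (f : nov) : left_finite f.
Proof. by case: f => f /= /asboolP. Qed.

Definition mknov (f : R -> C) (h : left_finite f) : nov := Nov (introT (asboolP _) h).

Lemma novP (f g : nov) : f =1 g -> f = g.
Proof.
case: f g => [f hf] [g hg] /= fg.
have {}fg : f = g by apply: functional_extensionality_dep.
by rewrite -{g}fg in hg *; congr Nov; apply: bool_irrelevance.
Qed.

Definition nsupp (f : nov) (B : R) : seq R := undup (projT1 (cid (nov_lf f B))).

Lemma nsuppP (f : nov) B r : r < B -> f r != 0 -> r \in nsupp f B.
Proof. by rewrite /nsupp mem_undup; case: cid => s /= hs; apply: hs. Qed.

Lemma nsupp_uniq f B : uniq (nsupp f B).
Proof. exact: undup_uniq. Qed.

(** Only negative exponents are compared; the default 0 bounds the others. *)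
Definition lbnd (f : nov) : R := \big[Num.min/0]_(r <- nsupp f 0) r.

Lemma lbndP (f : nov) r : f r != 0 -> lbnd f <= r.
Proof.
move=> fr; rewrite /lbnd; have [r0|r0] := ltP r 0.
  have := nsuppP r0 fr; elim: (nsupp f 0) => // x s IH.
  rewrite inE big_cons => /orP[/eqP ->|/IH h].
    by rewrite ge_min lexx.
  by rewrite ge_min h orbT.
apply: le_trans r0; elim: (nsupp f 0) => [|x s IH]; first by rewrite big_nil.
by rewrite big_cons ge_min IH orbT.
Qed.

(** A nonzero term needs v - r >= [lbnd g], hence r <= v - [lbnd g]; adding 1 makes this bound
    strict, as [nsuppP] requires. *)
Definition conv (f g : nov) (v : R) : C :=
  \sum_(r <- nsupp f (v - lbnd g + 1)) f r * g (v - r).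

Lemma convE (f g : nov) v s : uniq s ->
  (forall r, f r != 0 -> g (v - r) != 0 -> r \in s) ->
  conv f g v = \sum_(r <- s) f r * g (v - r).
Proof.
move=> us hs; apply: eq_big_support => //; first exact: nsupp_uniq.
move=> r; rewrite mulf_eq0 negb_or => /andP[fr gr].
rewrite hs // nsuppP //.
by have := lbndP gr; lra.
Qed.

Lemma conv_neq0 (f g : nov) v : conv f g v != 0 ->
  exists r, f r != 0 /\ g (v - r) != 0.
Proof.
move=> h; apply: contrapT => n.
move/negP: h; apply; apply/eqP; rewrite /conv big1 // => r _.
apply/eqP; apply: contrapT => /negP.
by rewrite mulf_eq0 negb_or => /andP[fr gr]; apply: n; exists r.
Qed.

Lemma conv_lf (f g : nov) : left_finite (conv f g).
Proof.
move=> B.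
exists [seq x + y | x <- nsupp f (B - lbnd g), y <- nsupp g (B - lbnd f)].
move=> v vB /conv_neq0[r [fr gr]].
apply/allpairsP; exists (r, v - r) => /=; split.
- by apply: nsuppP => //; have := lbndP gr; lra.
- by apply: nsuppP => //; have := lbndP fr; lra.
- by rewrite addrC subrK.
Qed.

Lemma add_lf (f g : nov) : left_finite (fun r => f r + g r).
Proof.
move=> B; exists (nsupp f B ++ nsupp g B) => r rB h; rewrite mem_cat.
have [f0|f0] := eqVneq (f r) 0; last by rewrite nsuppP.
by rewrite (nsuppP (f := g)) ?orbT //; move: h; rewrite f0 add0r.
Qed.

Lemma opp_lf (f : nov) : left_finite (fun r => - f r).
Proof. by move=> B; exists (nsupp f B) => r rB; rewrite oppr_eq0; apply: nsuppP. Qed.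

Lemma mono_lf (c : C) (a : R) : left_finite (fun r => if r == a then c else 0).
Proof. by move=> B; exists [:: a] => r _; rewrite inE; case: (r == a); rewrite ?eqxx. Qed.

Definition nmono c a : nov := mknov (mono_lf c a).
Definition nadd f g : nov := mknov (add_lf f g).
Definition nopp f : nov := mknov (opp_lf f).
Definition nmul f g : nov := mknov (conv_lf f g).
Definition n0 : nov := nmono 0 0.
Definition n1 : nov := nmono 1 0.

Lemma n0E r : n0 r = 0. Proof. by rewrite /=; case: eqP. Qed.

Lemma naddA : associative nadd.
Proof. by move=> f g h; apply: novP => r /=; rewrite addrA. Qed.
Lemma naddC : commutative nadd.
Proof. by move=> f g; apply: novP => r /=; rewrite addrC. Qed.
Lemma nadd0 : left_id n0 nadd.
Proof. by move=> f; apply: novP => r /=; case: eqP; rewrite add0r. Qed.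
Lemma naddN : left_inverse n0 nopp nadd.
Proof. by move=> f; apply: novP => r /=; case: eqP; rewrite addNr. Qed.

HB.instance Definition _ := GRing.isZmodule.Build nov naddA naddC nadd0 naddN.

Lemma nmulC : commutative nmul.
Proof.
move=> f g; apply: novP => v /=.
pose s := nsupp f (v - lbnd g + 1).
rewrite (@convE g f v [seq v - r | r <- s]).
- rewrite big_map /conv; apply: eq_bigr => r _.
  by rewrite mulrC; congr (_ * f _); lra.
- by rewrite map_inj_uniq ?nsupp_uniq // => x y; lra.
- move=> r gr fr; apply/mapP; exists (v - r); last by lra.
  by apply: nsuppP => //; have := lbndP gr; lra.
Qed.

Lemma nmul1 : left_id n1 nmul.
Proof.
move=> f; apply: novP => v /=; rewrite (@convE _ _ _ [:: 0]) //.
  by rewrite big_seq1 /= eqxx mul1r subr0.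
by move=> r /=; case: (r =P 0) => [-> _|_]; rewrite ?inE ?eqxx.
Qed.

Lemma nmulDl : left_distributive nmul nadd.
Proof.
move=> f g h; apply: novP => v /=.
pose s := undup (nsupp f (v - lbnd h + 1) ++ nsupp g (v - lbnd h + 1)).
have us : uniq s by apply: undup_uniq.
rewrite !(@convE _ _ v s) //.
- by rewrite -big_split; apply: eq_bigr => r _ /=; rewrite mulrDl.
- move=> r gr hr; rewrite mem_undup mem_cat (nsuppP (f := g)) ?orbT //.
  by have := lbndP hr; lra.
- move=> r gr hr; rewrite mem_undup mem_cat (nsuppP (f := f)) //.
  by have := lbndP hr; lra.
- move=> r /=; have [->|f0 _] := eqVneq (f r) 0; last first.
    move=> hr; rewrite mem_undup mem_cat (nsuppP (f := f)) //.
    by have := lbndP hr; lra.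
  rewrite add0r => gr hr; rewrite mem_undup mem_cat (nsuppP (f := g)) ?orbT //.
  by have := lbndP hr; lra.
Qed.

Lemma nmulA : associative nmul.
Proof.
move=> f g h; apply: novP => v /=.
(* In a nonzero product of coefficients whose exponents add up to v, each exponent is at most v
   minus the lower bounds of the two other factors, hence below [B]. *)
pose B := `|v| + `|lbnd f| + `|lbnd g| + `|lbnd h| + 1.
have hn (x : R) : - `|x| <= x /\ x <= `|x| by have := ler_norm x; have := ler_norm (- x); rewrite normrN; lra.
have [vl vr] := hn v; have [fl fr] := hn (lbnd f).
have [gl gr] := hn (lbnd g); have [hl hr] := hn (lbnd h).
pose sf := nsupp f B; pose sg := nsupp g B.
pose U := undup [seq x + y | x <- sf, y <- sg].
have uU : uniq U by apply: undup_uniq.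
rewrite (@convE f (nmul g h) v sf) ?nsupp_uniq //; last first.
  move=> r f0 /conv_neq0[u [g0 h0]]; apply: nsuppP => //.
  by have := lbndP g0; have := lbndP h0; rewrite /B; lra.
rewrite (@convE (nmul f g) h v U) //; last first.
  move=> r /conv_neq0[u [f0 g0]] h0; rewrite mem_undup; apply/allpairsP.
  exists (u, r - u) => /=; split; last by lra.
  - by apply: nsuppP => //; have := lbndP g0; have := lbndP h0; rewrite /B; lra.
  - by apply: nsuppP => //; have := lbndP f0; have := lbndP h0; rewrite /B; lra.
under [RHS]eq_bigr => u _.
  have -> : (nmul f g) u * h (v - u) = \sum_(r <- sf) f r * (g (u - r) * h (v - u)).
    have [->|h0] := eqVneq (h (v - u)) 0.
      by rewrite mulr0 big1 // => r _; rewrite !mulr0.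
    rewrite /= (@convE f g u sf) ?nsupp_uniq //.
      by rewrite mulr_suml; apply: eq_bigr => r _; rewrite mulrA.
    move=> r f0 g0; apply: nsuppP => //.
    by have := lbndP g0; have := lbndP h0; rewrite /B; lra.
  over.
rewrite exchange_big; apply: eq_big_seq => r rsf /=.
rewrite -mulr_sumr; have [->|f0] := eqVneq (f r) 0; first by rewrite !mul0r.
congr (_ * _).
rewrite (@convE g h (v - r) [seq u - r | u <- U]).
- by rewrite big_map; apply: eq_bigr => u _; congr (_ * h _); lra.
- by rewrite map_inj_uniq // => x y; lra.
- move=> u g0 h0; apply/mapP; exists (r + u); last by lra.
  rewrite mem_undup; apply/allpairsP; exists (r, u); split => //=.
  by apply: nsuppP => //; have := lbndP f0; have := lbndP h0; rewrite /B; lra.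
Qed.

Lemma n1_neq0 : n1 != 0 :> nov.
Proof.
apply/eqP => /(congr1 (fun f : nov => f 0)) /=.
by rewrite eqxx; apply/eqP; rewrite oner_eq0.
Qed.

HB.instance Definition _ :=
  GRing.Zmodule_isComNzRing.Build nov nmulA nmulC nmul1 nmulDl n1_neq0.

Lemma nov0E r : (0 : nov) r = 0. Proof. exact: n0E. Qed.
Lemma novDE (f g : nov) r : (f + g) r = f r + g r. Proof. by []. Qed.
Lemma novNE (f : nov) r : (- f) r = - f r. Proof. by []. Qed.
Lemma novBE (f g : nov) r : (f - g) r = f r - g r. Proof. by []. Qed.
Lemma nov_sumE I (s : seq I) P (F : I -> nov) r :
  (\sum_(i <- s | P i) F i) r = \sum_(i <- s | P i) F i r.
Proof.
apply: (big_morph (fun f : nov => f r)) => //; exact: nov0E.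
Qed.

Lemma nmonoE c a r : nmono c a r = if r == a then c else 0. Proof. by []. Qed.

Lemma nmonoM c a d b : nmono c a * nmono d b = nmono (c * d) (a + b).
Proof.
apply: novP => v /=; rewrite (@convE _ _ v [:: a]) //; last first.
  by move=> r /=; case: (r =P a) => [->|_]; rewrite ?inE ?eqxx.
rewrite big_seq1 /= eqxx; have -> : (v - a == b) = (v == a + b).
  by apply/eqP/eqP; lra.
by case: eqP; rewrite ?mulr0.
Qed.

Lemma nmono_addl c d a : nmono (c + d) a = nmono c a + nmono d a.
Proof. by apply: novP => v; rewrite novDE /=; case: eqP; rewrite ?addr0. Qed.

(** * Valuations of series *)

Definition vge (f : nov) (r : R) : Prop := forall v, v < r -> f v = 0.
Definition hasval (f : nov) (r : R) : Prop := vge f r /\ f r != 0.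

Lemma vge0 r : vge 0 r. Proof. by move=> v _; rewrite nov0E. Qed.
Lemma vgeD f g r : vge f r -> vge g r -> vge (f + g) r.
Proof. by move=> hf hg v vr; rewrite novDE hf // hg // addr0. Qed.
Lemma vgeN f r : vge f r -> vge (- f) r.
Proof. by move=> hf v vr; rewrite novNE hf // oppr0. Qed.
Lemma vge_le f r s : s <= r -> vge f r -> vge f s.
Proof. by move=> sr hf v vs; apply: hf; apply: lt_le_trans sr. Qed.

(** The only pair of exponents that can reach r + s is (r, s). Recording the coefficient there makes
    valuations additive, because C has no zero divisors. *)
Lemma vgeM f g r s : vge f r -> vge g s ->
  vge (f * g) (r + s) /\ (f * g) (r + s) = f r * g s.
Proof.
move=> hf hg; split=> [v vrs|].
  apply/eqP; apply: contrapT => /negP /conv_neq0[u [fu gu]].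
  have ur : r <= u by rewrite leNgt; apply: contra fu => /hf ->.
  have us : s <= v - u by rewrite leNgt; apply: contra gu => /hg ->.
  by lra.
rewrite /= (@convE _ _ _ [:: r]) //; first by rewrite big_seq1; congr (_ * g _); lra.
move=> u fu gu.
have ur : r <= u by rewrite leNgt; apply: contra fu => /hf ->.
have us : s <= r + s - u by rewrite leNgt; apply: contra gu => /hg ->.
by rewrite inE; apply/eqP; lra.
Qed.

Lemma hasvalM f g r s : hasval f r -> hasval g s -> hasval (f * g) (r + s).
Proof.
move=> [f1 f2] [g1 g2]; have [h1 h2] := vgeM f1 g1.
by split=> //; rewrite h2 mulf_neq0.
Qed.

Lemma hasvalN f r : hasval f r -> hasval (- f) r.
Proof. by move=> [h1 h2]; split; [exact: vgeN | rewrite novNE oppr_eq0]. Qed.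

Lemma hasval_mono c a : c != 0 -> hasval (nmono c a) a.
Proof.
by move=> c0; split=> [v va|]; rewrite /= ?eqxx // lt_eqF.
Qed.

Lemma vge_mono c a : vge (nmono c a) a.
Proof. by move=> v va; rewrite /= lt_eqF. Qed.

Lemma hasval1 : hasval 1 0.
Proof. exact: hasval_mono (oner_neq0 _). Qed.

Lemma hasval_neq0 f r : hasval f r -> f != 0.
Proof. by move=> [_]; apply: contra => /eqP ->; rewrite nov0E. Qed.

Lemma hasvalDl f g r s : hasval f r -> vge g s -> r < s -> hasval (f + g) r.
Proof.
move=> [f1 f2] g1 rs; split.
  by apply: vgeD => //; apply: vge_le g1; apply: ltW.
by rewrite novDE (g1 r) // addr0.
Qed.

Lemma hasval_uniq f r s : hasval f r -> hasval f s -> r = s.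
Proof.
move=> [f1 f2] [f3 f4]; apply/eqP; rewrite eq_le !leNgt.
by apply/andP; split; apply/negP => h; [move: f4; rewrite f1 ?eqxx | move: f2; rewrite f3 ?eqxx].
Qed.

(** Any exponent r0 of f bounds the search: the finitely many exponents below r0 + 1 contain a least
    one. *)
Lemma nov_hasval f : f != 0 -> exists r, hasval f r.
Proof.
move=> f0; have [r0 fr0] : exists r, f r != 0.
  apply: contrapT => n; move/eqP: f0; apply; apply: novP => r; rewrite nov0E.
  by apply/eqP; apply: contrapT => /negP h; apply: n; exists r.
pose s := [seq r <- nsupp f (r0 + 1) | f r != 0].
have r0s : r0 \in s by rewrite mem_filter fr0 nsuppP // ltrDl.
have ms : \big[Num.min/r0]_(r <- s) r \in s.
  have : {subset s <= s} by [].
  elim: {1 3}s => [|x t IH] h; first by rewrite big_nil.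
  rewrite big_cons; case: leP => _; first by apply: h; rewrite inE eqxx.
  by apply: IH => y yt; apply: h; rewrite inE yt orbT.
exists (\big[Num.min/r0]_(r <- s) r); split; last by move: ms; rewrite mem_filter => /andP[].
have mle r : r \in s -> \big[Num.min/r0]_(r <- s) r <= r.
  elim: (s) => // x t IH; rewrite inE big_cons ge_min => /orP[/eqP ->|/IH ->]; by rewrite ?lexx ?orbT.
move=> v vm; apply/eqP; apply: contrapT => /negP fv.
have : v \in s.
  rewrite mem_filter fv nsuppP //; apply: lt_trans vm _.
  by apply: le_lt_trans (mle _ r0s) _; rewrite ltrDl.
by move/mle; rewrite leNgt vm.
Qed.

Lemma nov_mulf_eq0 (f g : nov) : f * g = 0 -> f = 0 \/ g = 0.
Proof.
move=> fg; have [->|/nov_hasval[r hr]] := eqVneq f 0; first by left.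
have [->|/nov_hasval[s hs]] := eqVneq g 0; first by right.
by have := hasval_neq0 (hasvalM hr hs); rewrite fg eqxx.
Qed.

End Novikov.

(** * Embedding of the Puiseux series *)

Section Puiseux.
Variable R : realType.
Local Notation C := R[i].
Implicit Types x y : puiseux R.

Lemma absz_addK (m : int) (k : nat) : `|(m + k%:Z - m)%R|%N = k.
Proof. by rewrite addrC addKr. Qed.

Lemma pz_coeff_int x (j : int) :
  pz_coeff x (j%:~R / (pz_den x).+1%:R) =
  if pz_ord x <= j then pz_coef x `|j - pz_ord x|%N else 0.
Proof.
by rewrite /pz_coeff divfK ?pnatr_eq0 // denq_int numq_int eqxx.
Qed.

Lemma pz_coeff_neq0 x q : pz_coeff x q != 0 ->
  exists k : nat, q = (pz_ord x + k%:Z)%:~R / (pz_den x).+1%:R.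
Proof.
rewrite /pz_coeff; case: ifP => [/andP[/eqP d1 le] _|]; last by rewrite eqxx.
exists `|numq (q * (pz_den x).+1%:R) - pz_ord x|%N.
have -> : pz_ord x + `|numq (q * (pz_den x).+1%:R) - pz_ord x|%N%:Z
  = numq (q * (pz_den x).+1%:R).
  by rewrite gez0_abs ?subr_ge0 // subrKC.
transitivity (q * (pz_den x).+1%:R / (pz_den x).+1%:R); first by rewrite mulfK ?pnatr_eq0.
by congr (_ / _); rewrite -[in LHS](divq_num_den (q * _)) d1 divr1.
Qed.

(** Two series are added or multiplied over a common denominator; this reads the coefficients of one
    of them on the finer grid, where the stretched sequence is 0 off the old grid. *)
Lemma pz_coeff_stretch x (M : nat) (j : int) : (0 < M)%N ->
  pz_coeff x (j%:~R / ((pz_den x).+1 * M)%N%:R) =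
  if pz_ord x * M%:Z <= j then stretch (pz_coef x) M `|j - (pz_ord x * M%:Z)%R|%N else 0.
Proof.
move=> M0; have M0z : (0 : int) < M%:Z by rewrite ltz_nat.
have [/dvdzP[j' ->]|nd] := boolP (M%:Z %| j)%Z.
  have -> : (j' * M%:Z)%:~R / ((pz_den x).+1 * M)%N%:R = j'%:~R / (pz_den x).+1%:R :> rat.
    rewrite intrM natrM invfM mulrACA pmulrn divff ?mulr1 //.
    by rewrite intr_eq0 gt_eqF.
  rewrite pz_coeff_int ler_pM2r // -mulrBl abszM /=; case: ifP => // _.
  by rewrite /stretch dvdn_mull // mulnK.
have -> : pz_coeff x (j%:~R / ((pz_den x).+1 * M)%N%:R) = 0.
  apply/eqP/negP => /negP /pz_coeff_neq0[k /eqP].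
  rewrite natrM invfM mulrA [_ / _ / M%:R]mulrAC.
  rewrite (can2_eq (divfK _) (mulfK _)) ?pnatr_eq0 ?mulfVK ?pnatr_eq0 //.
  rewrite -[M%:R]/(M%:Z%:~R) => /eqP h; move/negP: nd; apply.
  have {}h : j%:~R = ((pz_ord x + k%:Z) * M%:Z)%:~R :> rat.
    rewrite intrM -(divfK (_ : M%:R != 0) j%:~R) ?pnatr_eq0 -?lt0n // h.
    by rewrite ?pmulrn.
  by move/intr_inj: h => ->; rewrite dvdz_mull.
case: ifP => // le; rewrite /stretch; case: ifP => // dv.
move/negP: nd; case.
have : (M%:Z %| j - pz_ord x * M%:Z)%Z by rewrite dvdzE.
by rewrite rpredBr // dvdz_mull.
Qed.

(** The exponent q is unique since [ratr] is injective; irrational exponents receive the coefficient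
    0. *)
Definition embf x (r : R) : C :=
  if pselect (exists q : rat, ratr q == r) is left h then pz_coeff x (xchoose h) else 0.

Lemma embfE x q : embf x (ratr q) = pz_coeff x q.
Proof.
rewrite /embf; case: pselect => [h|n]; last by case: n; exists q.
by have /eqP/fmorph_inj -> := xchooseP h.
Qed.

Lemma embf_neq0 x r : embf x r != 0 -> exists q : rat, r = ratr q /\ pz_coeff x q != 0.
Proof.
rewrite /embf; case: pselect => [h|n]; last by rewrite eqxx.
by move=> c0; exists (xchoose h); split=> //; have /eqP := xchooseP h.
Qed.

Lemma emb_lf x : left_finite (embf x).
Proof.
move=> B; pose N := (pz_den x).+1.
pose K := (Num.Def.truncn (`|B| * N%:R + `|(pz_ord x)%:~R| : R)).+1.
exists [seq ratr ((pz_ord x + k%:Z)%:~R / N%:R) | k : nat <- iota 0 K.+1].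
move=> r rB /embf_neq0[q [rq /pz_coeff_neq0[k qk]]].
apply/mapP; exists k; last by rewrite rq qk.
rewrite mem_iota /= add0n ltnS; move: rB; rewrite rq qk.
rewrite fmorph_div /= ratr_int ratr_nat ltr_pdivrMr ?ltr0n // intrD -pmulrn => rB.
rewrite -(ler_nat R) ltW //; apply: lt_trans (truncnS_gt _).
move: rB; rewrite -/N => rB.
have N0 : 0 <= N%:R :> R by [].
have := ler_wpM2r N0 (ler_norm B).
have := ler_norm (- (pz_ord x)%:~R : R); rewrite normrN. lra.
Qed.

Definition emb x : nov R := mknov (emb_lf x).

Lemma embE x q : emb x (ratr q) = pz_coeff x q.
Proof. exact: embfE. Qed.

Lemma emb_neq0 x r : emb x r != 0 -> exists q : rat, r = ratr q /\ pz_coeff x q != 0.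
Proof. exact: embf_neq0. Qed.

Lemma emb_irr x r : (forall q : rat, r <> ratr q) -> emb x r = 0.
Proof.
by move=> h; apply/eqP/negP => /negP /emb_neq0[q [/h]].
Qed.

Lemma emb_ratP x (g : nov R) :
  (forall q, pz_coeff x q = g (ratr q)) -> (forall r, (forall q : rat, r <> ratr q) -> g r = 0) ->
  emb x = g.
Proof.
move=> h1 h2; apply: novP => r.
have [[q ->]|n] := pselect (exists q : rat, r = ratr q); first by rewrite embE h1.
have {}n q : r <> ratr q by move=> e; apply: n; exists q.
by rewrite emb_irr // h2.
Qed.

Lemma emb_eq x y : pz_eq x y <-> emb x = emb y.
Proof.
split=> [h|h q]; last by rewrite -!embE h.
by apply: emb_ratP => [q|r]; rewrite ?embE //; apply: emb_irr.
Qed.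

Lemma emb_zero x : pz_zero x <-> emb x = 0.
Proof.
split=> [h|h q]; last by rewrite -embE h nov0E.
by apply: emb_ratP => [q|r _]; rewrite ?nov0E.
Qed.

Lemma emb_pzC a : emb (pzC a) = nmono a 0.
Proof.
apply: emb_ratP => [q|r h]; last first.
  by rewrite nmonoE; case: eqP => // r0; case: (h 0); rewrite rmorph0.
rewrite nmonoE fmorph_eq0; case: eqP => [->|/eqP q0].
  by rewrite /pz_coeff mul0r.
apply/eqP/negP => /negP h; have [k /= qk] := pz_coeff_neq0 h.
move: h; rewrite qk add0r (pz_coeff_int (pzC a))  /= addn0.
by case: k qk => [|k] qk; rewrite ?eqxx //; rewrite qk add0r mul0r eqxx in q0.
Qed.

Let prodK (m n : nat) : ((m.+1 * n.+1).-1.+1 = m.+1 * n.+1)%N.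
Proof. by rewrite prednK. Qed.

Lemma stretch_not_frac x (M : nat) q : (0 < M)%N ->
  (forall j : int, q <> j%:~R / ((pz_den x).+1 * M)%N%:R) -> pz_coeff x q = 0.
Proof.
move=> M0 h; apply/eqP/negP => /negP /pz_coeff_neq0[k qk].
apply: (h ((pz_ord x + k%:Z) * M%:Z)); rewrite qk intrM natrM invfM mulrACA.
by rewrite -pmulrn divff ?mulr1 // pnatr_eq0 -lt0n.
Qed.

Lemma pz_coeff_add x y q : pz_coeff (pzadd x y) q = pz_coeff x q + pz_coeff y q.
Proof.
set Nx := (pz_den x).+1; set Ny := (pz_den y).+1.
have [[j ->]|n] := pselect (exists j : int, q = j%:~R / (Nx * Ny)%N%:R); last first.
  have n' (j : int) : q <> j%:~R / (Nx * Ny)%N%:R by move=> e; apply: n; exists j.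
  rewrite (stretch_not_frac (x := x) (M := Ny)) //.
  rewrite (stretch_not_frac (x := y) (M := Nx)) // 1?mulnC // addr0.
  by apply: (stretch_not_frac (M := 1)) => // j; rewrite /= prodK muln1.
have := pz_coeff_int (pzadd x y) j; rewrite /= prodK -/Nx -/Ny => ->.
rewrite (pz_coeff_stretch x) // [X in _ + pz_coeff y (_ / X%:R)]mulnC (pz_coeff_stretch y) //.
set mx := pz_ord x * _; set my := pz_ord y * _.
have sx : 0 <= mx - Num.min mx my by rewrite subr_ge0 ge_min lexx.
have sy : 0 <= my - Num.min mx my by rewrite subr_ge0 ge_min lexx orbT.
case: ifP => [le|nle]; last first.
  have -> : (mx <= j) = false by apply: contraFF nle => h; rewrite ge_min h.
  have -> : (my <= j) = false by apply: contraFF nle => h; rewrite ge_min h orbT.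
  by rewrite addr0.
have H (m : int) (M : nat) c : 0 <= m - Num.min mx my ->
    (if (`|(m - Num.min mx my)%R| <= `|(j - Num.min mx my)%R|)%N
     then stretch c M (`|(j - Num.min mx my)%R| - `|(m - Num.min mx my)%R|)%N else 0)
   = (if m <= j then stretch c M `|(j - m)%R|%N else 0) :> C.
  move=> hm; have -> : (`|(m - Num.min mx my)%R| <= `|(j - Num.min mx my)%R|)%N = (m <= j).
    by apply/idP/idP; lia.
  by case: ifP => // mj; congr stretch; lia.
by rewrite !H.
Qed.

Lemma emb_add x y : emb (pzadd x y) = emb x + emb y.
Proof.
apply: emb_ratP => [q|r h]; first by rewrite novDE !embE pz_coeff_add.
by rewrite novDE !emb_irr ?addr0.
Qed.

(** Exponents are moved to the grid [fr] of the common denominator. The product in [nov] is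
    supported on the points [fr (m + k)], where the convolution is the Cauchy product of the
    stretched sequences. *)
Lemma emb_mul x y : emb (pzmul x y) = emb x * emb y.
Proof.
set Nx := (pz_den x).+1; set Ny := (pz_den y).+1.
pose m := pz_ord x * Ny%:Z + pz_ord y * Nx%:Z.
pose fr (j : int) : rat := j%:~R / (Nx * Ny)%N%:R.
have N0 : ((Nx * Ny)%N%:R : rat) != 0 by rewrite pnatr_eq0.
have frx (j : int) : pz_coeff x (fr j) =
    if pz_ord x * Ny%:Z <= j then stretch (pz_coef x) Ny `|j - (pz_ord x * Ny%:Z)%R|%N else 0.
  by apply: pz_coeff_stretch.
have fry (j : int) : pz_coeff y (fr j) =
    if pz_ord y * Nx%:Z <= j then stretch (pz_coef y) Nx `|j - (pz_ord y * Nx%:Z)%R|%N else 0.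
  by rewrite /fr mulnC; apply: pz_coeff_stretch.
have nzx q : pz_coeff x q != 0 -> exists i : nat, q = fr (pz_ord x * Ny%:Z + i%:Z).
  move=> h; have [[j qj]|n] := pselect (exists j : int, q = fr j); last first.
    move: h; rewrite (stretch_not_frac (x := x) (M := Ny)) ?eqxx // => j e.
    by apply: n; exists j.
  move: h; rewrite qj frx; case: ifP => [le _|]; last by rewrite eqxx.
  by exists `|(j - pz_ord x * Ny%:Z)%R|%N; congr fr; lia.
have nzy q : pz_coeff y q != 0 -> exists i : nat, q = fr (pz_ord y * Nx%:Z + i%:Z).
  move=> h; have [[j qj]|n] := pselect (exists j : int, q = fr j); last first.
    move: h; rewrite (stretch_not_frac (x := y) (M := Nx)) ?eqxx // => j e.
    by apply: n; exists j; rewrite e mulnC.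
  move: h; rewrite qj fry; case: ifP => [le _|]; last by rewrite eqxx.
  by exists `|(j - pz_ord y * Nx%:Z)%R|%N; congr fr; lia.
have frD a b : fr a + fr b = fr (a + b) by rewrite /fr -mulrDl intrD.
have fr_inj : injective fr.
  by move=> a b /(mulIf _) h; apply: (@intr_inj rat); apply: h; rewrite invr_eq0.
have supp r : (emb x * emb y) r != 0 -> exists k : nat, r = ratr (fr (m + k%:Z)).
  move=> /conv_neq0[u [/emb_neq0[q [-> /nzx[i ->]]] /emb_neq0[q' [e /nzy[i' ee]]]]].
  exists (i + i')%N; have -> : r = ratr (fr (pz_ord x * Ny%:Z + i%:Z)) + ratr q'.
    by rewrite -e subrKC.
  by rewrite ee -rmorphD frD; congr (ratr (fr _)); rewrite /m PoszD; ring.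
apply: emb_ratP => [q|r h]; last first.
  by apply/eqP/negP => /negP /supp[k /h].
have [[k ->]|n] := pselect (exists k : nat, q = fr (m + k%:Z)); last first.
  have -> : (emb x * emb y) (ratr q) = 0.
    by apply/eqP/negP => /negP /supp[k /fmorph_inj e]; apply: n; exists k.
  apply/eqP/negP => /negP /pz_coeff_neq0[k]; rewrite /= prodK -/Nx -/Ny => e.
  by apply: n; exists k.
have := pz_coeff_int (pzmul x y) (m + k%:Z); rewrite /= prodK -/Nx -/Ny -/m => e.
rewrite [LHS]e lerDl lez_nat absz_addK.
rewrite /= (@convE _ _ _ _ [seq ratr (fr (pz_ord x * Ny%:Z + i%:Z)) | i : nat <- iota 0 k.+1]).
- rewrite big_map -[iota 0 k.+1]/(index_iota 0 k.+1) big_mkord; apply: eq_bigr => i _.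
  rewrite -rmorphB /= !embfE frx lerDl lez_nat /=.
  have -> : fr (m + k) - fr (pz_ord x * Ny%:Z + i%:Z) = fr (pz_ord y * Nx%:Z + (k - i)%N%:Z).
    apply/eqP; rewrite subr_eq frD; apply/eqP; congr fr.
    by rewrite /m -subzn -1?ltnS //; ring.
  by rewrite fry lerDl lez_nat !absz_addK.
- rewrite map_inj_uniq ?iota_uniq // => a b /fmorph_inj /fr_inj; lia.
- move=> r /embf_neq0[q' [-> /nzx[i ->]]]; rewrite -rmorphB => /embf_neq0[q'' [/fmorph_inj <-]].
  move=> /nzy[i' /eqP]; rewrite subr_eq frD => /eqP /fr_inj ee.
  apply/mapP; exists i => //; rewrite mem_iota /= add0n ltnS.
  by move: ee; rewrite /m; lia.
Qed.

Lemma pz_val_None x : pz_val x = None -> emb x = 0.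
Proof.
rewrite /pz_val; case: pselect => // n _; apply/emb_zero => q.
apply/eqP/negP => /negP h; have [k qk] := pz_coeff_neq0 h; apply: n; exists k.
by move: h; rewrite qk pz_coeff_int lerDl lez_nat absz_addK.
Qed.

Lemma pz_val_Some x q : pz_val x = Some q -> hasval (emb x) (ratr q).
Proof.
rewrite /pz_val; case: pselect => // ex [<-]; case: ex_minnP => k kn kmin.
have E (j : nat) : pz_coeff x ((pz_ord x + j%:Z)%:~R / (pz_den x).+1%:R) = pz_coef x j.
  by rewrite pz_coeff_int lerDl lez_nat absz_addK.
split; last by rewrite embE E.
move=> v vq; apply/eqP/negP => /negP /emb_neq0[q' [vq' h]].
have [j qj] := pz_coeff_neq0 h; move: h; rewrite qj E => /kmin kj.
move: vq; rewrite vq' qj ltr_rat ltr_pM2r ?invr_gt0 ?ltr0n // ltr_int ltrD2l ltz_nat.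
by rewrite ltnNge kj.
Qed.

Lemma pz_val_mono x c : emb x = nmono c 0 -> c != 0 -> pz_val x = Some 0.
Proof.
move=> ex c0; case E : (pz_val x) => [q|].
  have := hasval_uniq (pz_val_Some E); rewrite ex => /(_ _ (hasval_mono _ c0)).
  by move/eqP; rewrite fmorph_eq0 => /eqP ->.
have := hasval_neq0 (hasval_mono 0 c0); by rewrite -ex (pz_val_None E) eqxx.
Qed.

End Puiseux.

(** * Evaluation and the set form of the Wick relations *)

Section Evaluation.
Variables (R : realType) (n : nat).
Local Notation sets := {set 'I_n}.
Implicit Types (P Q : kpoly R n) (a b : monom n) (w : sets -> nov R).

Definition mv w a : nov R := \prod_(S : sets) w S ^+ a S.
(** The linear extension of phi from monomials to polynomials: [phi = mv w] evaluates at w, and the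
    indicator of a monomial extracts a coefficient. *)
Definition psum (phi : monom n -> nov R) P : nov R := \sum_(t <- P) emb t.1 * phi t.2.
Definition Ev w P : nov R := psum (mv w) P.

Lemma mv_add w a b : mv w (monadd a b) = mv w a * mv w b.
Proof. by rewrite -big_split; apply: eq_bigr => S _; rewrite ffunE exprD. Qed.

Lemma mv_monS w S : mv w (monS S) = w S.
Proof.
rewrite /mv (bigD1 S) //= big1 ?mulr1 => [|T TS]; rewrite ffunE ?eqxx ?expr1 //.
by rewrite (negbTE TS).
Qed.

Lemma psum_cat phi P Q : psum phi (P ++ Q) = psum phi P + psum phi Q.
Proof. exact: big_cat. Qed.

Lemma nmono0 r : nmono (0 : R[i]) r = 0.
Proof. by apply: novP => v; rewrite nmonoE if_same nov0E. Qed.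

Lemma emb_pcoef P a : emb (pcoef P a) = \sum_(t <- P | t.2 == a) emb t.1.
Proof.
rewrite /pcoef -big_filter; elim: [seq t <- P | _] => [|t s IH] /=.
  by rewrite big_nil emb_pzC nmono0.
by rewrite big_cons emb_add IH.
Qed.

(** A formal sum may repeat a monomial. Collecting its terms makes [psum] a function of the
    coefficients [pcoef] alone, hence compatible with [peq]. *)
Lemma psum_regroup phi P (s : seq (monom n)) : uniq s ->
  {subset [seq t.2 | t <- P] <= s} ->
  psum phi P = \sum_(a <- s) emb (pcoef P a) * phi a.
Proof.
move=> us sub; rewrite /psum.
under [RHS]eq_bigr => a _ do rewrite emb_pcoef big_mkcond mulr_suml.
rewrite exchange_big /=.
have E (t : puiseux R * monom n) : t.2 \in s ->
    emb t.1 * phi t.2 = \sum_(a <- s) (if t.2 == a then emb t.1 else 0) * phi a.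
  move=> ts; rewrite (bigD1_seq t.2) //= eqxx big1 ?addr0 // => a.
  by rewrite eq_sym => /negbTE ->; rewrite mul0r.
elim: P sub => [|t P IH] sub; first by rewrite !big_nil.
rewrite !big_cons E ?IH //; first by move=> a aP; apply: sub; rewrite inE aP orbT.
by apply: sub; rewrite inE eqxx.
Qed.

Lemma psum_peq phi P Q : peq P Q -> psum phi P = psum phi Q.
Proof.
move=> PQ; set s := undup [seq t.2 | t <- P ++ Q].
have us : uniq s by apply: undup_uniq.
rewrite (psum_regroup _ us) => [|a aP]; last by rewrite mem_undup map_cat mem_cat aP.
rewrite [RHS](psum_regroup _ us) => [|a aP]; last by rewrite mem_undup map_cat mem_cat aP orbT.
by apply: eq_bigr => a _; rewrite (iffLR (emb_eq _ _) (PQ a)).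
Qed.

Lemma Ev_pmul w P Q : Ev w (pmul P Q) = Ev w P * Ev w Q.
Proof.
rewrite /Ev /psum /pmul big_allpairs_dep mulr_suml; apply: eq_bigr => t _.
rewrite mulr_sumr; apply: eq_bigr => u _ /=.
by rewrite emb_mul mv_add; ring.
Qed.

Lemma ideal_Ev (G : kpoly R n -> Prop) w P :
  (forall Q, G Q -> Ev w Q = 0) -> ideal_gen G P -> Ev w P = 0.
Proof.
move=> h; elim=> [Q /h //||P' Q _ IH1 _ IH2|F Q _ IH|P' Q _ IH PQ].
- exact: big_nil.
- by rewrite /Ev psum_cat -!/(Ev _ _) IH1 IH2 addr0.
- by rewrite Ev_pmul IH mulr0.
- by rewrite /Ev -(psum_peq _ PQ).
Qed.

Lemma emb_pz1 : emb (pz1 R) = 1.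
Proof. by rewrite emb_pzC. Qed.

Lemma emb_exp x k : emb (pzexp x k) = emb x ^+ k :> nov R.
Proof.
elim: k => [|k IH]; first exact: emb_pz1.
by rewrite /pzexp iterS emb_mul -/(pzexp x k) IH exprS.
Qed.

Lemma emb_monval a (w : sets -> puiseux R) : emb (monval a w) = mv (fun S => emb (w S)) a.
Proof.
rewrite /monval /mv -big_enum /=; elim: (enum _) => [|S s IH] /=.
  by rewrite big_nil emb_pz1.
by rewrite big_cons emb_mul emb_exp IH.
Qed.

Lemma emb_peval P (w : sets -> puiseux R) : emb (peval P w) = Ev (fun S => emb (w S)) P.
Proof.
rewrite /peval /Ev /psum; elim: P => [|t P IH] /=.
  by rewrite big_nil emb_pzC nmono0.
by rewrite big_cons emb_add IH emb_mul emb_monval.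
Qed.

(** Through this inclusion a single element of the ideal of the Wick relations excludes a vector
    from both tropical spaces. *)
Lemma ideal_spin_plus P : ideal_gen (@wick_rels R n) P -> spin_plus_ideal P.
Proof.
move=> IP w hw _; apply/emb_zero; rewrite emb_peval.
apply: ideal_Ev IP => _ [sigma [tau ->]].
by rewrite -emb_peval; apply/emb_zero/hw.
Qed.

(* [(-1) ^+ below X k] is the sign of moving [k] from the front of [k :: enum X] to its
   sorted place. *)
Definition below (X : sets) (k : 'I_n) : nat := #|[set y in X | (y < k)%N]|.

Definition ws (rho : seq 'I_n) : nov R := if uniq rho then (-1) ^+ inversions rho else 0.

Lemma nmonoX (c : R[i]) k : nmono c 0 ^+ k = nmono (c ^+ k) 0.
Proof. by elim: k => [|k IH] //; rewrite !exprS IH nmonoM addr0. Qed.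

Lemma nmonoN1 : nmono (-1 : R[i]) 0 = -1.
Proof. by apply: novP => r; rewrite novNE /= ; case: eqP; rewrite ?oppr0. Qed.

Lemma nmono_sign k : nmono ((-1 : R[i]) ^+ k) 0 = (-1) ^+ k.
Proof. by rewrite -nmonoX nmonoN1. Qed.

Lemma nmono_wsign rho : nmono (wsign R rho) 0 = ws rho.
Proof. by rewrite /wsign /ws; case: ifP => _; rewrite ?nmono_sign ?nmono0. Qed.

Lemma emb_wterm k rho1 rho2 :
  emb (wterm ((-1) ^+ k : R[i]) rho1 rho2).1 = (-1) ^+ k * ws rho1 * ws rho2.
Proof.
rewrite /wterm /= emb_pzC -[X in nmono _ X](addr0 0) -nmonoM nmono_wsign.
by rewrite -[X in nmono _ X](addr0 0) -nmonoM nmono_wsign nmono_sign.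
Qed.

Lemma below_count rho k : uniq rho ->
  below [set x in rho] k = count (fun y : 'I_n => (y < k)%N) rho.
Proof.
move=> u; rewrite -size_filter -(card_uniqP (filter_uniq _ u)) /below.
by apply: eq_card => y; rewrite !inE mem_filter andbC.
Qed.

Lemma ws_cons x rho :
  ws (x :: rho) = if x \in rho then 0 else (-1) ^+ below [set x in rho] x * ws rho.
Proof.
rewrite /ws /=; case: (x \in rho) => //=; case: ifP => u; last by rewrite mulr0.
by rewrite exprD below_count.
Qed.

Lemma belowE (X : sets) k : below X k = (\sum_(y in X) (y < k))%N.
Proof.
rewrite /below -sum1_card big_mkcond [RHS]big_mkcond; apply: eq_bigr => y _.
by rewrite !inE; case: (y \in X); case: (y < k)%N.
Qed.

Lemma belowU1 (X : sets) x k : x \notin X -> below (x |: X) k = ((x < k)%N + below X k)%N.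
Proof. by move=> xX; rewrite !belowE big_setU1. Qed.

Lemma belowD1 (X : sets) x k : x \in X -> below X k = ((x < k)%N + below (X :\ x) k)%N.
Proof. by move=> xX; rewrite !belowE (big_setD1 x). Qed.

Lemma big_symd (V : Type) (idx : V) (op : Monoid.com_law idx) (S T : sets) (F : 'I_n -> V) :
  \big[op/idx]_(k in symd S T) F k =
  op (\big[op/idx]_(k in S :\: T) F k) (\big[op/idx]_(k in T :\: S) F k).
Proof.
rewrite (big_setID S); congr (op _ _); apply: eq_bigl => k; rewrite !inE;
  by case: (k \in S); case: (k \in T).
Qed.

(** An element of both S and T is counted twice on the right, which leaves the sign unchanged. *)
Lemma sign_below_symd (S T : sets) k :
  (-1) ^+ below (symd S T) k = (-1) ^+ below S k * (-1) ^+ below T k :> nov R.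
Proof.
rewrite -exprD -signr_odd -[RHS]signr_odd; congr (_ ^+ nat_of_bool _).
rewrite !belowE big_symd /=.
rewrite [in RHS](@big_setID _ _ _ _ S T) [in RHS](@big_setID _ _ _ _ T S) /= (setIC T).
by rewrite addnACA addnn [in RHS]oddD odd_double.
Qed.

Lemma symd_1_notin (S : sets) k : k \notin S -> symd S [set k] = k |: S.
Proof.
move=> kS; apply/setP => y; rewrite !inE; case: (y =P k) => [->|_]; rewrite ?(negbTE kS) //=.
by case: (y \in S).
Qed.

Lemma symd_1_in (S : sets) k : k \in S -> symd S [set k] = S :\ k.
Proof.
move=> kS; apply/setP => y; rewrite !inE; case: (y =P k) => [->|_]; rewrite ?kS //=.
by case: (y \in S).
Qed.

Lemma zip_mapr (T U V : Type) (f : U -> V) (s : seq T) (t : seq U) :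
  zip s (map f t) = [seq (p.1, f p.2) | p <- zip s t].
Proof. by elim: s t => [|x s IH] [|y t] //=; rewrite IH. Qed.

(** Moving an entry to the front and then sorting it back compares the sign of s with that of s
    without the entry: the position contributes one sign and [below] the other. If s has a repeated
    entry, the right side is 0 and the removals of its two copies cancel. *)
Lemma picks_sum (s : seq 'I_n) (psi : 'I_n -> sets -> nov R) (i0 : nat) :
  \sum_(ip <- zip (iota i0 (size s)) (picks s))
     (-1) ^+ ip.1 * (ws ip.2.2 * psi ip.2.1 [set x in ip.2.2]) =
  (-1) ^+ i0 * ws s * \sum_(k in [set x in s])
     (-1) ^+ below [set x in s] k * psi k ([set x in s] :\ k).
Proof.
elim: s psi i0 => [|x s IH] psi i0 /=.
  by rewrite big_nil big1 ?mulr0 // => k; rewrite inE.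
(* [psi'] puts the head x back into the remaining set, with the sign of sorting it in, so that the
   induction hypothesis covers the removals from the tail. *)
pose psi' y (X : sets) : nov R :=
  if x \in X then 0 else (-1) ^+ below X x * psi y (x |: X).
rewrite big_cons /= zip_mapr big_map /=.
rewrite (eq_bigr (fun ip => (-1) ^+ ip.1 * (ws ip.2.2 * psi' ip.2.1 [set x in ip.2.2])));
  last first.
  move=> [i [y r]] _ /=; congr (_ * _); rewrite ws_cons set_cons /psi' inE.
  by case: (x \in r); rewrite ?mul0r ?mulr0 //; ring.
rewrite IH exprS mulN1r ws_cons set_cons; set S := [set x in s].
have xS : (x \in s) = (x \in S) by rewrite inE.
rewrite xS; case: (boolP (x \in S)) => xinS.
  rewrite mulr0 mul0r (bigD1 x) //= big1 => [|k /andP[kS kx]]; last first.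
    by rewrite /psi' in_setD1 eq_sym kx xinS mulr0.
  rewrite /psi' in_setD1 eqxx /= setD1K // (belowD1 x xinS) ltnn add0n addr0.
  by rewrite [X in _ + _ * X]mulrA -exprMn mulrNN mulr1 expr1n mul1r; ring.
rewrite big_setU1 //= (setU1K xinS) belowU1 // ltnn add0n.
have E : \sum_(k in S) (-1) ^+ below S k * psi' k (S :\ k) =
   - (-1) ^+ below S x * \sum_(k in S) (-1) ^+ below (x |: S) k * psi k ((x |: S) :\ k).
  rewrite mulr_sumr; apply: eq_bigr => k kS.
  have kx : (k == x) = false by apply: contraNF xinS => /eqP <-.
  have -> : (x |: S) :\ k = x |: (S :\ k).
    by apply/setP => y; rewrite !inE; case: (eqVneq y x) => [->|] //=; rewrite eq_sym kx.
  rewrite /psi' in_setD1 (negbTE xinS) andbF (belowD1 x kS) belowU1 //.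
  have [kx'|xk'|/val_inj e] := ltngtP k x; last by rewrite e eqxx in kx.
    by rewrite /= !exprS; ring.
  by rewrite /= !exprS; ring.
rewrite E.
have Q : (-1) ^+ below S x * (-1) ^+ below S x = 1 :> nov R.
  by rewrite -exprMn mulrNN mulr1 expr1n.
ring: Q.
Qed.

(** An index common to S and T repeats an entry in one factor, so its term vanishes. What remains of
    the two sums is indexed by T minus S and by S minus T, and [sign_below_symd] unifies the
    signs. *)
Lemma psum_wick (phi : monom n -> nov R) (sigma tau : seq 'I_n) :
  let S := [set x in sigma] in let T := [set x in tau] in
  psum phi (wick R sigma tau) =
  - (ws sigma * ws tau) * \sum_(k in symd S T) (-1) ^+ below (symd S T) k *
     phi (monadd (monS (symd S [set k])) (monS (symd T [set k]))).
Proof.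
move=> S T; rewrite /wick psum_cat /psum !big_map /=.
rewrite (eq_bigr (fun ip => (-1) ^+ ip.1 * (ws ip.2.2 * (ws (ip.2.1 :: sigma) *
  phi (monadd (monS (ip.2.1 |: S)) (monS [set x in ip.2.2])))))); last first.
  by move=> ip _; rewrite emb_wterm set_cons -/S; ring.
rewrite [X in _ + X](eq_bigr (fun ip => (-1) ^+ ip.1 * (ws ip.2.2 * (ws (ip.2.1 :: tau) *
  phi (monadd (monS [set x in ip.2.2]) (monS (ip.2.1 |: T))))))); last first.
  by move=> ip _; rewrite emb_wterm set_cons -/T; ring.
rewrite (picks_sum tau (fun k X => ws (k :: sigma) * phi (monadd (monS (k |: S)) (monS X)))).
rewrite (picks_sum sigma (fun k X => ws (k :: tau) * phi (monadd (monS X) (monS (k |: T))))).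
rewrite expr1 -/S -/T.
rewrite big_symd /= mulrDr addrC; congr (_ + _).
  rewrite (big_setID T) /= big1 ?add0r => [|k]; last first.
    by rewrite !inE => /andP[_ ks]; rewrite ws_cons ks mul0r mulr0.
  rewrite !mulr_sumr; apply: eq_bigr => k; rewrite inE => /andP[kT kS].
  have ks : k \in tau = false by apply: contraNF kT; rewrite inE.
  rewrite ws_cons ks sign_below_symd [symd T _]symd_1_notin // symd_1_in //; ring.
rewrite (big_setID S) /= big1 ?add0r => [|k]; last first.
  by rewrite !inE => /andP[_ ks]; rewrite ws_cons ks mul0r mulr0.
rewrite !mulr_sumr; apply: eq_bigr => k; rewrite inE => /andP[kS kT].
have ks : k \in sigma = false by apply: contraNF kS; rewrite inE.
rewrite ws_cons ks sign_below_symd symd_1_notin // symd_1_in //; ring.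
Qed.

End Evaluation.

(** * Tropical hypersurfaces *)

Section Tropical.
Variable R : realType.
Implicit Types x y z : option R.

Lemma tle_refl x : tle x x. Proof. by case: x => /=. Qed.
Lemma tle_trans y x z : tle x y -> tle y z -> tle x z.
Proof. by case: x y z => [x|] [y|] [z|] //=; apply: le_trans. Qed.
Lemma tle_total x y : tle x y || tle y x.
Proof. by case: x y => [x|] [y|] //=; apply: le_total. Qed.
Lemma tle_anti x y : tle x y -> tle y x -> x = y.
Proof. by case: x y => [x|] [y|] //= h1 h2; congr Some; apply/eqP; rewrite eq_le h1. Qed.
Lemma tle_None x : tle x None. Proof. by case: x. Qed.
Lemma taddC x y : tadd x y = tadd y x.
Proof. by case: x y => [x|] [y|] //=; rewrite addrC. Qed.
Lemma taddA x y z : tadd x (tadd y z) = tadd (tadd x y) z.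
Proof. by case: x y z => [x|] [y|] [z|] //=; rewrite addrA. Qed.

(** For the converse, the condition is applied at an index of least value. The right side is an
    exchange property that no longer mentions the minimum. *)
Lemma min_twiceP (X : eqType) (s : seq X) (f : X -> option R) :
  min_twice s f <->
  (forall a, a \in s -> f a <> None -> exists b, [/\ b \in s, b != a & tle (f b) (f a)]).
Proof.
split=> [[h a /h //|[a [b [as_ bs ab fab amin]]] c cs _]|h].
  have [->|ca] := eqVneq c a; first by exists b; rewrite eq_sym -fab tle_refl.
  by exists a; rewrite eq_sym ca amin.
have [n|n] := pselect (forall a, a \in s -> f a = None); first by left.
right; have [a as_ amin] : exists2 a, a \in s & forall c, c \in s -> tle (f a) (f c).
  elim: s {h} n => [|x s IH] n; first by case: n.
  have [n'|/IH[a as_ amin]] := pselect (forall a, a \in s -> f a = None).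
    exists x => [|c]; rewrite inE ?eqxx // => /orP[/eqP ->|/n' ->]; first exact: tle_refl.
    exact: tle_None.
  have /orP[xa|ax] := tle_total (f x) (f a).
    exists x => [|c]; rewrite inE ?eqxx // => /orP[/eqP ->|/amin]; first exact: tle_refl.
    exact: tle_trans.
  by exists a => [|c]; rewrite inE ?as_ ?orbT // => /orP[/eqP ->|/amin].
have fa : f a <> None.
  move=> fa; apply: n => c cs; apply: tle_anti; first exact: tle_None.
  by rewrite -fa amin.
have [b [bs ba le]] := h a as_ fa; exists a, b; split; rewrite // 1?eq_sym //.
by apply: tle_anti => //; apply: amin.
Qed.

Variable n : nat.
Local Notation sets := {set 'I_n}.
Implicit Types (p : sets -> option R) (a b : monom n) (P : kpoly R n) (w : sets -> nov R).

Lemma mondot_add a b p : mondot (monadd a b) p = tadd (mondot a p) (mondot b p).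
Proof.
rewrite /mondot; case: existsP => [[S]|h]; rewrite ?ffunE.
  rewrite addn_gt0 => /andP[/orP[] aS pS].
    by rewrite (introT existsP) //; exists S; rewrite aS.
  by rewrite taddC (introT existsP) //; exists S; rewrite aS.
rewrite (introF existsP); last by case=> S /andP[aS pS]; apply: h; exists S; rewrite ffunE addn_gt0 aS.
rewrite (introF existsP); last first.
  by case=> S /andP[aS pS]; apply: h; exists S; rewrite ffunE addn_gt0 aS orbT.
rewrite /= -big_split; congr Some; apply: eq_bigr => S _ /=.
by rewrite ffunE natrD mulrDl.
Qed.

Lemma mondot_monS p S : mondot (monS S) p = p S.
Proof.
rewrite /mondot; case: existsP => [[T]|h]; rewrite ?ffunE.
  by case: eqP => [->|] //= /eqP ->.
have pS : p S != None by apply/negP => pS; apply: h; exists S; rewrite ffunE eqxx.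
rewrite (bigD1 S) //= big1 ?addr0 => [|T TS]; rewrite ffunE ?eqxx ?(negbTE TS) ?mul0r //.
by rewrite mul1r; case: (p S) pS.
Qed.

(** Nonzero constants have valuation 0, so a polynomial with such coefficients tropicalizes to the
    bare minimum over its monomials. *)
Definition isC (f : nov R) : Prop := f = nmono (f 0) 0.

Lemma isC_mono c : isC (nmono c 0).
Proof. by rewrite /isC nmonoE eqxx. Qed.
Lemma isC0 : isC 0. Proof. by rewrite /isC nov0E nmono0. Qed.
Lemma isC_D f g : isC f -> isC g -> isC (f + g).
Proof. by move=> hf hg; rewrite /isC novDE nmono_addl -hf -hg. Qed.
Lemma isC_M f g : isC f -> isC g -> isC (f * g).
Proof. by move=> -> ->; rewrite nmonoM addr0; apply: isC_mono. Qed.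
Lemma isC_sum I (s : seq I) (Q : pred I) (F : I -> nov R) :
  (forall i, Q i -> isC (F i)) -> isC (\sum_(i <- s | Q i) F i).
Proof. by move=> h; apply: (big_ind isC) => //; [exact: isC0|exact: isC_D]. Qed.
Lemma isC_sign k : isC ((-1) ^+ k).
Proof. by rewrite -nmono_sign; apply: isC_mono. Qed.
Lemma isC_N f : isC f -> isC (- f).
Proof. by rewrite -mulN1r; apply: isC_M; apply: (isC_sign 1). Qed.
Lemma isC_ws (s : seq 'I_n) : isC (ws R s).
Proof. by rewrite -nmono_wsign; apply: isC_mono. Qed.
Lemma isC_bool (b : bool) : isC (b%:R).
Proof. by case: b; [apply: isC_mono|apply: isC0]. Qed.

Lemma isC_val (x : puiseux R) : isC (emb x) -> emb x <> 0 -> pz_val x = Some 0.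
Proof.
move=> h n0; apply: (pz_val_mono h); apply/eqP => e; apply: n0.
by rewrite h e nmono0.
Qed.

Lemma psum_pcoef P a : psum (fun b => (b == a)%:R) P = emb (pcoef P a).
Proof.
rewrite /psum emb_pcoef [RHS]big_mkcond; apply: eq_bigr => t _.
by case: eqP; rewrite ?mulr1 ?mulr0.
Qed.

Lemma pcoef_mem P a : emb (pcoef P a) <> 0 -> a \in undup [seq t.2 | t <- P].
Proof.
rewrite mem_undup emb_pcoef; elim: P => [|t P IH]; first by rewrite big_nil.
by rewrite big_cons /= inE eq_sym; case: eqP.
Qed.

Lemma tropterm_None P p a : emb (pcoef P a) = 0 -> tropterm P p a = None.
Proof.
rewrite /tropterm; case E: (pz_val _) => [q|] // h.
by have := hasval_neq0 (pz_val_Some E); rewrite h eqxx.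
Qed.

Lemma tropterm_const P p a : isC (emb (pcoef P a)) -> emb (pcoef P a) <> 0 ->
  tropterm P p a = mondot a p.
Proof.
move=> h h0; rewrite /tropterm isC_val //= rmorph0.
by case: (mondot a p) => [r|] //=; rewrite add0r.
Qed.

Definition wmono (S T : sets) (k : 'I_n) : monom n :=
  monadd (monS (symd S [set k])) (monS (symd T [set k])).

Lemma wick_pcoef (S T : sets) a :
  emb (pcoef (wick R (enum S) (enum T)) a) =
  - (ws R (enum S) * ws R (enum T)) *
    \sum_(k in symd S T) (-1) ^+ below (symd S T) k * (wmono S T k == a)%:R.
Proof. by rewrite -psum_pcoef psum_wick !set_enum. Qed.

Lemma ws_enum (S : sets) : ws R (enum S) * ws R (enum S) = 1.
Proof. by rewrite /ws enum_uniq -exprMn mulrNN mulr1 expr1n. Qed.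

Lemma isC_wick (S T : sets) a : isC (emb (pcoef (wick R (enum S) (enum T)) a)).
Proof.
rewrite wick_pcoef; apply: isC_M; first by apply: isC_N; apply: isC_M; apply: isC_ws.
by apply: isC_sum => k _; apply: isC_M; [apply: isC_sign|apply: isC_bool].
Qed.

Lemma TSpinPM_DDr p : TSpinPM p -> DDr p.
Proof.
move=> hp S T; apply/min_twiceP => k; rewrite mem_enum => kST fk.
apply: contrapT => nk.
pose P := wick R (enum S) (enum T).
have /min_twiceP hP : in_trop_hyp P p.
  by apply: hp; apply: ig_gen; exists (enum S), (enum T).
have wp j : mondot (wmono S T j) p = tadd (p (symd S [set j])) (p (symd T [set j])).
  by rewrite mondot_add !mondot_monS.
(* A second index with the same monomial would itself be the index sought, so the coefficient is a
   single sign and nothing cancels. *)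
have c0 : emb (pcoef P (wmono S T k)) <> 0.
  rewrite wick_pcoef (bigD1 k) //= eqxx big1 => [|j /andP[jST jk]]; last first.
    case: eqP => [e|_]; last by rewrite mulr0.
    by case: nk; exists j; rewrite mem_enum jST jk -!wp e tle_refl.
  rewrite addr0 mulr1 => /(congr1 (fun g : nov R => - (ws R (enum S) * ws R (enum T)) *
    (-1) ^+ below (symd S T) k * g)); rewrite mulr0.
  have -> : forall a b c : nov R, - (a * b) * c * (- (a * b) * c) = (a * a) * (b * b) * (c * c).
    by move=> *; ring.
  rewrite !ws_enum -exprMn mulrNN mulr1 expr1n !mulr1 => /eqP.
  by rewrite oner_eq0.
have ck := tropterm_const p (isC_wick S T _) c0.
have [|b [bP bk]] := hP _ (pcoef_mem c0); first by rewrite ck wp.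
rewrite ck wp => le.
have [b0|b0] := pselect (emb (pcoef P b) = 0).
  by move: le; rewrite tropterm_None //; case: tadd fk.
move: le; rewrite (tropterm_const p (isC_wick S T _) b0) => le.
have [j jST e] : exists2 j, j \in symd S T & wmono S T j = b.
  apply: contrapT => nj; apply: b0; rewrite wick_pcoef big1 ?mulr0 // => j jST.
  by case: eqP => [e|_]; rewrite ?mulr0 //; case: nj; exists j.
apply: nk; exists j; rewrite mem_enum jST -wp e; split=> //.
by apply: contra bk => /eqP <-; rewrite e.
Qed.

(** * From lifts to membership in the tropical variety *)

Lemma hasval_exp (f : nov R) r k : hasval f r -> hasval (f ^+ k) (k%:R * r).
Proof.
move=> h; elim: k => [|k IH]; first by rewrite expr0 mul0r; apply: hasval1.
by rewrite exprS -natr1 mulrDl mul1r addrC; apply: hasvalM.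
Qed.

Lemma vge_exp (f : nov R) r k : vge f r -> vge (f ^+ k) (k%:R * r).
Proof.
move=> h; elim: k => [|k IH]; first by rewrite expr0 mul0r; case: (hasval1 R).
by rewrite exprS -natr1 mulrDl mul1r addrC; case: (vgeM h IH).
Qed.

Lemma hasval_mv w p a r : mondot a p = Some r ->
  (forall S u, p S = Some u -> hasval (w S) u) -> hasval (mv w a) r.
Proof.
rewrite /mondot; case: existsP => // h [<-] hw.
apply: (big_ind2 (@hasval R)); [exact: hasval1|by move=> *; apply: hasvalM|].
move=> S _; case E : (p S) => [x|] /=; first by apply: hasval_exp; apply: hw.
have -> : a S = 0%N.
  by apply/eqP; rewrite -leqn0 leqNgt; apply/negP => aS; apply: h; exists S; rewrite aS E.
by rewrite expr0 mul0r; apply: hasval1.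
Qed.

Lemma vge_mv w (l : sets -> R) a :
  (forall S, vge (w S) (l S)) -> vge (mv w a) (\sum_S (a S)%:R * l S).
Proof.
move=> hw; apply: (big_ind2 (@vge R)); first by case: (hasval1 R).
  by move=> f r g s hf hg; case: (vgeM hf hg).
by move=> S _; apply: vge_exp.
Qed.

(** If one term of P were strictly least at p, the evaluation of P at a lift would have a nonzero
    coefficient at that exponent. Since P has finitely many terms, an infinite entry may be lifted
    to any valuation above a bound that depends on P. *)
Lemma tspin_of_lifts p :
  (forall B, exists w, (forall sigma tau, Ev w (wick R sigma tau) = 0) /\
     forall S, if p S is Some r then hasval (w S) r else vge (w S) B) ->
  TSpinPM p.
Proof.
move=> lifts P IP; apply/min_twiceP => a aP.
case Ea : (tropterm P p a) => [v|] // _; apply: contrapT => na.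
pose o b := \sum_(S : sets) (b S)%:R * odflt 0 (p S).
pose c b : R := odflt 0 (omap ratr (pz_val (pcoef P b))).
pose D b := `|v| + `|c b| + `|o b|.
(* For every monomial b, [B] exceeds |v| + |c b| + |o b|; a term that uses an infinite coordinate
   therefore starts beyond v. *)
pose B := \sum_(b <- undup [seq t.2 | t <- P]) D b + 1.
have D0 b : 0 <= D b by rewrite !addr_ge0.
have hB b : b \in undup [seq t.2 | t <- P] -> D b + 1 <= B.
  move=> bP; rewrite lerD2r (bigD1_seq b) ?undup_uniq //= lerDl.
  by apply: sumr_ge0 => *; apply: D0.
have [w [hw hv]] := lifts B.
have hw0 : Ev w P = 0 by apply: ideal_Ev IP => _ [sigma [tau ->]].
have wS S u : p S = Some u -> hasval (w S) u by move=> e; have := hv S; rewrite e.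
have term_a : hasval (emb (pcoef P a) * mv w a) v.
  move: Ea; rewrite /tropterm; case Ev1 : (pz_val _) => [q|] //=.
  case Em : (mondot a p) => [m|] //= [<-].
  by apply: hasvalM; [apply: pz_val_Some|apply: hasval_mv Em wS].
have term_b b : b \in undup [seq t.2 | t <- P] -> b != a ->
    (emb (pcoef P b) * mv w b) v = 0.
  move=> bP ba; case Ev1 : (pz_val (pcoef P b)) => [q|]; last first.
    by rewrite pz_val_None // mul0r nov0E.
  have hq := pz_val_Some Ev1.
  case Em : (mondot b p) => [m|].
    have [h _] := hasvalM hq (hasval_mv Em wS); apply: h.
    rewrite ltNge; apply/negP => le; apply: na; exists b; split=> //.
    by rewrite /tropterm Ev1 Em /=.
  move: Em; rewrite /mondot; case: existsP => // -[S0 /andP[bS0 /eqP pS0]] _.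
  pose l S := if p S is Some r then r else B.
  have hl S : vge (w S) (l S).
    by rewrite /l; have := hv S; case: (p S) => // u [].
  have [h _] := vgeM hq.1 (@vge_mv w l b hl); apply: h.
  have B0 : 0 <= B by apply: le_trans (hB _ aP); rewrite addr_ge0.
  have le : o b + B <= \sum_S (b S)%:R * l S.
    rewrite /o (bigD1 S0) //= [X in _ <= X](bigD1 S0) //= /l pS0 /= mulr0 add0r addrC.
    apply: lerD; last by rewrite ler_peMl // ler1n.
    by apply: ler_sum => S _; case: (p S) => //=; rewrite mulr0 mulr_ge0.
  have := hB _ bP; have cq : c b = ratr q by rewrite /c Ev1.
  rewrite /D cq; move: le; set X := \sum_S _.
  have := ler_norm v; have := ler_norm (- ratr q : R); have := ler_norm (- o b).
  by rewrite !normrN; lra.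
have : (Ev w P) v = (emb (pcoef P a) * mv w a) v.
  rewrite /Ev (psum_regroup _ (undup_uniq _) (s := undup [seq t.2 | t <- P])); last first.
    by move=> b; rewrite mem_undup.
  rewrite nov_sumE (bigD1_seq a) ?undup_uniq //= [X in _ + X]big_seq_cond big1 ?addr0 //.
  by move=> b /andP[bP ba]; apply: term_b.
by rewrite hw0 nov0E => e; case: term_a => _; rewrite -e eqxx.
Qed.

End Tropical.

(** * Subsets as bit vectors and the Fano vector *)

Fixpoint flip (i : nat) (X : seq bool) : seq bool :=
  match X, i with
  | [::], _ => [::]
  | b :: X', 0 => ~~ b :: X'
  | b :: X', i'.+1 => b :: flip i' X'
  end.

Definition diffs (X Y : seq bool) : seq nat :=
  [seq i <- iota 0 (size X) | nth false X i (+) nth false Y i].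

Fixpoint allbits (m : nat) : seq (seq bool) :=
  if m is m'.+1 then map (cons false) (allbits m') ++ map (cons true) (allbits m') else [:: [::]].

Lemma mem_allbits X : X \in allbits (size X).
Proof.
elim: X => // b X IH; rewrite /= mem_cat.
by case: b; rewrite map_f ?orbT.
Qed.

Lemma allbitsP m (P : pred (seq bool)) : all P (allbits m) -> forall X, size X = m -> P X.
Proof. by move=> /allP h X sX; apply: h; rewrite -sX; apply: mem_allbits. Qed.

Lemma size_flip i X : size (flip i X) = size X.
Proof. by elim: X i => [|b X IH] [|i] //=; rewrite IH. Qed.

Lemma nth_flip i X j : (j < size X)%N -> nth false (flip i X) j = nth false X j (+) (j == i).
Proof.
elim: X i j => [|b X IH] [|i] [|j] //= h; rewrite ?addbT ?addbF //.
by rewrite IH // eqSS.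
Qed.

Lemma flip_ge i X : (size X <= i)%N -> flip i X = X.
Proof. by elim: X i => [|b X IH] [|i] //= h; rewrite IH. Qed.

Section Bits.
Variables (n m : nat).
Local Notation sets := {set 'I_n}.

(** The length m is independent of n: with n >= 7 and m = 7 this is the trace on the first seven
    elements, with n <= 5 and m = 5 it pads by absent elements. *)
Definition bits (S : sets) : seq bool :=
  mkseq (fun i => [exists k : 'I_n, (val k == i) && (k \in S)]) m.

Definition sset (X : seq bool) : sets := [set k : 'I_n | nth false X k].

Lemma size_bits S : size (bits S) = m.
Proof. exact: size_mkseq. Qed.

Lemma nth_bits S (k : 'I_n) : (k < m)%N -> nth false (bits S) k = (k \in S).
Proof.
move=> km; rewrite nth_mkseq //; apply/existsP/idP => [[j /andP[/eqP/val_inj -> //]]|kS].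
by exists k; rewrite eqxx.
Qed.

Lemma nth_bits_true S i : nth false (bits S) i -> exists k : 'I_n, [/\ val k = i, (k < m)%N & k \in S].
Proof.
have [im|mi] := ltnP i m; last by rewrite nth_default // size_bits.
by rewrite nth_mkseq // => /existsP[k /andP[/eqP ki kS]]; exists k; split; rewrite -?ki // ki.
Qed.

Lemma in_symd1 (S : sets) k j : (j \in symd S [set k]) = (j \in S) (+) (j == k).
Proof. by rewrite !inE; case: (j \in S); case: (j == k). Qed.

Lemma in_symd (S T : sets) j : (j \in symd S T) = (j \in S) (+) (j \in T).
Proof. by rewrite !inE; case: (j \in S); case: (j \in T). Qed.

Lemma bits_symd1 S (k : 'I_n) : bits (symd S [set k]) = flip k (bits S).
Proof.
apply: (@eq_from_nth _ false); rewrite ?size_flip !size_bits // => i im.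
rewrite nth_flip ?size_bits // !nth_mkseq //.
apply/existsP/idP => [[j /andP[/eqP <-]]|].
  rewrite in_symd1 => h; have -> : (val j == val k) = (j == k) by [].
  have -> // : [exists k0 : 'I_n, (val k0 == val j) && (k0 \in S)] = (j \in S).
  apply/existsP/idP => [[l /andP[/eqP/val_inj -> //]]|jS]; by exists j; rewrite eqxx.
case: existsP => [[j /andP[/eqP <- jS]]|nex] /=.
  by move=> jk; exists j; rewrite eqxx in_symd1 jS.
move=> /eqP ik; exists k; rewrite ik eqxx in_symd1 eqxx addbT.
by apply/negP => kS; apply: nex; exists k; rewrite ik eqxx.
Qed.

Lemma mem_diffs S T i : i \in diffs (bits S) (bits T) <->
  exists k : 'I_n, [/\ val k = i, (k < m)%N & k \in symd S T].
Proof.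
rewrite mem_filter mem_iota size_bits add0n /=; split=> [/andP[h im]|[k [<- km]]]; last first.
  by rewrite in_symd !nth_bits // km andbT.
have [k [ki km]] : exists k : 'I_n, val k = i /\ (k < m)%N.
  case E : (nth false (bits S) i); first by have [k []] := nth_bits_true E; exists k.
  case E' : (nth false (bits T) i); first by have [k []] := nth_bits_true E'; exists k.
  by rewrite E E' in h.
by exists k; split=> //; rewrite in_symd -!nth_bits // ki.
Qed.

Lemma perm_diffs S T : (forall k, k \in symd S T -> (k < m)%N) ->
  perm_eq [seq val k | k <- enum (symd S T)] (diffs (bits S) (bits T)).
Proof.
move=> h; apply: uniq_perm.
- by rewrite map_inj_uniq ?enum_uniq //; apply: val_inj.
- by rewrite filter_uniq ?iota_uniq.
move=> i; apply/mapP/idP => [[k]|/mem_diffs[k [ki km kST]]].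
  by rewrite mem_enum => kST ->; apply/mem_diffs; exists k; rewrite h.
by exists k; rewrite ?mem_enum.
Qed.

Lemma below_diffs S T (k : nat) (kn : (k < n)%N) : (forall k, k \in symd S T -> (k < m)%N) ->
  below (symd S T) (Ordinal kn) = count (fun i => (i < k)%N) (diffs (bits S) (bits T)).
Proof.
move=> h; rewrite -(permP (perm_diffs h)) count_map.
have -> : symd S T = [set x in enum (symd S T)] by rewrite set_enum.
by rewrite below_count ?enum_uniq // set_enum.
Qed.

Lemma big_diffs (V : nmodType) S T (G : nat -> V) :
  (forall k, k \in symd S T -> (k < m)%N) ->
  \sum_(k in symd S T) G k = \sum_(i <- diffs (bits S) (bits T)) G i.
Proof. by move=> h; rewrite -(perm_big _ (perm_diffs h)) big_map -big_enum. Qed.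

Lemma bits_sset X : size X = m -> (m <= n)%N -> bits (sset X) = X.
Proof.
move=> sX mn; apply: (@eq_from_nth _ false); rewrite size_bits // => i im.
have ki : (i < n)%N by apply: leq_trans mn.
by have := @nth_bits (sset X) (Ordinal ki) im; rewrite inE.
Qed.

Lemma odd_symd (S T : sets) : odd #|symd S T| = odd #|S| (+) odd #|T|.
Proof.
rewrite /symd cardsU -(cardsID T S) -(cardsID S T) (setIC T).
have -> : (S :\: T) :&: (T :\: S) = set0.
  by apply/setP => j; rewrite !inE; case: (j \in S); case: (j \in T).
by rewrite cards0 subn0 !oddD; case: (odd _); case: (odd _); case: (odd _).
Qed.

Lemma odd_symd1 (S : sets) k : odd #|symd S [set k]| = ~~ odd #|S|.
Proof. by rewrite odd_symd cards1 addbT. Qed.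

End Bits.

Arguments bits {n} m S.
Arguments sset n X.

(* The dual Fano matroid: its bases are the complements of the three-element
   sets which are not lines.  [fano_dist] is the Hamming distance to the set of bases. *)
Definition coline (X : seq bool) : bool :=
  if X is [:: a; b; c; d; e; f; g] then
    ~~ [&& [|| a, b | d], [|| b, c | e], [|| c, d | f], [|| d, e | g],
           [|| e, f | a], [|| f, g | b] & [|| g, a | c]]
  else false.

Definition fano_dist (X : seq bool) : nat :=
  let fix zeros X := if X is b :: X' then (if b then zeros X' else S (zeros X')) else 0%N in
  match zeros X with
  | 0 => 3 | 1 => 2 | 2 => 1 | 3 => if coline X then 2 else 0 | 4 => 1 | 5 => 2 | 6 => 3 | _ => 4
  end%N.

(** The start value 10 exceeds every sum of two values of [fano_dist], so on such sums the fold is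
    their minimum. *)
Definition min_twice_nat (l : seq nat) : bool :=
  if l is [::] then true
  else let m := foldr Nat.min 10%N l in Nat.leb 2 (count (Nat.eqb m) l).

Lemma min_twice_natP (K : eqType) (t : K -> nat) (s : seq K) : uniq s ->
  min_twice_nat (map t s) -> forall a, a \in s -> exists b, [/\ b \in s, b != a & (t b <= t a)%N].
Proof.
move=> us h a as_; apply: contrapT => na.
pose m := foldr Nat.min 10%N (map t s).
have ma : (m <= t a)%N.
  rewrite /m; elim: (s) as_ => // x s' IH; rewrite inE /= => /orP[/eqP <-|/IH]; lia.
have : (2 <= count (fun k => Nat.eqb m (t k)) s)%N.
  have h1 : Nat.leb 2 (count (Nat.eqb m) (map t s)) by move: h as_; rewrite /m; case: (s).
  by rewrite count_map in h1; apply/ssrnat.leP/(iffLR (PeanoNat.Nat.leb_le _ _))/h1.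
apply/negP; rewrite -ltnNge ltnS.
have -> : 1%N = count_mem a s by rewrite count_uniq_mem // as_.
have -> : count (fun k => Nat.eqb m (t k)) s = count (fun k => (k \in s) && Nat.eqb m (t k)) s.
  by apply: eq_in_count => k ->.
apply: sub_count => k /= /andP[ks mk0]; have mk := iffLR (PeanoNat.Nat.eqb_eq _ _) mk0.
by apply/negP => /negP ka; apply: na; exists k; split=> //; rewrite -mk.
Qed.

(** For sets of equal parity the symmetric difference is even. If the traces differ in an odd number
    of places, some exchange index lies outside the first seven elements; it leaves both traces
    unchanged and contributes [e]. *)
Definition fano_exch (X Y : seq bool) : bool :=
  let ds := diffs X Y in
  let e := (fano_dist X + fano_dist Y)%N in
  let ts := [seq (fano_dist (flip k X) + fano_dist (flip k Y))%N | k <- ds] in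
  min_twice_nat (if odd (size ds) then e :: ts else ts).

Lemma fano_exch_all : all (fun X => all (fano_exch X) (allbits 7)) (allbits 7).
Proof. by vm_compute. Qed.

(* [None] stands for a further coordinate outside the ground set of the Fano matroid. *)
Lemma fano_exchP X Y : size X = 7 -> size Y = 7 ->
  let ds := diffs X Y in
  let K := (if odd (size ds) then [:: None] else [::]) ++ map some ds in
  let t k := if k is Some j then (fano_dist (flip j X) + fano_dist (flip j Y))%N
             else (fano_dist X + fano_dist Y)%N in
  forall a, a \in K -> exists b, [/\ b \in K, b != a & (t b <= t a)%N].
Proof.
move=> sX sY ds K t; apply: min_twice_natP.
  have us : uniq (map some ds) by rewrite map_inj_uniq ?filter_uniq ?iota_uniq // => x y [].
  by rewrite /K; case: ifP => //= _; rewrite us andbT; apply/mapP => -[].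
have := allbitsP (allbitsP fano_exch_all sX) sY; rewrite /fano_exch -/ds /K map_cat -map_comp.
by case: (odd (size ds)).
Qed.

Section FanoVector.
Variables (R : realType) (n : nat).
Local Notation sets := {set 'I_n}.

Definition fano_vec (S : sets) : option R :=
  if odd #|S| then None else Some (fano_dist (bits 7 S))%:R.

(** Only odd S and T give finite values. The sets [A] and [B] of exchange indices inside and outside
    the first seven elements have sizes of equal parity. Two indices of [B] have equal values and
    answer each other; otherwise [fano_exchP] supplies the partner, [None] standing for an element
    of [B]. *)
Lemma fano_vec_DDr : DDr fano_vec.
Proof.
move=> S T; apply/min_twiceP => k; rewrite mem_enum => kST.
rewrite /fano_vec !odd_symd1; case: (boolP (odd #|S|)) => //= oS; case: (boolP (odd #|T|)) => //= oT _.
rewrite !bits_symd1 -natrD.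
set X := bits 7 S; set Y := bits 7 T.
pose t (j : nat) := (fano_dist (flip j X) + fano_dist (flip j Y))%N.
suff [b [bST bk le]] : exists b, [/\ b \in symd S T, b != k & (t b <= t k)%N].
  exists b; rewrite mem_enum bST bk; split=> //.
  by rewrite !odd_symd1 oS oT /= !bits_symd1 -natrD ler_nat.
have sX : size X = 7 by apply: size_bits.
have sY : size Y = 7 by apply: size_bits.
have exch := fano_exchP sX sY.
have tge (j : 'I_n) : (7 <= j)%N -> t j = (fano_dist X + fano_dist Y)%N.
  by move=> j7; rewrite /t !flip_ge // ?sX ?sY.
pose A := [set j in symd S T | (j < 7)%N]; pose B := [set j in symd S T | (7 <= j)%N].
have sz : size (diffs X Y) = #|A|.
  rewrite cardE -(size_map val (enum A)); apply/perm_size/uniq_perm.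
  - by rewrite filter_uniq ?iota_uniq.
  - by rewrite map_inj_uniq ?enum_uniq //; apply: val_inj.
  move=> i; apply/idP/mapP => [/mem_diffs[j [<- j7 jST]]|[j]].
    by exists j => //; rewrite mem_enum inE jST.
  rewrite mem_enum inE => /andP[jST j7] ->; apply/mem_diffs; by exists j.
have card : odd #|A| = odd #|B|.
  have : odd #|symd S T| = false by rewrite odd_symd oS oT.
  rewrite -(cardsID [set j : 'I_n | (j < 7)%N] (symd S T)) oddD.
  have -> : symd S T :&: [set j : 'I_n | (j < 7)%N] = A by apply/setP => j; rewrite !inE.
  have -> : symd S T :\: [set j : 'I_n | (j < 7)%N] = B.
    by apply/setP => j; rewrite !inE -leqNgt andbC.
  by case: (odd _); case: (odd _).
pose K := (if odd (size (diffs X Y)) then [:: None] else [::]) ++ map some (diffs X Y).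
have KS j : (Some j \in K) = (j \in diffs X Y).
  rewrite mem_cat mem_map; last by move=> ? ? [].
  by case: (odd (size _)).
have KN : (None \in K) = odd (size (diffs X Y)).
  rewrite mem_cat; have -> : None \in map some (diffs X Y) = false by apply/mapP => -[].
  by case: (odd (size _)).
have [k7|k7] := ltnP k 7.
  have kd : Some (val k) \in K by rewrite KS; apply/mem_diffs; exists k.
  have [[j|] [bK bk le]] := exch _ kd.
    move: bK; rewrite KS => /mem_diffs[b [bj b7 bST]].
    by exists b; split=> //; [apply: contra bk => /eqP <-; rewrite bj|rewrite bj].
  have : #|B| != 0%N by apply/eqP => B0; move: bK; rewrite KN sz card B0.
  rewrite cards_eq0 => /set0Pn[b]; rewrite inE => /andP[bST b7].
  exists b; split=> //; last by rewrite tge.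
  by apply/eqP => e; move: b7; rewrite e leqNgt k7.
have kB : k \in B by rewrite inE kST.
have [B1|] := leqP #|B| 1; last first.
  rewrite (cardsD1 k) kB /= add1n ltnS card_gt0 => /set0Pn[b].
  rewrite in_setD1 inE => /andP[bk /andP[bST b7]].
  by exists b; split; rewrite // !tge.
have od : None \in K.
  rewrite KN sz card; have : (0 < #|B|)%N by rewrite card_gt0; apply/set0Pn; exists k.
  by case: #|B| B1 => [|[]].
have [[j|] [bK bk le]] := exch _ od => //.
move: bK; rewrite KS => /mem_diffs[b [bj b7 bST]].
exists b; split=> //; last by rewrite bj (tge k).
by apply/eqP => e; move: b7; rewrite e ltnNge k7.
Qed.

End FanoVector.

(** * The polynomial certificate *)

Definition bits7 (s : seq nat) : seq bool := mkseq (fun i => i \in s) 7.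

(** An entry consists of a sign flag, the sets S and T, and the left and right monomials in bases.
    The flags make the right monomial of each relation cancel the left monomial of the next one
    after multiplication by [fano_factor]. *)
Definition fano_binomials : seq (bool * (seq nat * seq nat) * (seq (seq nat) * seq (seq nat))) :=
  [:: (false, ([:: 0; 1; 2], [:: 0; 1; 3; 4; 5]),
        ([:: [:: 0; 1; 2; 3]; [:: 0; 1; 4; 5]], [:: [:: 0; 1; 2; 4]; [:: 0; 1; 3; 5]]));
      (true, ([:: 0; 1; 4], [:: 2; 3; 4; 5; 6]),
        ([:: [:: 0; 1; 2; 4]; [:: 3; 4; 5; 6]], [:: [:: 0; 1; 4; 5]; [:: 2; 3; 4; 6]]));
      (false, ([:: 0; 2; 3], [:: 1; 3; 4; 5; 6]),
        ([:: [:: 0; 2; 3; 5]; [:: 1; 3; 4; 6]], [:: [:: 0; 1; 2; 3]; [:: 3; 4; 5; 6]]));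
      (true, ([:: 0; 3; 5], [:: 1; 2; 3; 4; 6]),
        ([:: [:: 0; 1; 3; 5]; [:: 2; 3; 4; 6]], [:: [:: 0; 2; 3; 5]; [:: 1; 3; 4; 6]]))]%N.

(* The binomial with index [k] is multiplied by the right hand monomials of the
   previous ones and by the left hand monomials of the next ones. *)
Definition fano_factor (k : nat) : seq (seq bool) :=
  map bits7 (flatten [seq x.2.2 | x <- take k fano_binomials] ++
             flatten [seq x.2.1 | x <- drop k.+1 fano_binomials]).

Definition fano_step (k : nat) : bool * (seq bool * seq bool) :=
  let x := (nth (false, ([::], [::]), ([::], [::])) fano_binomials k).1 in
  (x.1, (bits7 x.2.1, bits7 x.2.2)).

Definition step_terms (k : nat) : seq (bool * seq (seq bool)) :=
  let: (c, (X, Y)) := fano_step k in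
  [seq (c (+) odd (count (fun j => j < i)%N (diffs X Y)), fano_factor k ++ [:: flip i X; flip i Y])
     | i <- diffs X Y].

Definition cert_terms : seq (bool * seq (seq bool)) := flatten (map step_terms (iota 0 4)).

Definition cert_zero (l : seq (seq bool)) : bool := all (fun X => fano_dist X == 0%N) l.

Definition code (X : seq bool) : nat := foldl (fun k (b : bool) => k.*2 + b)%N 0%N X.
(** Sorting by the binary code turns equality of commutative monomials into equality of lists. *)
Definition canon (l : seq (seq bool)) : seq (seq bool) := sort (fun X Y => code X <= code Y)%N l.

Definition cert_main : seq (seq bool) :=
  canon (map bits7 (flatten [seq x.2.1 | x <- fano_binomials])).

(** For k = 1, 2, 3 the entry is both the right monomial of step k - 1 and the left monomial of step
    k, each multiplied by its factor. *)
Definition cert_middle : seq (seq (seq bool)) :=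
  [seq canon (map bits7 (flatten [seq x.2.2 | x <- take k fano_binomials] ++
             flatten [seq x.2.1 | x <- drop k fano_binomials])) | k <- iota 1 3].

(** Apart from the cancelling pairs, the left monomial of the first step and the right monomial of
    the last one coincide and carry the same sign. *)
Lemma cert_telescope :
  perm_eq [seq (x.1, canon x.2) | x <- cert_terms & cert_zero x.2]
    ([:: (true, cert_main); (true, cert_main)] ++
     flatten [seq [:: (false, m); (true, m)] | m <- cert_middle]).
Proof. by vm_compute. Qed.

Lemma cert_even : all (fun x => all (fun X => (size X == 7%N) && ~~ odd (count id X)) x.2) cert_terms
  && all (fun X => [&& size X == 7%N, ~~ odd (count id X) & fano_dist X == 0%N]) cert_main.
Proof. by vm_compute. Qed.

Section Certificate.
Variables (R : realType) (n : nat).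
Hypothesis n7 : (7 <= n)%N.
Local Notation sets := {set 'I_n}.

Definition monoB (l : seq (seq bool)) : monom n :=
  [ffun T : sets => count (fun X => T == sset n X) l].

Lemma monoB_cat l1 l2 : monoB (l1 ++ l2) = monadd (monoB l1) (monoB l2).
Proof. by apply/ffunP => T; rewrite !ffunE count_cat. Qed.

Lemma monoB_seq1 X : monoB [:: X] = monS (sset n X).
Proof. by apply/ffunP => T; rewrite !ffunE /= addn0. Qed.

Lemma monoB_perm l1 l2 : perm_eq l1 l2 -> monoB l1 = monoB l2.
Proof. by move=> /permP h; apply/ffunP => T; rewrite !ffunE h. Qed.

Lemma card_sset X : (size X <= n)%N -> #|sset n X| = count id X.
Proof.
move=> sX; rewrite cardE -(size_map val).
have -> : count id X = size [seq i <- iota 0 (size X) | nth false X i].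
  by rewrite size_filter -{1}[X](mkseq_nth false) /mkseq count_map.
apply/perm_size/uniq_perm; rewrite ?filter_uniq ?iota_uniq //.
  by rewrite map_inj_uniq ?enum_uniq //; apply: val_inj.
move=> i; rewrite mem_filter mem_iota add0n /=; apply/mapP/andP => [[k]|[Xi iX]].
  rewrite mem_enum inE => Xk ->; split=> //; rewrite ltnNge; apply/negP => le.
  by rewrite nth_default in Xk.
by exists (Ordinal (leq_trans iX sX)); rewrite // mem_enum inE.
Qed.

Lemma mondot_monoB (l : seq (seq bool)) :
  all (fun X => (size X == 7%N) && ~~ odd (count id X)) l ->
  mondot (monoB l) (fano_vec R (n:=n)) = Some (\sum_(X <- l) fano_dist X)%N%:R.
Proof.
elim: l => [_|X l IH /= /andP[/andP[/eqP sX oX] hl]].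
  rewrite big_nil /mondot; case: existsP => [[S]|_]; first by rewrite ffunE.
  by rewrite big1 // => S _; rewrite ffunE mul0r.
rewrite -cat1s monoB_cat mondot_add monoB_seq1 mondot_monS IH //.
rewrite /fano_vec card_sset ?sX // (negbTE oX) bits_sset //.
by rewrite big_cons natrD.
Qed.

Lemma psum_pmul1 (phi : monom n -> nov R) x a (Q : kpoly R n) :
  psum phi (pmul [:: (x, a)] Q) = emb x * psum (fun b => phi (monadd a b)) Q.
Proof.
rewrite /psum /pmul /= cats0 big_map mulr_sumr; apply: eq_bigr => u _ /=.
by rewrite emb_mul mulrA.
Qed.

(** The scalar repeats the signs of the two enumerations, which then square to 1 in [psum_wick]. *)
Definition cert_step (k : nat) : kpoly R n :=
  let: (c, (X, Y)) := fano_step k in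
  let s := enum (sset n X) in let t := enum (sset n Y) in
  pmul [:: (pzC ((-1) ^+ c * wsign R s * wsign R t), monoB (fano_factor k))] (wick R s t).

Definition cert_poly : kpoly R n := flatten (map cert_step (iota 0 4)).

Lemma cert_poly_ideal : ideal_gen (@wick_rels R n) cert_poly.
Proof.
have h k : ideal_gen (@wick_rels R n) (cert_step k).
  rewrite /cert_step; case: (fano_step k) => c [X Y]; apply/ig_mul/ig_gen.
  by exists (enum (sset n X)), (enum (sset n Y)).
rewrite /cert_poly; elim: (iota 0 4) => [|k s IH]; first exact: ig_zero.
exact: ig_add.
Qed.

Lemma psum_cert_step (phi : monom n -> nov R) k : 
  psum phi (cert_step k) = - \sum_(x <- step_terms k) (-1) ^+ x.1 * phi (monoB x.2).
Proof.
rewrite /cert_step /step_terms.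
have : (size (fano_step k).2.1 = 7%N) /\ (size (fano_step k).2.2 = 7%N) by rewrite !size_mkseq.
case: (fano_step k) => c [X Y] /= [sX sY].
rewrite psum_pmul1 psum_wick !set_enum emb_pzC.
rewrite -[X in nmono _ X](addr0 0) -nmonoM -[X in nmono _ X * _](addr0 0) -nmonoM.
rewrite !nmono_wsign nmono_sign big_map.
have -> (u v w z : nov R) : u * v * w * (- (v * w) * z) = - ((v * v) * (w * w) * (u * z)) by ring.
rewrite !ws_enum !mul1r; congr (- _); rewrite mulr_sumr.
have hST k0 : k0 \in symd (sset n X) (sset n Y) -> (k0 < 7)%N.
  rewrite in_symd !inE; apply: contraLR; rewrite -leqNgt => le.
  by rewrite !nth_default ?sX ?sY.
pose G i := (-1) ^+ (c (+) odd (count (fun j => (j < i)%N) (diffs X Y))) *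
    phi (monoB (fano_factor k ++ [:: flip i X; flip i Y])).
transitivity (\sum_(i in symd (sset n X) (sset n Y)) G i); last first.
  by rewrite (@big_diffs n 7) // !bits_sset.
rewrite /G; apply: eq_bigr => i iST; rewrite mulrA; congr (_ * phi _).
  case: i iST => i ni iST; rewrite (below_diffs (m := 7)) // !bits_sset //.
  by rewrite signr_addb signr_odd.
rewrite monoB_cat; congr monadd; rewrite -cat1s monoB_cat !monoB_seq1.
have E Z : size Z = 7%N -> symd (sset n Z) [set i] = sset n (flip i Z).
  move=> sZ; apply/setP => j; rewrite in_symd1 !inE.
  have [j7|j7] := ltnP j 7; first by rewrite nth_flip ?sZ.
  rewrite !nth_default ?size_flip ?sZ //.
  by case: eqP => // ji; move: j7; rewrite ji leqNgt hST.
by rewrite !E.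
Qed.

(** With phi arbitrary this describes all coefficients at once. The minus sign of [psum_cert_step]
    turns the two negative copies of [cert_main] into the coefficient 2. *)
Lemma psum_cert (phi : monom n -> nov R) : psum phi cert_poly =
  phi (monoB cert_main) *+ 2 -
  \sum_(x <- cert_terms | ~~ cert_zero x.2) (-1) ^+ x.1 * phi (monoB x.2).
Proof.
have -> : psum phi cert_poly = - \sum_(x <- cert_terms) (-1) ^+ x.1 * phi (monoB x.2).
  rewrite /cert_poly /cert_terms; elim: (iota 0 4) => [|k s IH] /=.
    by rewrite /psum !big_nil oppr0.
  by rewrite psum_cat psum_cert_step big_cat IH opprD.
rewrite (bigID (fun x => cert_zero x.2)) /= opprD; congr (_ - _).
transitivity (- \sum_(x <- [seq (x.1, canon x.2) | x <- cert_terms & cert_zero x.2])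
    (-1) ^+ x.1 * phi (monoB x.2)).
  rewrite big_map big_filter; congr (- _); apply: eq_bigr => x _ /=.
  by congr (_ * phi _); apply: monoB_perm; rewrite perm_sym perm_sort.
rewrite (perm_big _ cert_telescope) big_cat.
have -> : \sum_(x <- flatten [seq [:: (false, m); (true, m)] | m <- cert_middle])
    (-1) ^+ x.1 * phi (monoB x.2) = 0.
  by rewrite big_flatten big_map big1 // => m _; rewrite !big_cons big_nil /=; ring.
by move: cert_main => m; rewrite !big_cons big_nil /=; ring.
Qed.

Lemma fano_not_trop (I : kpoly R n -> Prop) :
  (forall P, ideal_gen (@wick_rels R n) P -> I P) -> ~ trop_variety I (fano_vec R (n:=n)).
Proof.
move=> hI /(_ _ (hI _ cert_poly_ideal)) /min_twiceP hP.
have /andP[/allP ev /allP ev0] := cert_even.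
set p := fano_vec R (n:=n) in hP *; set P := cert_poly in hP *.
set a0 := monoB cert_main.
have pc b : emb (pcoef P b) = (a0 == b)%:R *+ 2 -
    \sum_(x <- cert_terms | ~~ cert_zero x.2) (-1) ^+ x.1 * (monoB x.2 == b)%:R.
  by rewrite -psum_pcoef psum_cert.
have isCp b : isC (emb (pcoef P b)).
  rewrite pc mulr2n; apply: isC_D; first by apply: isC_D; apply: isC_bool.
  by apply/isC_N/isC_sum => x _; apply: isC_M; [apply: isC_sign|apply: isC_bool].
have pos x : x \in cert_terms -> ~~ cert_zero x.2 ->
    exists2 r, mondot (monoB x.2) p = Some r & 0 < r.
  move=> xc nz; eexists; first by apply: mondot_monoB; apply: ev.
  rewrite ltr0n lt0n; apply: contra nz => /eqP; move: (x.2) => l.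
  elim: l => // X l IH; rewrite big_cons /= => /eqP; rewrite addn_eq0 => /andP[-> /eqP].
  exact: IH.
have a0p : mondot a0 p = Some 0.
  rewrite mondot_monoB; last by apply/allP => X /ev0 /and3P[-> ->].
  by rewrite big_seq big1 // => X /ev0 /and3P[_ _ /eqP].
(* All other monomials take positive values at p, so none of them equals [a0] and the coefficient is
   exactly 2, of valuation 0 in characteristic 0. *)
have pc0 : emb (pcoef P a0) = 1 *+ 2.
  rewrite pc eqxx big_seq_cond big1 ?subr0 // => x /andP[xc nz].
  case: eqP => [e|_]; last by rewrite mulr0.
  by have [r] := pos x xc nz; rewrite e a0p => -[<-]; rewrite ltxx.
have n0 : emb (pcoef P a0) <> 0.
  rewrite pc0 => /(congr1 (fun f : nov R => f 0)); rewrite nov0E mulr2n novDE.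
  have -> : (1 : nov R) 0 = 1 by rewrite -[1 in LHS]/(nmono 1 0) nmonoE eqxx.
  by apply/eqP; rewrite -mulr2n pnatr_eq0.
have t0 := tropterm_const p (isCp a0) n0.
have [|b [_ ba0 le]] := hP _ (pcoef_mem n0); first by rewrite t0 a0p.
rewrite t0 a0p in le.
have [b0|b0] := pselect (emb (pcoef P b) = 0); first by rewrite tropterm_None in le.
rewrite (tropterm_const p (isCp b) b0) in le.
apply: b0; rewrite pc eq_sym (negbTE ba0) mul0rn sub0r big_seq_cond big1 ?oppr0 // => x /andP[xc nz].
case: eqP => [e|_]; last by rewrite mulr0.
by have [r] := pos x xc nz; rewrite e => E r0; move: le; rewrite E /= leNgt r0.
Qed.

Lemma supp_fano_vec : supp (fano_vec R (n:=n)) = [set S : sets | ~~ odd #|S|].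
Proof. by apply/setP => S; rewrite !inE /fano_vec; case: odd. Qed.

End Certificate.

(** * Circulations on K5 with prescribed valuations *)

Definition dist5 (s : seq nat) : bool := uniq s && all (fun i => (i < 5)%N) s.

Ltac d5 := clear; rewrite /dist5 /= !inE; lia.

Section Generic.
Variable R : realType.
Local Notation C := R[i].

Lemma nat_avoid (s : seq C) : exists c : nat, c%:R \notin s.
Proof.
apply: contrapT => h.
have sub : {subset [seq (c%:R : C) | c <- iota 0 (size s).+1] <= s}.
  by move=> x /mapP[c _ ->]; apply: contrapT => /negP cs; apply: h; exists c.
have u : uniq [seq (c%:R : C) | c <- iota 0 (size s).+1].
  by rewrite map_inj_uniq ?iota_uniq // => a b /eqP; rewrite eqr_nat => /eqP.
by have := uniq_leq_size u sub; rewrite size_map size_iota ltnn.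
Qed.

Lemma novMnE (f : nov R) k r : (f *+ k) r = f r *+ k.
Proof.
by elim: k => [|k IH]; rewrite ?mulr0n ?nov0E // !mulrS novDE IH.
Qed.

Lemma vgeMn (f : nov R) k r : vge f r -> vge (f *+ k) r.
Proof. by move=> h v vr; rewrite novMnE h // mul0rn. Qed.

(** Each new e is treated by adding a multiple of a vector that is right at e. Every leading
    coefficient vanishes for at most one multiplier, so a natural number outside a finite list
    serves them all. *)
Lemma generic_comb (I : eqType) (E : seq I) (x : I -> R) (W : (I -> nov R) -> Prop) :
  W (fun=> 0) ->
  (forall u v c, W u -> W v -> W (fun i => u i + v i *+ c)) ->
  (forall e, e \in E -> exists u, [/\ W u, forall e', e' \in E -> vge (u e') (x e')
     & u e (x e) != 0]) ->
  exists2 u, W u & forall e, e \in E -> hasval (u e) (x e).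
Proof.
move=> W0 WD h.
suff [u [Wu vu nu]] : exists u, [/\ W u, forall e', e' \in E -> vge (u e') (x e')
   & forall e, e \in E -> u e (x e) != 0].
  by exists u => // e eE; split; [apply: vu|apply: nu].
suff H (E1 : seq I) : {subset E1 <= E} -> exists u, [/\ W u, forall e', e' \in E -> vge (u e') (x e')
   & forall e, e \in E1 -> u e (x e) != 0] by apply: H.
elim: E1 => [|e E1 IH] sub.
  by exists (fun=> 0); split=> // e' _; apply: vge0.
have [|u [Wu vu nu]] := IH; first by move=> e' e'E; apply: sub; rewrite inE e'E orbT.
have [v [Wv vv nv]] := h e (sub _ (mem_head _ _)).
have [c cbad] := nat_avoid [seq - u e' (x e') / v e' (x e') | e' <- e :: E1].
exists (fun i => u i + v i *+ c); split; first exact: WD.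
  by move=> e' e'E; apply: vgeD; [apply: vu|apply/vgeMn/vv].
move=> e' e'E; rewrite novDE novMnE; apply/negP => /eqP eq0.
have [v0|v0] := eqVneq (v e' (x e')) 0.
  move: eq0; rewrite v0 mul0rn addr0 => /eqP; apply/negP.
  by move: e'E; rewrite inE => /orP[/eqP e'e|/nu //]; move: nv; rewrite -e'e v0 eqxx.
move/negP: cbad; apply; apply/mapP; exists e' => //.
apply: (mulIf v0); rewrite divfK // mulr_natl.
by apply/eqP; rewrite -addr_eq0 addrC eq0.
Qed.

Lemma argminP (T : eqType) (s : seq T) (f : T -> R) : s != [::] ->
  exists2 a, a \in s & forall c, c \in s -> f a <= f c.
Proof.
elim: s => // x [|y s] IH _.
  by exists x => [|c]; rewrite inE // => /eqP ->.
have [//|a as_ amin] := IH; have [xa|ax] := leP (f x) (f a).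
  exists x => [|c]; first by rewrite inE eqxx.
  rewrite inE => /orP[/eqP -> //|/amin]; exact: le_trans.
exists a => [|c]; first by rewrite inE as_ orbT.
by rewrite inE => /orP[/eqP ->|/amin //]; apply: ltW.
Qed.

Lemma dist5_full s o : dist5 s -> size s = 5%N -> (o < 5)%N -> o \in s.
Proof.
move=> /andP[us /allP s5] ss o5.
have sub : {subset s <= iota 0 5} by move=> x /s5; rewrite mem_iota.
by have [|_ ->] := uniq_min_size us sub; rewrite ?mem_iota ?ss.
Qed.

Section Flow.

Definition flow (a : nat -> nat -> nov R) : Prop :=
  (forall i j, a i j = - a j i) /\
  (forall i, (i < 5)%N -> \sum_(j <- iota 0 5) a i j = 0).

(** The Pfaffian of the principal submatrix on i, j, k, l. *)
Definition pf (a : nat -> nat -> nov R) i j k l : nov R :=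
  a i j * a k l - a i k * a j l + a i l * a j k.

Lemma vge_bool (c : bool) : vge (c%:R : nov R) 0.
Proof. by case: c; [case: (hasval1 R)|apply: vge0]. Qed.

(** The unit flow along the directed edge p. *)
Definition elem (p : nat * nat) (x y : nat) : nov R :=
  ((x == p.1) && (y == p.2))%:R - ((x == p.2) && (y == p.1))%:R.

Lemma elem_anti p x y : elem p x y = - elem p y x.
Proof. by rewrite /elem ![(x == _) && _]andbC; ring. Qed.

Lemma sum_delta i (c : nov R) : (i < 5)%N -> \sum_(j <- iota 0 5) (j == i)%:R * c = c.
Proof.
move=> i5; rewrite (bigD1_seq i) ?iota_uniq ?mem_iota //= eqxx mul1r big1 ?addr0 // => j.
by move=> /negbTE ->; rewrite mul0r.
Qed.

Lemma elem_sum p x : (p.1 < 5)%N -> (p.2 < 5)%N ->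
  \sum_(y <- iota 0 5) elem p x y = (x == p.1)%:R - (x == p.2)%:R.
Proof.
move=> p1 p2; rewrite sumrB.
have E (c : bool) i : (i < 5)%N -> \sum_(y <- iota 0 5) (c && (y == i))%:R = c%:R :> nov R.
  move=> i5; rewrite -(sum_delta (c%:R) i5); apply: eq_bigr => y _.
  by rewrite -natrM mulnb andbC.
by rewrite !E.
Qed.

(* Weights on the edges of the complete graph on {0,...,4} for which no edge is
   strictly the lightest one in the star of an endpoint. *)
Variable b : nat -> nat -> R.
Hypothesis bC : forall i j, b i j = b j i.
Hypothesis star : forall i j, dist5 [:: i; j] ->
  exists k, dist5 [:: i; j; k] /\ b i k <= b i j.

(** The star condition extends the edge ij at both ends by edges that are no heavier. On five
    vertices the two paths close up to a triangle, a quadrangle or a pentagon. [Es] lists the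
    remaining edges, and the last conjunct says that the cycle has boundary 0. *)
Lemma light_cycle i j : dist5 [:: i; j] -> exists Es : seq (nat * nat),
  [/\ forall p, p \in Es -> [/\ (p.1 < 5)%N, (p.2 < 5)%N, p != (i, j), p != (j, i) & b p.1 p.2 <= b i j]
    & forall x : nat, \sum_(p <- (i, j) :: Es) ((x == p.1)%:R - (x == p.2)%:R) = 0 :> nov R].
Proof.
move=> dij; have [k [dk lk]] := star dij.
have dji : dist5 [:: j; i] by move: dij; d5.
have [l [dl ll]] := star dji; rewrite (bC j i) in ll.
have tri o : dist5 [:: i; j; o] -> b i o <= b i j -> b j o <= b i j ->
    exists Es : seq (nat * nat),
  [/\ forall p, p \in Es -> [/\ (p.1 < 5)%N, (p.2 < 5)%N, p != (i, j), p != (j, i) & b p.1 p.2 <= b i j]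
    & forall x : nat, \sum_(p <- (i, j) :: Es) ((x == p.1)%:R - (x == p.2)%:R) = 0 :> nov R].
  move=> d l1 l2; exists [:: (j, o); (o, i)]; split=> [p|x]; last by rewrite !big_cons big_nil /=; ring.
  by rewrite !inE => /orP[] /eqP -> /=; split; rewrite ?xpair_eqE;
    try (move: d; d5); rewrite // bC.
have [lk'|lk'] := eqVneq l k; first by apply: (tri k) => //; rewrite -lk'.
have quad : b k l <= b i j -> exists Es : seq (nat * nat),
  [/\ forall p, p \in Es -> [/\ (p.1 < 5)%N, (p.2 < 5)%N, p != (i, j), p != (j, i) & b p.1 p.2 <= b i j]
    & forall x : nat, \sum_(p <- (i, j) :: Es) ((x == p.1)%:R - (x == p.2)%:R) = 0 :> nov R].
  move=> lkl; exists [:: (j, l); (l, k); (k, i)].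
  split=> [p|x]; last by rewrite !big_cons big_nil /=; ring.
  by rewrite !inE => /or3P[] /eqP -> /=; split; rewrite ?xpair_eqE;
    try (move: dk dl; d5); rewrite // bC.
have dki : dist5 [:: k; i] by move: dk; d5.
have [m [dm lm]] := star dki; rewrite (bC k i) in lm.
have [mj|mj] := eqVneq m j.
  by apply: (tri k) => //; apply: le_trans lk; rewrite bC -mj.
have [ml|ml] := eqVneq m l; first by apply: quad; apply: le_trans lk; rewrite -ml.
have dlj : dist5 [:: l; j] by move: dl; d5.
have [o [dlo lo]] := star dlj; rewrite (bC l j) in lo.
have [oi|oi] := eqVneq o i.
  apply: (tri l) => //; first by move: dl dij; d5.
  by apply: le_trans ll; rewrite bC -oi.
have [ok|ok] := eqVneq o k; first by apply: quad; apply: le_trans ll; rewrite bC -ok.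
have d : dist5 [:: i; j; k; l; m].
  by move: dk dl dm mj ml lk'; clear; rewrite /dist5 /= !inE; case: (k == l) / eqP; lia.
have om : o = m.
  have o5 : (o < 5)%N by move: dlo; rewrite /dist5 /= => /and5P[].
  have := dist5_full d (erefl _) o5; move: dlo oi ok; clear; rewrite /dist5 /= !inE; lia.
exists [:: (j, l); (l, m); (m, k); (k, i)].
split=> [p|x]; last by rewrite !big_cons big_nil /=; ring.
rewrite !inE => /or4P[] /eqP -> /=; split; rewrite ?xpair_eqE; try (move: dk dl dm; d5).
- by [].
- by apply: le_trans ll; rewrite -om.
- by apply: le_trans lk; rewrite bC.
- by rewrite bC.
Qed.

Definition edges5 : seq (nat * nat) :=
  [seq p <- [seq (i, j) | i <- iota 0 5, j <- iota 0 5] | p.1 != p.2].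

Lemma mem_edges5 i j : ((i, j) \in edges5) = dist5 [:: i; j].
Proof.
rewrite mem_filter.
have -> : ((i, j) \in [seq (i, j) | i <- iota 0 5, j <- iota 0 5]) = (i < 5)%N && (j < 5)%N.
  apply/allpairsP/andP => [[p [+ + [-> ->]]]|[i5 j5]]; rewrite ?mem_iota //.
  by exists (i, j); rewrite !mem_iota.
by rewrite /dist5 /= !inE !andbT.
Qed.

(** The unit flow along the light cycle through ij, times t^(b i j), has the right valuation on ij
    and sufficiently large ones elsewhere; [generic_comb] combines these flows. *)
Lemma flow_exists : exists2 a, flow a & forall i j, dist5 [:: i; j] -> hasval (a i j) (b i j).
Proof.
pose W (u : nat * nat -> nov R) := flow (fun i j => u (i, j)).
have [|u v c [u1 u2] [v1 v2]|[i j]|u Wu hu] := @generic_comb _ edges5 (fun p => b p.1 p.2) W.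
- by split=> [i j|i _]; rewrite ?oppr0 // big1.
- split=> [i j|i i5]; first by rewrite u1 v1 mulNrn -opprD.
  by rewrite big_split sumrMnl /= u2 // v2 // mul0rn addr0.
- rewrite mem_edges5 => dij; have [Es [hEs bal]] := light_cycle dij.
  exists (fun q => nmono 1 (b i j) * \sum_(p <- (i, j) :: Es) elem p q.1 q.2).
  have dij' : (i < 5)%N /\ (j < 5)%N by move: dij; d5.
  split=> [|[x y]|]; [split=> [x y|x x5]| | ].
  + by rewrite -mulrN -sumrN; congr (_ * _); apply: eq_bigr => p _ /=; apply: elem_anti.
  + rewrite -mulr_sumr exchange_big /=.
    have -> : \sum_(p <- (i, j) :: Es) \sum_(y <- iota 0 5) elem p x y =
       \sum_(p <- (i, j) :: Es) ((x == p.1)%:R - (x == p.2)%:R).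
      apply: eq_big_seq => p; rewrite inE => /orP[/eqP ->|/hEs[p1 p2 _ _ _]];
        by rewrite elem_sum //; case: dij'.
    by rewrite bal mulr0.
  + rewrite mem_edges5 => dxy /=; rewrite mulr_sumr big_seq.
    apply: (big_ind (fun f => vge f (b x y))); [exact: vge0|by move=> *; apply: vgeD|].
    move=> p pE; have lp : b p.1 p.2 <= b i j.
      by move: pE; rewrite inE => /orP[/eqP ->|/hEs[]].
    have [e|/norP[/negbTE e1 /negbTE e2]] :=
      boolP (((x == p.1) && (y == p.2)) || ((x == p.2) && (y == p.1))); last first.
      by rewrite /elem e1 e2 subrr mulr0; apply: vge0.
    have -> : b x y = b p.1 p.2.
      by move: e => /orP[] /andP[/eqP -> /eqP ->] //; apply: bC.
    have h0 : vge (elem p x y) 0 by apply: vgeD; [|apply: vgeN]; apply: vge_bool.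
    have := (vgeM (@vge_mono R 1 (b i j)) h0).1; rewrite addr0; exact: vge_le lp.
  + have S1 : \sum_(p <- (i, j) :: Es) elem p i j = 1.
      rewrite big_cons big_seq big1 => [|p /hEs[_ _ p1 p2 _]].
        rewrite /elem /= !eqxx; have -> : (i == j) = false by move: dij; d5.
        by rewrite subr0 addr0.
      rewrite /elem; case: p p1 p2 => x y /=; rewrite !xpair_eqE.
      rewrite (eq_sym i x) (eq_sym j y) (eq_sym i y) (eq_sym j x) (andbC (y == i)).
      by move=> /negbTE -> /negbTE ->; rewrite subrr.
    change ((nmono 1 (b i j) * \sum_(p <- (i, j) :: Es) elem p i j) (b i j) != 0).
    by rewrite S1 mulr1 nmonoE eqxx oner_neq0.
- exists (fun i j => u (i, j)) => // i j dij.
  by apply: (hu (i, j)); rewrite mem_edges5.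
Qed.

(* The solution is a generic combination of circuits, which are supported on three
   indices. *)
Lemma kernel_exists (z : nat -> nov R) (la : nat -> R) :
  (forall i j, dist5 [:: i; j] -> hasval (z j - z i) (b i j - la i - la j)) ->
  exists s, [/\ \sum_(i <- iota 0 5) s i = 0, \sum_(i <- iota 0 5) s i * z i = 0
    & forall i, (i < 5)%N -> hasval (s i) (la i)].
Proof.
move=> hz.
pose W (u : nat -> nov R) := \sum_(i <- iota 0 5) u i = 0 /\ \sum_(i <- iota 0 5) u i * z i = 0.
have [|u v c [u1 u2] [v1 v2]|i|s [s1 s2] hs] := @generic_comb _ (iota 0 5) la W.
- by split; rewrite big1 // => i _; rewrite mul0r.
- split; first by rewrite big_split sumrMnl /= u1 v1 mul0rn addr0.
  under eq_bigr => i _ do rewrite mulrDl mulrnAl.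
  by rewrite big_split sumrMnl /= u2 v2 mul0rn addr0.
- rewrite mem_iota add0n /= => i5.
  pose s := [seq p <- edges5 | (p.1 != i) && (p.2 != i)].
  have s0 : s != [::].
    have [j [k [d di]]] : exists j k, dist5 [:: j; k] /\ (j != i) && (k != i).
      by case: i i5 {s} => [|[|[|i]]] i5; [exists 1%N, 2%N|exists 0%N, 2%N|exists 0%N, 1%N|exists 0%N, 1%N].
    have : (j, k) \in s by rewrite mem_filter mem_edges5 d di.
    by case: (s).
  (* Let jk be the lightest edge avoiding i. The star condition at j and at k shows that ji and ki
     are no lighter. The circuit on i, j, k, scaled by t^h to valuation [la i] at i, therefore has
     valuations at least [la j] and [la k] at j and k. *)
  have [[j k]] := argminP (fun p => b p.1 p.2) s0.
  rewrite mem_filter mem_edges5 /= => /andP[/andP[ji ki] djk] jkmin.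
  have key x : (x == j) || (x == k) -> b j k <= b x i.
    move=> xjk; have [m [dm lm]] : exists m, dist5 [:: x; i; m] /\ b x m <= b x i.
      by apply: star; move: djk ji ki i5 xjk; d5.
    apply: le_trans lm; apply: (jkmin (x, m)); rewrite mem_filter mem_edges5 /=.
    by move: dm; d5.
  have kj := key j; have kk := key k; rewrite !eqxx orbT in kj kk.
  have {}kj := kj isT; have {}kk := kk isT.
  have [i5' [j5 k5]] : (i < 5)%N /\ (j < 5)%N /\ (k < 5)%N.
    by move: djk i5; d5.
  pose h := la i - (b j k - la j - la k).
  have dij : dist5 [:: i; j] by move: djk ji ki i5; d5.
  have dki : dist5 [:: k; i] by move: djk ji ki i5; d5.
  have dkj : dist5 [:: k; j] by move: djk ji ki i5; d5.
  exists (fun x => nmono 1 h * ((x == i)%:R * (z j - z k) + (x == j)%:R * (z k - z i) +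
                      (x == k)%:R * (z i - z j))).
  split=> [|x|].
  + split; first by rewrite -mulr_sumr !big_split /= !sum_delta //; ring.
    rewrite (eq_bigr (fun x => nmono 1 h * ((x == i)%:R * ((z j - z k) * z x) +
      (x == j)%:R * ((z k - z i) * z x) + (x == k)%:R * ((z i - z j) * z x)))); last by move=> x _; ring.
    rewrite -mulr_sumr !big_split /=.
    have E y (c : nov R) : (y < 5)%N ->
        \sum_(x <- iota 0 5) (x == y)%:R * (c * z x) = c * z y.
      move=> y5; rewrite -[RHS](sum_delta _ y5); apply: eq_bigr => x _.
      by case: eqP => [->|_] //; rewrite !mul0r.
    by rewrite !E //; ring.
  + move=> _; rewrite mulrDr mulrDr; apply: vgeD; [apply: vgeD|];
      case: eqP => [->|_]; rewrite ?mul0r ?mulr0 ?mul1r; try exact: vge0.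
    * have [h1 _] := hz _ _ dkj.
      apply: (vge_le _ (vgeM (@vge_mono R 1 h) h1).1); rewrite /h (bC k j); lra.
    * have := hz _ _ dki => /hasvalN; rewrite opprB => -[h1 _].
      apply: (vge_le _ (vgeM (@vge_mono R 1 h) h1).1); rewrite /h; lra.
    * have := hz _ _ dij => /hasvalN; rewrite opprB => -[h1 _].
      by apply: (vge_le _ (vgeM (@vge_mono R 1 h) h1).1); rewrite /h (bC i j); lra.
  + rewrite eqxx (eq_sym i j) (negbTE ji) (eq_sym i k) (negbTE ki) !mul0r !addr0 mul1r.
    have := hasvalM (hasval_mono h (oner_neq0 _)) (hz _ _ dkj).
    by rewrite (_ : h + _ = la i) => [[]|]; last by rewrite /h (bC k j); lra.
- by exists s; split=> // i i5; apply: hs; rewrite mem_iota.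
Qed.

End Flow.
End Generic.

(** * Tree metrics *)

Section TreeFlow.
Variable R : realType.
Local Notation C := R[i].

(** The four sums are the possible constant coefficients, according to which of l1 and l2 vanish. *)
Lemma hasval_tri (c0 c1 c2 : int) (l1 l2 : R) : 0 <= l1 -> 0 <= l2 ->
  [&& c0 != 0, c0 + c1 != 0, c0 + c2 != 0 & c0 + c1 + c2 != 0] ->
  hasval (nmono (c0%:~R : C) 0 + nmono c1%:~R l1 + nmono c2%:~R l2) 0.
Proof.
move=> p1 p2 /and4P[n0 n1 n2 n3]; split.
  apply: vgeD; first (apply: vgeD; first exact: vge_mono).
  - by apply: vge_le p1 _; apply: vge_mono.
  - by apply: vge_le p2 _; apply: vge_mono.
rewrite !novDE !nmonoE eqxx.
by case: (0 == l1); case: (0 == l2); rewrite ?addr0 -?intrD intr_eq0.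
Qed.

(** The tree has the cherries {0, 1} and {2, 3} and the further leaf 4. If s is orthogonal to the
    all-ones vector and to z, the matrix s i * s j * (z j - z i) is a circulation of rank at most 2,
    so all its Pfaffians vanish. *)
Lemma tree_flow (b : nat -> nat -> R) (la : nat -> R) (l1 l2 L : R) :
  (forall i j, b i j = b j i) ->
  (forall i j, dist5 [:: i; j] -> exists k, dist5 [:: i; j; k] /\ b i k <= b i j) ->
  0 <= l1 -> 0 <= l2 ->
  (forall i j, dist5 [:: i; j] -> (i < j)%N ->
     b i j = la i + la j + (if (i, j) == (0, 1)%N then l1 else if (i, j) == (2, 3)%N then l2 else 0)) ->
  b 1 3 + b 0 2 <= L -> b 1 3 + b 2 4 <= L -> b 1 3 + b 0 4 <= L ->
  exists a : nat -> nat -> nov R, [/\ flow a, forall i j, dist5 [:: i; j] -> hasval (a i j) (b i j)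
    & hasval (pf a 1 2 3 4) L].
Proof.
move=> bC star p1 p2 hb L02 L24 L04.
(* [z = (0, 5 t^l1, 1, 1 + 7 t^l2, 2)]; the constants 5 and 7 avoid cancellations when
   [l1] or [l2] vanishes. *)
pose zc (i : nat) : int * int * int :=
  nth (0, 0, 0) [:: (0, 0, 0); (0, 5, 0); (1, 0, 0); (1, 0, 7); (2, 0, 0)] i.
pose Z (c : int * int * int) : nov R :=
  nmono c.1.1%:~R 0 + nmono c.1.2%:~R l1 + nmono c.2%:~R l2.
pose z i := Z (zc i).
have zB i j : z j - z i = Z ((zc j).1.1 - (zc i).1.1, (zc j).1.2 - (zc i).1.2, (zc j).2 - (zc i).2).
  have E (c d : int) r : nmono ((c - d)%:~R : C) r = nmono c%:~R r - nmono d%:~R r.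
    apply: novP => v; rewrite novBE !nmonoE intrB; case: eqP => //; by rewrite subr0.
  by rewrite /z /Z !E; ring.
have hz' i j : dist5 [:: i; j] -> (i < j)%N -> hasval (z j - z i) (b i j - la i - la j).
  move=> dij ij; rewrite hb // (_ : _ - la i - la j =
    if (i, j) == (0, 1)%N then l1 else if (i, j) == (2, 3)%N then l2 else 0); last by lra.
  rewrite zB; move: dij ij; rewrite /dist5 /= !inE andbT => /andP[_ /andP[i5 j5]].
  case: i i5 => [|[|[|[|[|]]]]] // _; case: j j5 => [|[|[|[|[|]]]]] // _ _; try by apply: hasval_tri.
  - rewrite /Z /= !subrr nmono0 add0r nmono0 addr0.
    by apply: hasval_mono; rewrite intr_eq0.
  - rewrite /Z /= !subrr !nmono0 !add0r.
    by apply: hasval_mono; rewrite intr_eq0.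
have hz i j : dist5 [:: i; j] -> hasval (z j - z i) (b i j - la i - la j).
  move=> dij; have [ij|ji|ij] := ltngtP i j; first exact: hz'.
  - rewrite -opprB; apply: hasvalN.
    have -> : b i j - la i - la j = b j i - la j - la i by rewrite (bC i j); lra.
    by apply: hz' => //; move: dij; d5.
  - by move: dij ij; d5.
have [s [s1 s2 hs]] := kernel_exists bC star hz.
pose a i j := s i * s j * (z j - z i).
have ha i j : dist5 [:: i; j] -> hasval (a i j) (b i j).
  move=> dij; have [i5 j5] : (i < 5)%N /\ (j < 5)%N by move: dij; d5.
  have := hasvalM (hasvalM (hs _ i5) (hs _ j5)) (hz _ _ dij).
  by rewrite (_ : la i + la j + _ = b i j) //; lra.
(* Within {1, 2, 3, 4} the triangle 0, 2, 4 has only the edge 24, so adding t along it changes the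
   Pfaffian by - a 1 3 * t, which fixes the exponent. The choice of [c] prevents cancellation on the
   three edges. *)
pose r := L - b 1 3.
have [c cbad] := nat_avoid [:: 0; - a 0%N 2%N r; - a 2%N 4%N r; - a 4%N 0%N r].
pose t : nov R := nmono c%:R r.
pose tri x y : nov R := t * (elem R (0, 2)%N x y + elem R (2, 4)%N x y + elem R (4, 0)%N x y).
have c0 : c%:R != 0 :> C by move: cbad; rewrite !inE !negb_or => /andP[].
have ht (f : nov R) v : hasval f v -> v <= r -> c%:R != - f r -> hasval (f + t) v.
  move=> [h1 h2] vr cf; split.
    by apply: vgeD => //; apply: vge_le vr _; apply: vge_mono.
  rewrite novDE nmonoE; case: (v =P r) => [e|_]; last by rewrite addr0.
  by rewrite addrC addr_eq0 e.
exists (fun i j => a i j + tri i j); split.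
- split=> [i j|i i5].
    by rewrite /tri ![elem _ _ i j]elem_anti /a; ring.
  transitivity (\sum_(j <- iota 0 5) a i j + t * (\sum_(j <- iota 0 5) elem R (0, 2)%N i j +
    \sum_(j <- iota 0 5) elem R (2, 4)%N i j + \sum_(j <- iota 0 5) elem R (4, 0)%N i j)).
    by rewrite -!big_split mulr_sumr -big_split.
  rewrite !elem_sum //.
  have -> : \sum_(j <- iota 0 5) a i j =
    s i * (\sum_(j <- iota 0 5) s j * z j) - s i * z i * \sum_(j <- iota 0 5) s j.
    by rewrite !mulr_sumr -sumrB; apply: eq_bigr => j _; rewrite /a; ring.
  by rewrite s1 s2; ring.
- have symm i j : hasval (a i j + tri i j) (b i j) -> hasval (a j i + tri j i) (b j i).
    move=> /hasvalN; rewrite (bC i j).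
    have -> // : - (a i j + tri i j) = a j i + tri j i.
    by rewrite /tri ![elem _ _ i j]elem_anti /a; ring.
  move: cbad; rewrite !inE !negb_or => /and4P[_ b1 b2 b3].
  have h02 : hasval (a 0%N 2%N + tri 0%N 2%N) (b 0%N 2%N).
    rewrite (_ : tri 0%N 2%N = t); last by rewrite /tri /elem /=; ring.
    by apply: ht => //; [apply: ha|rewrite /r; lra].
  have h24 : hasval (a 2%N 4%N + tri 2%N 4%N) (b 2%N 4%N).
    rewrite (_ : tri 2%N 4%N = t); last by rewrite /tri /elem /=; ring.
    by apply: ht => //; [apply: ha|rewrite /r; lra].
  have h40 : hasval (a 4%N 0%N + tri 4%N 0%N) (b 4%N 0%N).
    rewrite (_ : tri 4%N 0%N = t); last by rewrite /tri /elem /=; ring.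
    by apply: ht => //; [apply: ha|rewrite /r (bC 4 0)%N; lra].
  move=> i j dij; have := ha i j dij.
  move: dij; rewrite /dist5 /= !inE andbT => /andP[_ /andP[i5 j5]].
  case: i i5 => [|[|[|[|[|]]]]] // _; case: j j5 => [|[|[|[|[|]]]]] // _ h;
    first [by [] | by apply: symm | by rewrite (_ : tri _ _ = 0) ?addr0 // /tri /elem /=; ring].
- have -> : pf (fun i j => a i j + tri i j) 1 2 3 4 = - (a 1%N 3%N * t).
    by rewrite /pf /tri /elem /= /a; ring.
  apply: hasvalN; have := hasvalM (ha 1%N 3%N isT) (hasval_mono r c0).
  by rewrite (_ : _ + r = L) // /r addrC subrK.
Qed.

End TreeFlow.

(** * Lifting weights on K5 *)

Section LiftFlow.
Variable R : realType.
Implicit Types (b : nat -> nat -> R) (L : R).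

Definition star_cond b : Prop := forall i j, dist5 [:: i; j] ->
  exists k, dist5 [:: i; j; k] /\ b i k <= b i j.

(** The tropical Pfaffian relation: on any four vertices the minimum of L and the weights of the
    three perfect matchings is attained at least twice. *)
Definition match_cond b L : Prop := forall i j k l, dist5 [:: i; j; k; l] ->
  [\/ b i j + b k l <= L, b i k + b j l <= L | b i l + b j k <= L] /\
  [\/ L <= b i j + b k l, b i k + b j l <= b i j + b k l | b i l + b j k <= b i j + b k l].

(** Any four vertices may carry the last condition, because for a circulation all these Pfaffians
    agree up to sign ([pf_exchange]). *)
Definition lifted b L : Prop := exists a : nat -> nat -> nov R,
  [/\ flow a, forall i j, dist5 [:: i; j] -> hasval (a i j) (b i j)
    & exists i j k l, dist5 [:: i; j; k; l] /\ hasval (pf a i j k l) L].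

(** * Permutations of the vertices *)

Section Relabel.
Variable xs : seq nat.
Hypotheses (dxs : dist5 xs) (sxs : size xs = 5%N).
Local Notation pi i := (nth 0%N xs i).
Local Notation pinv i := (index i xs).

Let uxs : uniq xs. Proof. by case/andP: dxs. Qed.
Let pinv_lt i : (i < 5)%N -> (pinv i < 5)%N.
Proof. by move=> i5; rewrite -sxs index_mem dist5_full. Qed.
Let pinvK i : (i < 5)%N -> pi (pinv i) = i.
Proof. by move=> i5; rewrite nth_index // dist5_full. Qed.
Let piK i : (i < 5)%N -> pinv (pi i) = i.
Proof. by move=> i5; rewrite index_uniq // sxs. Qed.

Lemma dist5_pi s : dist5 s -> dist5 (map (fun i => pi i) s).
Proof.
move=> /andP[us /allP s5]; apply/andP; split.
  by rewrite map_inj_in_uniq // => i j /s5 i5 /s5 j5 e; rewrite -(piK i5) e piK.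
apply/allP => x /mapP[i /s5 i5 ->].
by case/andP: dxs => _ /allP; apply; rewrite mem_nth // sxs.
Qed.

Lemma dist5_pinv s : dist5 s -> dist5 (map (fun i => pinv i) s).
Proof.
move=> /andP[us /allP s5]; apply/andP; split.
  by rewrite map_inj_in_uniq // => i j /s5 i5 /s5 j5 e; rewrite -(pinvK i5) e pinvK.
by apply/allP => x /mapP[i /s5 i5 ->]; apply: pinv_lt.
Qed.

Lemma dist5_mem s i : dist5 s -> i \in s -> (i < 5)%N.
Proof. by move=> /andP[_ /allP h] /h. Qed.

Lemma relabel_star b : star_cond b -> star_cond (fun i j => b (pi i) (pi j)).
Proof.
move=> h i j /[dup] dij /dist5_pi /h[k [dk lk]]; exists (pinv k).
have k5 : (k < 5)%N by apply: dist5_mem dk _; rewrite !inE eqxx !orbT.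
rewrite pinvK //; split=> //.
have := dist5_pinv dk; rewrite /= !piK //; apply: dist5_mem dij _; by rewrite !inE eqxx ?orbT.
Qed.

Lemma relabel_match b L : match_cond b L -> match_cond (fun i j => b (pi i) (pi j)) L.
Proof. by move=> h i j k l /dist5_pi /h. Qed.

Lemma relabel_lifted b L : lifted (fun i j => b (pi i) (pi j)) L -> lifted b L.
Proof.
move=> [a [[a1 a2] ha [i [j [k [l [d hpf]]]]]]].
exists (fun x y => a (pinv x) (pinv y)); split.
- split=> [x y|x x5]; first exact: a1.
  have sub : {subset [seq pinv y | y <- iota 0 5] <= iota 0 5}.
    by move=> z /mapP[y]; rewrite !mem_iota => y5 ->; apply: pinv_lt.
  have u : uniq [seq pinv y | y <- iota 0 5].
    by have /andP[] := dist5_pinv (isT : dist5 (iota 0 5)).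
  have [|_ E] := uniq_min_size u sub; first by rewrite size_map.
  have P : perm_eq [seq pinv y | y <- iota 0 5] (iota 0 5) by apply: uniq_perm.
  by rewrite -[RHS](a2 _ (pinv_lt x5)) -[RHS](perm_big _ P) big_map.
- move=> x y dxy; have [x5 y5] : (x < 5)%N /\ (y < 5)%N.
    by split; apply: dist5_mem dxy _; rewrite !inE eqxx ?orbT.
  by have := ha _ _ (dist5_pinv dxy); rewrite !pinvK.
- exists (pi i), (pi j), (pi k), (pi l); split; first exact: dist5_pi d.
  by rewrite /pf !piK //; apply: dist5_mem d _; rewrite !inE eqxx ?orbT.
Qed.

End Relabel.

(** The equations and inequalities are four-point conditions of the tree in [tree_flow]; they allow
    b to be decomposed into leaf weights and two inner lengths. *)
Lemma lifted_tree b L : (forall i j, b i j = b j i) -> star_cond b -> match_cond b L ->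
  b 0 3 + b 1 2 = b 0 2 + b 1 3 -> b 0 4 + b 1 2 = b 0 2 + b 1 4 ->
  b 0 4 + b 1 3 = b 0 3 + b 1 4 -> b 2 4 + b 0 3 = b 3 4 + b 0 2 ->
  b 0 4 + b 1 2 <= b 0 1 + b 2 4 -> b 2 4 + b 0 3 <= b 2 3 + b 0 4 ->
  lifted b L.
Proof.
move=> bC star mt e1 e2 e3 e4 i1 i2.
(* Solves b i j = la i + la j on the triangle 0, 2, 4 for the weight of the leaf 4; the edges to 4
   then determine the other leaf weights. *)
pose l4 := (b 0 4 + b 2 4 - b 0 2) / 2%:R.
pose la i := nth 0 [:: b 0 4 - l4; b 1 4 - l4; b 2 4 - l4; b 3 4 - l4; l4] i.
have l4E : 2%:R * l4 = b 0 4 + b 2 4 - b 0 2 by rewrite mulrC divfK // pnatr_eq0.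
have [||i j||||a [a1 a2 a3]] := @tree_flow R b la (b 0 1 - b 1 4 + b 2 4 - b 0 2)
   (b 2 3 - b 3 4 + b 0 4 - b 0 2) L bC star.
- by lra.
- by lra.
- move=> dij ij; move: dij ij; rewrite /dist5 /= !inE andbT => /andP[_ /andP[i5 j5]].
  by case: i i5 => [|[|[|[|[|]]]]] // _; case: j j5 => [|[|[|[|[|]]]]] // _ _;
    rewrite /la /=; clear -e1 e2 e3 e4 l4E; lra.
(* In each of the last three goals the matching is a lightest one on its four vertices. By
   [match_cond] some matching has weight at most L, hence so does this one. *)
- have [[] h _] := mt 0 2 1 3 isT; move: h i1 i2; rewrite ?(bC 2 1)%N ?(bC 3 1)%N; lra.
- have [[] h _] := mt 1 3 2 4 isT; move: h i1 i2; rewrite ?(bC 3 2)%N; lra.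
- have [[] h _] := mt 1 3 0 4 isT; move: h i1 i2; rewrite ?(bC 3 0)%N ?(bC 1 0)%N; lra.
by exists a; split=> //; exists 1%N, 2%N, 3%N, 4%N.
Qed.

Lemma two_smallest (x y z : R) : (y <= x \/ z <= x) -> (x <= y \/ z <= y) -> (x <= z \/ y <= z) ->
  (y = z /\ y <= x) \/ ((x = z /\ x <= y) \/ (x = y /\ x <= z)).
Proof.
by case=> h1; case=> h2; case=> h3;
  first [by left; split; lra | by right; left; split; lra | by right; right; split; lra].
Qed.

(* A point is chosen as root and the Gromov products with respect to it form an
   ultrametric; [i] and [j] realise its largest value. *)
Lemma lifted_cherry b L i j k l : (forall i j, b i j = b j i) -> star_cond b -> match_cond b L ->
  (forall i j k l, dist5 [:: i; j; k; l] ->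
     b i k + b j l <= b i j + b k l \/ b i l + b j k <= b i j + b k l) ->
  dist5 [:: i; j; k; l; 4%N] ->
  b i k + b j 4 <= b i j + b k 4 -> b i 4 + b j k <= b i j + b k 4 ->
  b i l + b j 4 <= b i j + b l 4 -> b i 4 + b j l <= b i j + b l 4 ->
  lifted b L.
Proof.
move=> bC star mt tie d mk1 mk2 ml1 ml2.
have c1 := bC j i; have c2 := bC k i; have c3 := bC l i; have c4 := bC 4 i.
have c5 := bC k j; have c6 := bC l j; have c7 := bC 4 j; have c8 := bC l k.
have c9 := bC 4 k; have c10 := bC 4 l.
(* The matching containing ij is a heaviest one, so the tie condition equates the two others. *)
have E1 : b i k + b j 4 = b i 4 + b j k.
  have t1 := tie i k j 4 ltac:(move: d; d5); have t2 := tie j k i 4 ltac:(move: d; d5).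
  by case: t1; case: t2; lra.
have E2 : b i l + b j 4 = b i 4 + b j l.
  have t1 := tie i l j 4 ltac:(move: d; d5); have t2 := tie j l i 4 ltac:(move: d; d5).
  by case: t1; case: t2; lra.
have relab xs : dist5 xs -> size xs = 5%N ->
    lifted (fun u v => b (nth 0%N xs u) (nth 0%N xs v)) L -> lifted b L.
  by move=> dx sx; apply: relabel_lifted.
have tree x0 x1 x2 x3 x4 : dist5 [:: x0; x1; x2; x3; x4] ->
    b x0 x3 + b x1 x2 = b x0 x2 + b x1 x3 -> b x0 x4 + b x1 x2 = b x0 x2 + b x1 x4 ->
    b x0 x4 + b x1 x3 = b x0 x3 + b x1 x4 -> b x2 x4 + b x0 x3 = b x3 x4 + b x0 x2 ->
    b x0 x4 + b x1 x2 <= b x0 x1 + b x2 x4 -> b x2 x4 + b x0 x3 <= b x2 x3 + b x0 x4 ->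
    lifted b L.
  move=> dx *; apply: (relab _ dx) => //; apply: lifted_tree => //.
  - exact: relabel_star.
  - exact: relabel_match.
have t1 := tie k l i 4 ltac:(move: d; d5).
have t2 := tie i k l 4 ltac:(move: d; d5).
have t3 := tie i l k 4 ltac:(move: d; d5).
(* A heaviest matching on i, k, l, 4 tells which two of k, l, 4 form the second cherry. *)
have [|||[n1 n1']|[[n2 n2']|[n3 n3']]] :=
  @two_smallest (b k l + b i 4) (b i k + b l 4) (b i l + b k 4).
- by clear -t1 c2 c3; case: t1; [left|right]; lra.
- by clear -t2 c8; case: t2; [right|left]; lra.
- by clear -t3 c8; case: t3; [right|left]; lra.
- by apply: (tree i j k l 4%N) => //; lra.
- by apply: (tree i j l 4%N k); [move: d; d5|lra..].
- by apply: (tree i j k 4%N l); [move: d; d5|lra..].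
Qed.

(** A strictly lightest matching forces L to be its weight, and its term then dominates the Pfaffian
    of every lift of b. Without such a matching all four-point conditions hold. *)
Lemma lift_flow b L : (forall i j, b i j = b j i) -> star_cond b -> match_cond b L -> lifted b L.
Proof.
move=> bC star mt.
have [[i [j [k [l [d [h1 h2]]]]]]|nB] := pselect (exists i j k l,
  dist5 [:: i; j; k; l] /\ b i j + b k l < b i k + b j l /\ b i j + b k l < b i l + b j k).
  have E : L = b i j + b k l by have [m1 m2] := mt i j k l d; case: m1; case: m2; lra.
  have [a fa ha] := flow_exists bC star.
  exists a; split=> //; exists i, j, k, l; split=> //; rewrite E /pf.
  have A x y u v : dist5 [:: x; y] -> dist5 [:: u; v] -> hasval (a x y * a u v) (b x y + b u v).
    by move=> ? ?; apply: hasvalM; apply: ha.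
  have A1 : hasval (a i j * a k l) (b i j + b k l) by apply: A; move: d; d5.
  have [A2 _] : hasval (- (a i k * a j l)) (b i k + b j l).
    by apply: hasvalN; apply: A; move: d; d5.
  have [A3 _] : hasval (a i l * a j k) (b i l + b j k) by apply: A; move: d; d5.
  by apply: (hasvalDl _ A3) => //; apply: (hasvalDl A1 A2).
have tie i j k l : dist5 [:: i; j; k; l] ->
     b i k + b j l <= b i j + b k l \/ b i l + b j k <= b i j + b k l.
  move=> d; have [|h1] := leP (b i k + b j l) (b i j + b k l); first by left.
  have [|h2] := leP (b i l + b j k) (b i j + b k l); first by right.
  by case: nB; exists i, j, k, l.
(* If ij has the least g, then for each further vertex k the matching of ij with k4 is a heaviest
   one, so i and j form a cherry. *)
pose g (p : nat * nat) := b p.1 4 + b p.2 4 - b p.1 p.2.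
have [[i j] pin pmin] := @argminP R _
  [:: (0, 1); (0, 2); (0, 3); (1, 2); (1, 3); (2, 3)]%N g isT.
have h x y : (x, y) \in [:: (0, 1); (0, 2); (0, 3); (1, 2); (1, 3); (2, 3)]%N ->
    b i 4 + b j 4 - b i j <= b x 4 + b y 4 - b x y by move=> /pmin.
have h01 := h 0%N 1%N isT; have h02 := h 0%N 2%N isT; have h03 := h 0%N 3%N isT.
have h12 := h 1%N 2%N isT; have h13 := h 1%N 3%N isT; have h23 := h 2%N 3%N isT.
have c1 := bC 1%N 0%N; have c2 := bC 2 0; have c3 := bC 3 0; have c4 := bC 2 1.
have c5 := bC 3 1; have c6 := bC 3 2.
have C k l := @lifted_cherry b L i j k l bC star mt tie.
clear h pmin; move: pin; rewrite !inE => /or4P[/eqP[]|/eqP[]|/eqP[]|/or3P[]/eqP[]] ei ej; subst i j.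
- by apply: (C 2%N 3%N) => //; lra.
- by apply: (C 1%N 3%N) => //; lra.
- by apply: (C 1%N 2%N) => //; lra.
- by apply: (C 0%N 3%N) => //; lra.
- by apply: (C 0%N 2%N) => //; lra.
- by apply: (C 0%N 1%N) => //; lra.
Qed.

End LiftFlow.

(** * Removing infinite values *)

Definition mk5 (s : seq nat) : seq bool := mkseq (fun i => i \in s) 5.
Definition co5 (m : nat) : seq bool := mkseq (fun i => i != m) 5.

Fixpoint eqbits (X Y : seq bool) : bool :=
  match X, Y with
  | [::], [::] => true
  | b :: X', c :: Y' => (if b then c else ~~ c) && eqbits X' Y'
  | _, _ => false
  end.

Lemma eqbitsP X Y : eqbits X Y -> X = Y.
Proof. by elim: X Y => [|b X IH] [|c Y] //= /andP[bc /IH ->]; case: b c bc => [] []. Qed.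

Definition eqpair (p r : seq bool * seq bool) : bool :=
  (eqbits p.1 r.1 && eqbits p.2 r.2) || (eqbits p.1 r.2 && eqbits p.2 r.1).

Lemma eqpairP (V : Type) (h : seq bool -> seq bool -> V) p r :
  (forall X Y, h X Y = h Y X) -> eqpair p r -> h p.1 p.2 = h r.1 r.2.
Proof.
by move=> hC /orP[/andP[/eqbitsP -> /eqbitsP ->]|/andP[/eqbitsP -> /eqbitsP ->]].
Qed.

(* A tropical root operation: on the sets whose intersection with [{i, j}] is
   prescribed, the value may be replaced by that of the set translated by [{i, j}],
   increased by a constant. *)
Definition root : Type := (nat * nat) * (bool * bool).
Definition rmatch (r : root) (X : seq bool) : bool :=
  ~~ (nth false X r.1.1 (+) r.2.1) && ~~ (nth false X r.1.2 (+) r.2.2).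
Definition rmove (r : root) (X : seq bool) : seq bool := flip r.1.1 (flip r.1.2 X).

Definition roots5 : seq root :=
  flatten [seq [seq (ij, bc) | bc <- [:: (false, false); (false, true); (true, false); (true, true)]]
     | ij <- [:: (0, 1); (0, 2); (0, 3); (0, 4); (1, 2); (1, 3); (1, 4); (2, 3); (2, 4); (3, 4)]%N].

(** The pairs whose values, increased by the constant, enter the term with exchange index k after
    the root operation. *)
Definition shifted (r : root) (X Y : seq bool) (k : nat) : seq (seq bool * seq bool) :=
  let U := flip k X in let V := flip k Y in
  (if rmatch r U then [:: (rmove r U, V)] else [::]) ++
  (if rmatch r V then [:: (U, rmove r V)] else [::]).

Definition covers (r : root) (X Y : seq bool) (i : nat) (p : seq bool * seq bool) : bool :=
  has (fun k => ~~ eqn k i && has (eqpair p) (shifted r X Y k)) (diffs X Y).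

Definition transported (r : root) (X Y : seq bool) (i : nat) (p : seq bool * seq bool)
    (X' Y' : seq bool) : bool :=
  let d := diffs X' Y' in eqn (size d) 4 &&
  has (fun a => eqpair (flip a X', flip a Y') p &&
    all (fun c => eqn c a || covers r X Y i (flip c X', flip c Y')) d) d.

Definition root_check (r : root) (X Y : seq bool) : bool :=
  let d := diffs X Y in
  if eqn (size d) 4 then
    all (fun i => ~~ (rmatch r (flip i X) && rmatch r (flip i Y)) &&
      all (fun p => [|| covers r X Y i p, transported r X Y i p (rmove r X) Y
                      | transported r X Y i p X (rmove r Y)])
      (shifted r X Y i)) d
  else true.

Lemma root_check_all :
  all (fun r => all (fun X => all (root_check r X) (allbits 5)) (allbits 5)) roots5.
Proof. by vm_compute. Qed.

Definition even5 : seq (seq bool) := [seq X <- allbits 5 | ~~ odd (count id X)].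

Definition grow (r : root) (s : seq (seq bool)) : seq (seq bool) :=
  foldr (fun X t => if rmatch r X && ~~ has (eqbits X) t && has (eqbits (rmove r X)) s
                    then X :: t else t) s even5.

(** Two rounds through all root operations spread finiteness from one even set to all of them. *)
Lemma grow_all : all (fun X0 => let s := foldl (fun s r => grow r s) [:: X0] (roots5 ++ roots5) in
  all (fun X => has (eqbits X) s) even5) even5.
Proof. by vm_compute. Qed.

Section Fill.
Variable R : realType.
Implicit Types (f : seq bool -> option R) (N : R).

Definition tmin (x y : option R) : option R := if tle x y then x else y.

Lemma tmin_l x y : tle (tmin x y) x.
Proof.
rewrite /tmin; case: ifP => [_|h]; first exact: tle_refl.
by have := tle_total x y; rewrite h.
Qed.

Lemma tmin_r x y : tle (tmin x y) y.
Proof. by rewrite /tmin; case: ifP => // _; exact: tle_refl. Qed.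

Lemma tle_add x y x' y' : tle x x' -> tle y y' -> tle (tadd x y) (tadd x' y' : option R).
Proof. by case: x x' y y' => [x|] [x'|] [y|] [y'|] //=; apply: lerD. Qed.

Definition texch f (X Y : seq bool) : Prop := forall i, i \in diffs X Y ->
  tadd (f (flip i X)) (f (flip i Y)) <> None ->
  exists j, [/\ j \in diffs X Y, j != i &
    tle (tadd (f (flip j X)) (f (flip j Y))) (tadd (f (flip i X)) (f (flip i Y)))].

(** The four-term conditions on [5] are those that the lift of a finite vector uses and that
    [root_check] shows to be preserved. *)
Definition texch4 f : Prop := forall X Y, size X = 5%N -> size Y = 5%N ->
  size (diffs X Y) = 4%N -> texch f X Y.

Definition act (rN : root * R) f (X : seq bool) : option R :=
  if rmatch rN.1 X then tmin (f X) (tadd (f (rmove rN.1 X)) (Some rN.2)) else f X.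

Lemma act_le rN f X : tle (act rN f X) (f X).
Proof. by rewrite /act; case: ifP => _; [exact: tmin_l|exact: tle_refl]. Qed.

Lemma shifted_le r N f X Y k p : p \in shifted r X Y k ->
  tle (tadd (act (r, N) f (flip k X)) (act (r, N) f (flip k Y)))
      (tadd (tadd (f p.1) (f p.2)) (Some N)).
Proof.
have A Z : rmatch r Z -> tle (act (r, N) f Z) (tadd (f (rmove r Z)) (Some N)).
  by move=> h; rewrite /act h; apply: tmin_r.
rewrite mem_cat => /orP[]; case: ifP => // h; rewrite inE => /eqP -> /=.
  rewrite -taddA (taddC (f _) (Some N)) taddA; apply: tle_add (A _ h) (act_le _ _ _).
by rewrite -taddA; apply: tle_add (act_le _ _ _) (A _ h).
Qed.

Lemma coversP r N f X Y i p : covers r X Y i p -> exists j, [/\ j \in diffs X Y, j != i &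
  tle (tadd (act (r, N) f (flip j X)) (act (r, N) f (flip j Y)))
      (tadd (tadd (f p.1) (f p.2)) (Some N))].
Proof.
move=> /hasP[j jd /andP[ji /hasP[q qs e]]]; exists j; split=> //.
rewrite (@eqpairP _ (fun X Y => tadd (f X) (f Y)) p q) //; last by move=> *; apply: taddC.
exact: shifted_le.
Qed.

(** Where neither factor at index i has changed, the old exchange property applies, as values only
    decrease. Otherwise exactly one factor is a shifted value, and [root_check] provides the
    partner. *)
Lemma act_texch4 r N f : r \in roots5 -> texch4 f -> texch4 (act (r, N) f).
Proof.
move=> rr hf X Y sX sY sd i id fi.
have /allP/(_ r rr) := root_check_all; move=> /allbitsP/(_ X sX)/allbitsP/(_ Y sY).
rewrite /root_check sd /= => /allP/(_ i id)/andP[nboth /allP hs].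
have shift p : p \in shifted r X Y i -> tadd (f p.1) (f p.2) <> None ->
    exists j, [/\ j \in diffs X Y, j != i &
      tle (tadd (act (r, N) f (flip j X)) (act (r, N) f (flip j Y)))
          (tadd (tadd (f p.1) (f p.2)) (Some N))].
  move=> ps fp; have [/coversP //|h] := orP (hs p ps).
  have [X' [Y' [sX' sY' /andP[/eqP sd' /hasP[a ad /andP[e /allP cov]]]]]] : exists X' Y',
      [/\ size X' = 5%N, size Y' = 5%N & transported r X Y i p X' Y'].
    by case/orP: h => h; [exists (rmove r X), Y|exists X, (rmove r Y)]; rewrite !size_flip.
  have ep := @eqpairP _ (fun X Y => tadd (f X) (f Y)) _ p (fun _ _ => taddC _ _) e.
  have [|c [cd ca le]] := hf X' Y' sX' sY' sd' a ad; first by rewrite ep.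
  have /orP[/eqP ca'|/(coversP N f)[j [jd ji le']]] := cov c cd.
    by rewrite ca' eqxx in ca.
  exists j; split=> //; apply: tle_trans le' _; apply: tle_add (tle_refl _).
  by rewrite -ep.
have plain : act (r, N) f (flip i X) = f (flip i X) -> act (r, N) f (flip i Y) = f (flip i Y) ->
    exists j, [/\ j \in diffs X Y, j != i &
      tle (tadd (act (r, N) f (flip j X)) (act (r, N) f (flip j Y)))
          (tadd (act (r, N) f (flip i X)) (act (r, N) f (flip i Y)))].
  move=> e1 e2; rewrite e1 e2 in fi *.
  have [j [jd ji le]] := hf X Y sX sY sd i id fi; exists j; split=> //.
  by apply: tle_trans le; apply: tle_add; apply: act_le.
case mX : (rmatch r (flip i X)) nboth => /= nY.
  have eY : act (r, N) f (flip i Y) = f (flip i Y) by rewrite /act (negbTE nY).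
  have [eX|neX] := pselect (act (r, N) f (flip i X) = f (flip i X)); first exact: plain.
  have eX : act (r, N) f (flip i X) = tadd (f (rmove r (flip i X))) (Some N).
    by move: neX; rewrite /act /= mX /tmin; case: ifP.
  have [||j [jd ji le]] := shift (rmove r (flip i X), flip i Y).
  - by rewrite /shifted mX mem_head.
  - move: fi; rewrite eX eY /=; case: (f (rmove _ _)) => [x|] //=; by case: (f _).
  by exists j; split=> //; move: le; rewrite eX eY /= -!taddA (taddC (f (flip i Y))).
have eX : act (r, N) f (flip i X) = f (flip i X) by rewrite /act mX.
have [eY|neY] := pselect (act (r, N) f (flip i Y) = f (flip i Y)); first exact: plain.
have mY : rmatch r (flip i Y) by apply/negP => /negP h; apply: neY; rewrite /act (negbTE h).
have eY : act (r, N) f (flip i Y) = tadd (f (rmove r (flip i Y))) (Some N).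
  by move: neY; rewrite /act /= mY /tmin; case: ifP.
have [||j [jd ji le]] := shift (flip i X, rmove r (flip i Y)).
- by rewrite /shifted mX mY mem_head.
- by move: fi; rewrite eX eY /=; case: (f (flip i X)) => [x|] //=; case: (f _).
by exists j; split=> //; move: le; rewrite eX eY /= -!taddA.
Qed.

Definition finite_on f (s : seq (seq bool)) : Prop := forall X, has (eqbits X) s -> f X <> None.

Lemma grow_finite r N f s : finite_on f s -> finite_on (act (r, N) f) (grow r s).
Proof.
move=> hf.
have fin X : f X <> None -> act (r, N) f X <> None.
  by have := act_le (r, N) f X; case: (f X) => // x; case: act.
rewrite /grow; elim: even5 => [|Z e IH] X /=; first by move=> /hf/fin.
case: ifP => [/andP[/andP[m _] /hf h]|_]; last exact: IH.
move=> /orP[/eqbitsP ->|]; last exact: IH.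
by rewrite /act m; have := tmin_r (f Z) (tadd (f (rmove r Z)) (Some N)); move: h;
  case: (f (rmove r Z)) => // x _; case: tmin.
Qed.

Lemma fill f X0 B : texch4 f -> X0 \in even5 -> f X0 <> None ->
  exists g, [/\ texch4 g, forall X, X \in even5 -> g X <> None &
    forall X, X \in even5 -> if f X is Some r then g X = Some r
      else forall s, g X = Some s -> B <= s].
Proof.
move=> hf eX0 fX0.
pose vals := [seq odflt 0 (f X) | X <- allbits 5].
have [mu mu_le] : exists mu, forall X r, size X = 5%N -> f X = Some r -> mu <= r.
  have [m _ mmin] := @argminP R _ vals id isT.
  exists m => X r sX fX; have : odflt 0 (f X) \in vals by apply/mapP; exists X => //; rewrite -sX; apply: mem_allbits.
  by rewrite fX => /mmin.
have [M M_ge] : exists M, forall X r, size X = 5%N -> f X = Some r -> r <= M.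
  have [m _ mmax] := @argminP R _ vals -%R isT.
  exists m => X r sX fX; have : odflt 0 (f X) \in vals by apply/mapP; exists X => //; rewrite -sX; apply: mem_allbits.
  by rewrite fX => /mmax; rewrite /= lerN2.
(* With mu <= values <= M, adding [N] to a value gives at least M, so finite entries never change,
   at least B, so filled entries are large, and at least mu, so the bound persists. *)
pose N := Num.max (M - mu) (Num.max (B - mu) 0).
have [N1 [N2 N3]] : M - mu <= N /\ B - mu <= N /\ 0 <= N by rewrite /N !le_max !lexx !orbT.
pose good g := [/\ texch4 g, forall X r, size X = 5%N -> g X = Some r -> mu <= r &
  forall X, size X = 5%N -> if f X is Some r then g X = Some r
      else forall s, g X = Some s -> B <= s].
have step (rs : seq root) g s : {subset rs <= roots5} -> good g -> finite_on g s ->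
    exists g', good g' /\ finite_on g' (foldl (fun s r => grow r s) s rs).
  elim: rs g s => [|r rs IH] g s sub gg fg; first by exists g.
  apply: (IH (act (r, N) g)) => [x xr||]; first by apply: sub; rewrite inE xr orbT.
    have rr : r \in roots5 by apply: sub; rewrite inE eqxx.
    case: gg => g1 g2 g3; split; first exact: act_texch4.
    - move=> X x sX; rewrite /act; case: ifP => _; last exact: g2.
      rewrite /tmin; case: ifP => _; first exact: g2.
      case E : (g (rmove r X)) => [y|] //= -[<-]; have := g2 _ _ _ E.
      by rewrite !size_flip => /(_ sX); lra.
    - move=> X sX; have := g3 X sX; have h (y : R) : g (rmove r X) = Some y -> mu <= y.
        by apply: g2; rewrite !size_flip.
      rewrite /act /=; case fX : (f X) => [x|] gX; last first.
        case: ifP => _ //; rewrite /tmin; case: ifP => _ //; move=> s0.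
        by case E : (g (rmove r X)) => [y|] //= -[<-]; have := h _ E; lra.
      case: ifP => _ //; rewrite gX /tmin; case E : (g (rmove r X)) => [y|] //=.
      have -> // : x <= y + N by have := h _ E; have := M_ge _ _ sX fX; lra.
  exact: grow_finite.
have sub : {subset roots5 ++ roots5 <= roots5} by move=> x; rewrite mem_cat => /orP[].
have size_even X : X \in even5 -> size X = 5%N.
  move=> /(allP (_ : all (fun X => eqn (size X) 5) even5)) h; exact/eqP/h.
have [||g [[g1 _ g3] gfin]] := step (roots5 ++ roots5) f [:: X0] sub.
- split=> // X sX; by case: (f X).
- by move=> X; rewrite /= orbF => /eqbitsP ->.
exists g; split=> // [X eX|X /size_even]; last exact: g3.
by apply: gfin; have /allP/(_ _ eX0)/allP/(_ _ eX) := grow_all.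
Qed.

End Fill.

(** * From circulations to spinors *)

Definition rel_terms (X Y : seq bool) : seq (bool * (seq bool * seq bool)) :=
  let d := diffs X Y in
  [seq (odd (count (fun j => j < i)%N d), (flip i X, flip i Y)) | i <- d].

(** The first five relations become the row sums of a circulation, the last five express its
    Pfaffians on four vertices. *)
Definition base_rels : seq (seq (bool * (seq bool * seq bool))) :=
  [seq rel_terms (mk5 [:: k]) (mk5 (iota 0 5)) | k <- iota 0 5] ++
  [seq let s := [seq i <- iota 0 5 | ~~ eqn i m] in rel_terms (mk5 [:: head 0%N s]) (mk5 (behead s))
     | m <- iota 0 5].

Definition canon_rel (c : bool) (l : seq (bool * (seq bool * seq bool))) :=
  [seq (c (+) t.1, if (code t.2.1 <= code t.2.2)%N then t.2 else (t.2.2, t.2.1)) | t <- l].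

(** A relation vanishes because each product contains an odd set, because its two terms cancel, or
    because it is a base relation up to sign. *)
Definition rel_check (X Y : seq bool) : bool :=
  let l := rel_terms X Y in
  [|| all (fun t => odd (count id t.2.1) || odd (count id t.2.2)) l,
      (if l is [:: (s, (P, Q)); (s', (P', Q'))] then [&& s (+) s', eqbits P Q' & eqbits Q P'] else false)
    | has (fun l0 => perm_eq (canon_rel false l) (canon_rel false l0) ||
                     perm_eq (canon_rel true l) (canon_rel false l0)) base_rels].

Lemma rel_check_all : all (fun X => all (rel_check X) (allbits 5)) (allbits 5).
Proof. by vm_compute. Qed.

Section BitsWick.
Variable R : realType.
Implicit Types W : seq bool -> nov R.

Definition wsum W (l : seq (bool * (seq bool * seq bool))) : nov R :=
  \sum_(t <- l) (-1) ^+ t.1 * (W t.2.1 * W t.2.2).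

Definition bwick W : Prop := forall X Y, size X = 5%N -> size Y = 5%N -> wsum W (rel_terms X Y) = 0.

Lemma wsum_canon W c l : wsum W (canon_rel c l) = (-1) ^+ c * wsum W l.
Proof.
rewrite /wsum big_map mulr_sumr; apply: eq_bigr => -[s [P Q]] _ /=.
by rewrite signr_addb -mulrA; case: ifP => //= _; rewrite (mulrC (W Q)).
Qed.

Lemma bwick_of_base W :
  (forall X, size X = 5%N -> odd (count id X) -> W X = 0) ->
  (forall l, l \in base_rels -> wsum W l = 0) -> bwick W.
Proof.
move=> Wodd Wbase X Y sX sY.
have /or3P[/allP h|h|/hasP[l0 l0b h]] := allbitsP (allbitsP rel_check_all sX) sY.
- rewrite /wsum big_seq big1 // => t tl.
  have [st1 st2] : size t.2.1 = 5%N /\ size t.2.2 = 5%N.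
    by case/mapP: tl => i _ ->; rewrite !size_flip.
  by case/orP: (h t tl) => o; rewrite (Wodd _ _ o) // ?mul0r ?mulr0 ?mulr0.
- case: (rel_terms X Y) h => [|[s [P Q]] [|[s' [P' Q']] [|]]] // /and3P[ss /eqbitsP -> /eqbitsP ->].
  rewrite /wsum !big_cons big_nil /= (mulrC (W Q')); move: ss; case: s; case: s' => //= _; ring.
- have E c : perm_eq (canon_rel c (rel_terms X Y)) (canon_rel false l0) -> wsum W (rel_terms X Y) = 0.
    move=> P; have : wsum W (canon_rel c (rel_terms X Y)) = wsum W (canon_rel false l0).
      exact: perm_big.
    rewrite !wsum_canon (Wbase _ l0b) mulr0 => /(congr1 (fun z : nov R => (-1) ^+ c * z)).
    by rewrite mulr0 mulrA -signr_addb addbb mul1r.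
  by case/orP: h => /E.
Qed.

Section FromFlow.
Variables (a : nat -> nat -> nov R) (q : nat -> R).
Hypothesis fa : flow a.

(* In the third branch [10 - (i + j + k + l)] is the missing element of [{0, ..., 4}]. *)
Definition W_of_flow (X : seq bool) : nov R :=
  match [seq i <- iota 0 (size X) | nth false X i] with
  | [::] => pf a 0 1 2 3 * nmono 1 (- (q 0 + q 1 + q 2 + q 3 + q 4))
  | [:: i; j] => a i j * nmono 1 (- (q i + q j))
  | [:: i; j; k; l] => (-1) ^+ (10 - (i + j + k + l))%N * nmono 1 (q (10 - (i + j + k + l))%N)
  | _ => 0
  end.

Lemma W_odd X : odd (count id X) -> W_of_flow X = 0.
Proof.
have -> : count id X = size [seq i <- iota 0 (size X) | nth false X i].
  by rewrite size_filter -{1}[X](mkseq_nth false) /mkseq count_map.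
by rewrite /W_of_flow; case: filter => [|? [|? [|? [|? [|? ?]]]]].
Qed.

Lemma nmonoD c d : nmono (1 : R[i]) (c + d) = nmono 1 c * nmono 1 d.
Proof. by rewrite nmonoM mulr1. Qed.

Lemma flow_diag i : a i i = 0.
Proof.
have [anti _] := fa.
have /eqP := anti i i; rewrite -addr_eq0 => /eqP h.
have [h2|//] : (2%:R : nov R) = 0 \/ a i i = 0.
  by apply: nov_mulf_eq0; rewrite mulr_natl mulr2n.
have := congr1 (fun f : nov R => f 0) h2; rewrite nov0E mulr2n novDE.
have -> : (1 : nov R) 0 = 1 by rewrite -[1 in LHS]/(nmono 1 0) nmonoE eqxx.
by move/eqP; rewrite -mulr2n pnatr_eq0.
Qed.

Lemma pf_opp i j k l : [/\ pf a j i k l = - pf a i j k l, pf a i k j l = - pf a i j k l &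
  pf a i j l k = - pf a i j k l].
Proof.
have [anti _] := fa; rewrite /pf (anti j i) (anti k j) (anti l k); split; ring.
Qed.

(** The sum of the two Pfaffians is a combination of the row sums of i, j and k. *)
Lemma pf_exchange i j k l m : dist5 [:: i; j; k; l; m] -> pf a i j k m = - pf a i j k l.
Proof.
move=> d; have [anti rows] := fa.
have P : perm_eq [:: i; j; k; l; m] (iota 0 5).
  have /andP[u _] := d; apply: uniq_perm => //= x; apply/idP/idP => [xs|].
    by have /andP[_ /allP/(_ x xs)] := d; rewrite -[[:: 0; 1; 2; 3; 4]%N]/(iota 0 5) mem_iota.
  by rewrite -[[:: 0; 1; 2; 3; 4]%N]/(iota 0 5) mem_iota => x5; apply: dist5_full.
have S x : (x < 5)%N -> a x i + a x j + a x k + a x l + a x m = 0.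
  move=> x5; rewrite -[RHS](rows x x5) -[RHS](perm_big _ P) !big_cons big_nil /=; ring.
have [i5 [j5 k5]] : (i < 5)%N /\ (j < 5)%N /\ (k < 5)%N by move: d; d5.
apply/eqP; rewrite -addr_eq0; apply/eqP.
have -> : pf a i j k m + pf a i j k l =
  a i j * (a k i + a k j + a k k + a k l + a k m) - a i k * (a j i + a j j + a j k + a j l + a j m)
  + a j k * (a i i + a i j + a i k + a i l + a i m) - (a i j * a k k - a i k * a j j + a j k * a i i).
  by rewrite /pf (anti j i) (anti k i) (anti k j); ring.
by rewrite !S // !flow_diag; ring.
Qed.

(** Transpositions and [pf_exchange] change a Pfaffian only by a sign; with them the indices 0, 1,
    2, 3 are brought into place one after another. *)
Lemma hasval_pf L i j k l : dist5 [:: i; j; k; l] -> hasval (pf a i j k l) L ->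
  hasval (pf a 0 1 2 3) L.
Proof.
pose H i j k l := dist5 [:: i; j; k; l] /\ hasval (pf a i j k l) L.
have s1 x y z t : H x y z t -> H y x z t.
  by move=> [d h]; split; [move: d; d5|have [-> _ _] := pf_opp x y z t; apply: hasvalN].
have s2 x y z t : H x y z t -> H x z y t.
  by move=> [d h]; split; [move: d; d5|have [_ -> _] := pf_opp x y z t; apply: hasvalN].
have s3 x y z t : H x y z t -> H x y t z.
  by move=> [d h]; split; [move: d; d5|have [_ _ ->] := pf_opp x y z t; apply: hasvalN].
have r4 x y z t u : dist5 [:: x; y; z; u] -> H x y z t -> H x y z u.
  move=> du [dt h]; have [<-//|ut] := eqVneq t u; split=> //.
  rewrite (pf_exchange (l := t)); first exact: hasvalN.
  by move: du dt ut; d5.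
move=> d h; have [j' [k' [l' H0]]] : exists y z t, H 0%N y z t.
  have h0 : H i j k l by [].
  have [ej|nj] := eqVneq j 0%N; first by exists i, k, l; apply: s1; rewrite -ej.
  have [ek|nk] := eqVneq k 0%N; first by exists i, j, l; apply/s1/s2; rewrite -ek.
  have [el|nl] := eqVneq l 0%N; first by exists i, j, k; apply/s1/s2/s3; rewrite -el.
  exists j, k, l; apply/s1/s2/s3/(r4 _ _ _ i); last by apply/s3/s2/s1.
  by move: d nj nk nl; d5.
have [k2 [l2 H1]] : exists z t, H 0%N 1%N z t.
  have [ek|nk] := eqVneq k' 1%N; first by exists j', l'; apply: s2; rewrite -ek.
  have [el|nl] := eqVneq l' 1%N; first by exists j', k'; apply/s2/s3; rewrite -el.
  exists k', l'; apply/s2/s3/(r4 _ _ _ j'); last by apply/s3/s2.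
  by case: H0 => d0 _; move: d0 nk nl; d5.
have [l3 H2] : exists t, H 0%N 1%N 2%N t.
  have [el|nl] := eqVneq l2 2%N; first by exists k2; apply: s3; rewrite -el.
  exists l2; apply/s3/(r4 _ _ _ k2); last exact: s3.
  by case: H1 => d0 _; move: d0 nl; d5.
by have [] := r4 0%N 1%N 2%N l3 3%N isT H2.
Qed.

(** Eliminates row 0 in favour of the entries among 1, 2, 3, 4, which makes the base relations ring
    identities. *)
Lemma flow_rows :
  [/\ a 0 1 = - (a 0 2 + a 0 3 + a 0 4), a 0 2 = a 2 3 + a 2 4 - a 1 2,
      a 0 3 = a 3 4 - a 1 3 - a 2 3, a 0 4 = - (a 1 4 + a 2 4 + a 3 4) &
      a 0 1 = a 1 2 + a 1 3 + a 1 4].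
Proof.
case: fa => anti rows.
have diag := flow_diag.
have S (i : nat) : (i < 5)%N -> a i 0 + a i 1 + a i 2 + a i 3 + a i 4 = 0.
  by move=> /rows; rewrite /= !big_cons big_nil => <-; ring.
have r0 := S 0 isT; have r1 := S 1 isT; have r2 := S 2 isT; have r3 := S 3 isT; have r4 := S 4 isT.
have z (x y : nov R) : x - y = 0 -> x = y by move/eqP; rewrite subr_eq0 => /eqP.
rewrite !diag (anti 1 0) (anti 2 0) (anti 2 1) (anti 3 0) (anti 3 1) (anti 3 2) (anti 4 0) (anti 4 1)
  (anti 4 2) (anti 4 3) in r0 r1 r2 r3 r4.
split; apply: z.
- by rewrite -r0; ring.
- by rewrite -[RHS]oppr0 -r2; ring.
- by rewrite -[RHS]oppr0 -r3; ring.
- by rewrite -[RHS]oppr0 -r4; ring.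
- by rewrite -[RHS]oppr0 -r1; ring.
Qed.

(** The powers of t are a torus action: up to it, complements of points have coordinates 1 or -1,
    pairs carry the circulation, and the empty set its Pfaffian. After the ten base relations are
    expanded, [u] cancels these powers. *)
Lemma bwick_flow : bwick W_of_flow.
Proof.
apply: bwick_of_base => [X _|l]; first exact: W_odd.
have u i : nmono (1 : R[i]) (- q i) * nmono 1 (q i) = 1 by rewrite -nmonoD addNr.
have [r0 r2 r3 r4 r1] := flow_rows; case: fa => anti _.
have c0 : (10 - (1 + 2 + 3 + 4) = 0)%N by [].
have c1 : (10 - (0 + 2 + 3 + 4) = 1)%N by [].
have c2 : (10 - (0 + 1 + 3 + 4) = 2)%N by [].
have c3 : (10 - (0 + 1 + 2 + 4) = 3)%N by [].
have c4 : (10 - (0 + 1 + 2 + 3) = 4)%N by [].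
have C := (c0, c1, c2, c3, c4).
have := u 4; have := u 3; have := u 2; have := u 1; have := u 0.
rewrite mem_cat => u0 u1 u2 u3 u4 /orP[] /mapP[m].
  rewrite !inE => /or4P[/eqP ->|/eqP ->|/eqP ->|/orP[]/eqP ->] ->;
  rewrite /rel_terms /wsum /= !big_cons big_nil /W_of_flow /= ?opprD !nmonoD !C;
  move: u0 u1 u2 u3 u4; move: (nmono 1 (- q 0)) (nmono 1 (- q 1)) (nmono 1 (- q 2)) (nmono 1 (- q 3)) (nmono 1 (- q 4));
  move: (nmono 1 (q 0)) (nmono 1 (q 1)) (nmono 1 (q 2)) (nmono 1 (q 3)) (nmono 1 (q 4)) =>
    T0 T1 T2 T3 T4 U0 U1 U2 U3 U4 u0 u1 u2 u3 u4; rewrite ?r1 ?r2 ?r3 ?r4; ring: u0 u1 u2 u3 u4.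
rewrite !inE => /or4P[/eqP ->|/eqP ->|/eqP ->|/orP[]/eqP ->] ->;
  rewrite /rel_terms /wsum /= !big_cons big_nil /W_of_flow /= ?opprD !nmonoD !C /pf;
  move: u0 u1 u2 u3 u4; move: (nmono 1 (- q 0)) (nmono 1 (- q 1)) (nmono 1 (- q 2)) (nmono 1 (- q 3)) (nmono 1 (- q 4));
  move: (nmono 1 (q 0)) (nmono 1 (q 1)) (nmono 1 (q 2)) (nmono 1 (q 3)) (nmono 1 (q 4)) =>
    T0 T1 T2 T3 T4 U0 U1 U2 U3 U4 u0 u1 u2 u3 u4; rewrite ?r1 ?r2 ?r3 ?r4; ring: u0 u1 u2 u3 u4.
Qed.

End FromFlow.
End BitsWick.

(** * Lifting finite vectors *)

Definition even_bits (X : seq bool) : bool := eqn (size X) 5 && ~~ odd (count id X).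

Lemma mem_even5 X : (X \in even5) = even_bits X.
Proof.
rewrite mem_filter /even_bits andbC; congr (_ && _); apply/idP/eqP => [|<-]; last exact: mem_allbits.
move=> /(allP (_ : all (fun X => eqn (size X) 5) (allbits 5))) h; exact/eqP/h.
Qed.

Definition star_check (i j : nat) : bool :=
  let X := mk5 [:: i] in let Y := mk5 (iota 0 5) in
  dist5 [:: i; j] ==> [&& eqn (size (diffs X Y)) 4, j \in diffs X Y,
    even_bits (mk5 [:: i; j]), even_bits (co5 j) &
    all (fun k => [&& dist5 [:: i; k], eqbits (flip k X) (mk5 [:: i; k]) & eqbits (flip k Y) (co5 k)])
      (diffs X Y)].

Definition match_check (i j k l : nat) : bool :=
  let X := mk5 [:: i] in let Y := mk5 [:: j; k; l] in let d := diffs X Y in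
  dist5 [:: i; j; k; l] ==> [&& eqn (size d) 4,
    perm_eq d [:: i; j; k; l],
    eqbits (flip i X) (mk5 [::]) && eqbits (flip i Y) (mk5 [:: i; j; k; l]),
    eqbits (flip j X) (mk5 [:: i; j]) && eqbits (flip j Y) (mk5 [:: k; l]),
    eqbits (flip k X) (mk5 [:: i; k]) && eqbits (flip k Y) (mk5 [:: j; l]),
    eqbits (flip l X) (mk5 [:: i; l]) && eqbits (flip l Y) (mk5 [:: j; k]),
    [&& even_bits (mk5 [::]), even_bits (mk5 [:: i; j; k; l]), even_bits (mk5 [:: i; j]) &
        even_bits (mk5 [:: k; l])] &
    has (fun m => eqbits (mk5 [:: i; j; k; l]) (co5 m) && perm_eq [:: i; j; k; l; m] (iota 0 5))
      (iota 0 5)].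

Lemma star_check_all : all (fun i => all (star_check i) (iota 0 5)) (iota 0 5).
Proof. by vm_compute. Qed.

Lemma match_check_all : all (fun i => all (fun j => all (fun k => all (match_check i j k)
  (iota 0 5)) (iota 0 5)) (iota 0 5)) (iota 0 5).
Proof. by vm_compute. Qed.

Section FiniteLift.
Variables (R : realType) (g : seq bool -> option R).
Hypotheses (g_exch : texch4 g) (g_fin : forall X, X \in even5 -> g X <> None).

Let v X : R := odflt 0 (g X).

Lemma v_exch X Y i : size X = 5%N -> size Y = 5%N -> eqn (size (diffs X Y)) 4 -> i \in diffs X Y ->
  even_bits (flip i X) -> even_bits (flip i Y) ->
  exists j, [/\ j \in diffs X Y, j != i & v (flip j X) + v (flip j Y) <= v (flip i X) + v (flip i Y)].
Proof.
move=> sX sY /eqP sd id; rewrite -!mem_even5 => /g_fin fX /g_fin fY.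
have [|j [jd ji le]] := g_exch sX sY sd id; first by move: fX fY; do 2!case: (g _).
exists j; split=> //; move: le fX fY; rewrite /v.
by do 4![case: (g _) => [?|] //=].
Qed.

(** The tropical torus rescaling that brings the complements of points to value 0; [b] and [L] are
    the rescaled values on pairs and on the empty set. *)
Let q m : R := v (co5 m).
Let b i j : R := v (mk5 [:: i; j]) + q i + q j.
Let L : R := v (mk5 [::]) + (q 0 + q 1 + q 2 + q 3 + q 4).

Lemma mk5_eq s t : s =i t -> mk5 s = mk5 t.
Proof. by move=> h; apply: eq_mkseq => i; rewrite h. Qed.

Lemma finite_bC i j : b i j = b j i.
Proof.
rewrite /b (@mk5_eq [:: i; j] [:: j; i]) => [|x]; last by rewrite !inE orbC.
by rewrite -!addrA (addrC (q i)).
Qed.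

(** The exchange property for {i} and the full set: its terms pair {i, k} with the complement of
    k. *)
Lemma finite_star : star_cond b.
Proof.
move=> i j dij; have [i5 j5] : (i \in iota 0 5) /\ (j \in iota 0 5).
  by rewrite !mem_iota; move: dij; d5.
have /implyP/(_ dij)/and5P[sd jd e1 e2 /allP h] := allP (allP star_check_all i i5) j j5.
have [] := v_exch _ _ sd jd; rewrite ?size_mkseq //.
- by have /and3P[_ /eqbitsP -> _] := h j jd.
- by have /and3P[_ _ /eqbitsP ->] := h j jd.
move=> k [kd kj]; have /and3P[_ /eqbitsP -> /eqbitsP ->] := h j jd.
have /and3P[dik /eqbitsP -> /eqbitsP ->] := h k kd => le.
exists k; split; first by move: dij dik kj; d5.
by rewrite /b /q; lra.
Qed.

(** The exchange property for {i} and {j, k, l}: one term pairs the empty set with {i, j, k, l}, the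
    others are the three matchings. *)
Lemma finite_match : match_cond b L.
Proof.
move=> i j k l d.
have [i5 [j5 [k5 l5]]] : (i \in iota 0 5) /\ (j \in iota 0 5) /\ (k \in iota 0 5) /\ (l \in iota 0 5).
  by rewrite !mem_iota; move: d; d5.
have /implyP/(_ d) := allP (allP (allP (allP match_check_all i i5) j j5) k k5) l l5.
move=> /and5P[sd pd /andP[/eqbitsP iX /eqbitsP iY] /andP[/eqbitsP jX /eqbitsP jY]].
move=> /and4P[/andP[/eqbitsP kX /eqbitsP kY] /andP[/eqbitsP lX /eqbitsP lY]].
move=> /and4P[e0 e4 eij ekl] /hasP[m _ /andP[/eqbitsP com pm]].
have LE : L = v (mk5 [::]) + v (mk5 [:: i; j; k; l]) + q i + q j + q k + q l.
  have S : q 0 + q 1 + q 2 + q 3 + q 4 = q i + q j + q k + q l + q m.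
    have : \sum_(x <- [:: i; j; k; l; m]) q x = \sum_(x <- iota 0 5) q x by apply: perm_big.
    by rewrite /= !big_cons !big_nil; lra.
  by rewrite /L S com /q; lra.
have sX s : size (mk5 s) = 5%N by rewrite size_mkseq.
have [|||x [xd xi lei]] := v_exch (sX [:: i]) (sX [:: j; k; l]) sd (i := i).
- by rewrite (perm_mem pd) mem_head.
- by rewrite iX.
- by rewrite iY.
have [|||y [yd yj lej]] := v_exch (sX [:: i]) (sX [:: j; k; l]) sd (i := j).
- by rewrite (perm_mem pd) !inE eqxx orbT.
- by rewrite jX.
- by rewrite jY.
rewrite (perm_mem pd) !inE in xd; rewrite (perm_mem pd) !inE in yd; rewrite iX iY in lei; rewrite jX jY in lej.
rewrite LE /b; split.
  case/or4P: xd xi lei => /eqP ->; rewrite ?eqxx // ?jX ?jY ?kX ?kY ?lX ?lY => _ le.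
  - by apply: Or31; lra.
  - by apply: Or32; lra.
  - by apply: Or33; lra.
case/or4P: yd yj lej => /eqP ->; rewrite ?eqxx // ?iX ?iY ?kX ?kY ?lX ?lY => _ le.
- by apply: Or31; lra.
- by apply: Or32; lra.
- by apply: Or33; lra.
Qed.


Lemma finite_lift : exists W : seq bool -> nov R, [/\ bwick W,
  forall X, odd (count id X) -> W X = 0 &
  forall X r, X \in even5 -> g X = Some r -> hasval (W X) r].
Proof.
have [a [fa ha [i [j [k [l [d hp]]]]]]] := lift_flow finite_bC finite_star finite_match.
have {d}hp := hasval_pf fa d hp.
exists (W_of_flow a q); split; [exact: bwick_flow|exact: W_odd|].
have E X : X \in even5 -> hasval (W_of_flow a q X) (v X).
  have M (f : nov R) x c y : hasval f x -> x + c = y -> hasval (f * nmono 1 c) y.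
    by move=> h <-; apply: hasvalM h (hasval_mono _ (oner_neq0 _)).
  have S (m : nat) : hasval ((-1) ^+ m * nmono 1 (q m)) (v (co5 m)).
    rewrite -signr_odd; case: odd; rewrite ?mul1r ?mulN1r; [apply: hasvalN|];
      exact: hasval_mono (oner_neq0 _).
  have b0 : L - (q 0 + q 1 + q 2 + q 3 + q 4) = v (mk5 [::]) by rewrite /L addrK.
  have pair x y : dist5 [:: x; y] -> hasval (a x y * nmono 1 (- (q x + q y))) (v (mk5 [:: x; y])).
    by move=> dxy; apply: M (ha _ _ dxy) _; rewrite /b; lra.
  (* The list follows the order in which [allbits] enumerates the even sets. *)
  have : even5 = [:: mk5 [::]] ++ [seq mk5 [:: p.1; p.2] | p <- [:: (3, 4); (2, 4); (2, 3); (1, 4); (1, 3); (1, 2)]]%N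
    ++ [:: co5 0] ++ [seq mk5 [:: p.1; p.2] | p <- [:: (0, 4); (0, 3); (0, 2)]]%N ++ [:: co5 1]
    ++ [:: mk5 [:: 0; 1]%N; co5 2; co5 3; co5 4] by [].
  move=> ->; rewrite !mem_cat !inE /=.
  do ?[case/orP]; move/eqP=> ->;
    [exact: (M _ _ _ _ hp b0)|exact: (pair 3%N 4%N isT)|exact: (pair 2%N 4%N isT)|exact: (pair 2%N 3%N isT)|exact: (pair 1%N 4%N isT)|exact: (pair 1%N 3%N isT)|exact: (pair 1%N 2%N isT)|exact: (S 0%N)|exact: (pair 0%N 4%N isT)|exact: (pair 0%N 3%N isT)|exact: (pair 0%N 2%N isT)|exact: (S 1%N)|exact: (pair 0%N 1%N isT)|exact: (S 2%N)|exact: (S 3%N)|exact: (S 4%N)].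
by move=> X r eX gX; have := E X eX; rewrite /v gX.
Qed.

End FiniteLift.

(** * Ground sets with at most five elements *)

(** Translation by {0}, which exchanges the two parities. *)
Definition twist (e : bool) (X : seq bool) : seq bool := if e then flip 0 X else X.

Lemma size_twist e X : size (twist e X) = size X.
Proof. by case: e => //; apply: size_flip. Qed.

Lemma odd_flip i X : (i < size X)%N -> odd (count id (flip i X)) = ~~ odd (count id X).
Proof.
elim: X i => [|b X IH] [|i] //= iX; first by rewrite !oddD; case: b; rewrite ?negbK.
by rewrite !oddD IH //; case: b.
Qed.

Lemma flipC i j X : flip i (flip j X) = flip j (flip i X).
Proof.
apply: (@eq_from_nth _ false) => [|k]; rewrite !size_flip // => kX.
by rewrite !nth_flip ?size_flip // addbAC.
Qed.

Lemma flipK i X : flip i (flip i X) = X.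
Proof.
apply: (@eq_from_nth _ false) => [|k]; rewrite !size_flip // => kX.
by rewrite !nth_flip ?size_flip // addbK.
Qed.

Lemma flip_twist e i X : flip i (twist e X) = twist e (flip i X).
Proof. by case: e => //; apply: flipC. Qed.

Lemma twistK e X : twist e (twist e X) = X.
Proof. by case: e => //; apply: flipK. Qed.

Lemma mem_diffs_bits X Y i :
  (i \in diffs X Y) = (i < size X)%N && (nth false X i (+) nth false Y i).
Proof. by rewrite mem_filter mem_iota add0n andbC. Qed.

Lemma diffs_flip2 i X Y : size X = size Y -> diffs (flip i X) (flip i Y) = diffs X Y.
Proof.
move=> sXY; rewrite /diffs size_flip; apply: eq_in_filter => k.
rewrite mem_iota add0n /= => kX; rewrite !nth_flip -?sXY //.
by rewrite addbACA addbb addbF.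
Qed.

Lemma diffs_twist e X Y : size X = size Y -> diffs (twist e X) (twist e Y) = diffs X Y.
Proof. by case: e => //; apply: diffs_flip2. Qed.

Lemma size_diffs_flip i X Y : i \in diffs X Y -> size (diffs X Y) = (size (diffs (flip i X) Y)).+1.
Proof.
move=> id; rewrite -[RHS]/(size (i :: diffs (flip i X) Y)); apply/perm_size/uniq_perm.
- by rewrite filter_uniq ?iota_uniq.
- rewrite /= filter_uniq ?iota_uniq // andbT mem_diffs_bits size_flip.
  move: id; rewrite mem_diffs_bits => /andP[iX d]; rewrite nth_flip // eqxx addbT.
  by move: d; case: nth; case: nth; rewrite ?andbF.
move=> k; rewrite inE !mem_diffs_bits size_flip; case: (ltnP k (size X)) => kX /=; last first.
  rewrite orbF; apply/esym/negP => /eqP ki; move: id.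
  by rewrite -ki mem_diffs_bits ltnNge kX.
rewrite nth_flip //; case: (eqVneq k i) => [->|_]; last by rewrite addbF.
by move: id; rewrite mem_diffs_bits => /andP[_ ->].
Qed.

Section Parity.
Variables (R : realType) (f : seq bool -> option R).
Hypothesis f_exch : forall X Y, size X = 5%N -> size Y = 5%N -> texch f X Y.

(** Exchange at [flip i X], [flip i Y], starting from the finite term f X + f Y, yields a finite set
    two steps closer to Y; induction on the distance concludes. *)
Lemma even_diffs X Y : size X = 5%N -> size Y = 5%N -> f X <> None -> f Y <> None ->
  ~~ odd (size (diffs X Y)).
Proof.
have [m] := ubnP (size (diffs X Y)); elim: m X => // m IH X; rewrite ltnS => dm sX sY fX fY.
case E : (diffs X Y) => [|i d] //; rewrite -E.
have id : i \in diffs X Y by rewrite E mem_head.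
have sXY : size X = size Y by rewrite sX sY.
have [||||j [jd ji le]] := f_exch (X := flip i X) (Y := flip i Y) _ _ (i := i).
- by rewrite size_flip.
- by rewrite size_flip.
- by rewrite diffs_flip2.
- by rewrite !flipK; move: fX fY; case: (f X) => // x _; case: (f Y).
rewrite diffs_flip2 // in jd; move: le; rewrite !flipK => le.
have jd' : j \in diffs (flip i X) Y.
  by move: jd; rewrite !mem_diffs_bits size_flip => /andP[jX ?]; rewrite jX nth_flip // (negbTE ji) addbF.
rewrite (size_diffs_flip id) (size_diffs_flip jd') /= negbK.
apply: IH => //; rewrite ?size_flip //.
- by move: dm; rewrite (size_diffs_flip id) (size_diffs_flip jd'); apply: leq_trans; rewrite ltnS.
- by move: fX fY le; do 4!case: (f _).
Qed.

End Parity.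

Lemma odd_diffs_all : all (fun X => all (fun Y =>
  eqb (odd (size (diffs X Y))) (odd (count id X) (+) odd (count id Y))) (allbits 5)) (allbits 5).
Proof. by vm_compute. Qed.

Section SmallGroundSet.
Variables (R : realType) (n : nat).
Hypothesis n5 : (n <= 5)%N.
Local Notation sets := {set 'I_n}.

Lemma sset_bits (S : sets) : sset n (bits 5 S) = S.
Proof. by apply/setP => k; rewrite inE nth_bits // (leq_trans (ltn_ord k) n5). Qed.

(** The extension of p to subsets of [5]: sets with an element outside [n] receive infinity. *)
Definition bits_vec (p : sets -> option R) (X : seq bool) : option R :=
  if bits 5 (sset n X) == X then p (sset n X) else None.

Lemma bits_vecE p S : bits_vec p (bits 5 S) = p S.
Proof. by rewrite /bits_vec sset_bits eqxx. Qed.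

Lemma bits_vec_fin p X : bits_vec p X <> None -> exists S : sets, X = bits 5 S.
Proof. by rewrite /bits_vec; case: eqP => // e _; exists (sset n X). Qed.

Lemma bits_vec_exch p X Y : DDr p -> size X = 5%N -> size Y = 5%N -> texch (bits_vec p) X Y.
Proof.
move=> hp sX sY i id fi.
have [fX fY] : bits_vec p (flip i X) <> None /\ bits_vec p (flip i Y) <> None.
  by move: fi; do 2!case: (bits_vec p _).
have [U eU] := bits_vec_fin fX; have [V eV] := bits_vec_fin fY.
have [iX d] : (i < size X)%N /\ (nth false X i (+) nth false Y i).
  by move: id; rewrite mem_diffs_bits => /andP[].
(* One of the two finite sets contains i, so i is an element of [n]. *)
have [k ki] : exists k : 'I_n, val k = i.
  have : nth false (flip i X) i || nth false (flip i Y) i.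
    by rewrite !nth_flip ?sY -?sX // eqxx !addbT; move: d; do 2!case: nth.
  by rewrite eU eV => /orP[] /nth_bits_true[k [ki _ _]]; exists k.
have EX : X = bits 5 (symd U [set k]) by rewrite bits_symd1 -eU ki flipK.
have EY : Y = bits 5 (symd V [set k]) by rewrite bits_symd1 -eV ki flipK.
move: id fi; rewrite {}EX {}EY; set S := symd U _; set T := symd V _ => id fi.
have E (j : 'I_n) : bits_vec p (flip j (bits 5 S)) = p (symd S [set j]) /\
    bits_vec p (flip j (bits 5 T)) = p (symd T [set j]).
  by rewrite -!bits_symd1 !bits_vecE.
have kST : k \in symd S T by have [k' [/esym e _ kST]] := iffLR (mem_diffs _ _ _ _) id;
  rewrite -ki in e; rewrite (val_inj e).
have /min_twiceP := hp S T; move=> /(_ k); rewrite mem_enum => /(_ kST).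
rewrite -ki in fi *; rewrite !(E k).1 !(E k).2 in fi *.
case=> // j []; rewrite mem_enum => jST jk le.
exists (val j); split; rewrite ?(E j).1 ?(E j).2 //.
by apply/mem_diffs; exists j; split=> //; apply: leq_trans (ltn_ord j) n5.
Qed.

Lemma wick_of_bits (W : seq bool -> nov R) e (sigma tau : seq 'I_n) : bwick W ->
  Ev (fun S : sets => W (twist e (bits 5 S))) (wick R sigma tau) = 0.
Proof.
move=> hW; rewrite /Ev psum_wick; set S := [set x in sigma]; set T := [set x in tau].
rewrite [X in _ * X](_ : _ = 0) ?mulr0 //.
have hST (k : 'I_n) : k \in symd S T -> (k < 5)%N by move=> _; apply: leq_trans (ltn_ord k) n5.
pose X := twist e (bits 5 S); pose Y := twist e (bits 5 T).
have sz (Z : sets) : size (twist e (bits 5 Z)) = 5%N by rewrite size_twist size_bits.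
rewrite -[RHS](hW X Y (sz S) (sz T)) /wsum /rel_terms big_map diffs_twist; last by rewrite !size_bits.
pose G i := (-1) ^+ odd (count (fun j => (j < i)%N) (diffs (bits 5 S) (bits 5 T))) *
  (W (flip i X) * W (flip i Y)).
transitivity (\sum_(k in symd S T) G k); last exact: (big_diffs G hST).
apply: eq_bigr => -[k kn] kST; rewrite mv_add !mv_monS (below_diffs kn hST) -signr_odd /G.
by rewrite !bits_symd1 /X /Y !flip_twist.
Qed.

(** The vector is extended to [5], translated to even support, filled by values at least B, lifted,
    and translated back; the relations survive translation and restriction by [wick_of_bits]. *)
Lemma DDr_TSpinPM (p : sets -> option R) : DDr p -> TSpinPM p.
Proof.
move=> hp; apply: tspin_of_lifts => B.
pose f0 := bits_vec p.
have f0_exch X Y : size X = 5%N -> size Y = 5%N -> texch f0 X Y by apply: bits_vec_exch.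
have [[X0 [sX0 fX0]]|none] := pselect (exists X, size X = 5%N /\ f0 X <> None); last first.
  (* When p is infinite everywhere, the zero vector is a lift. *)
  exists (fun=> 0); split=> [sigma tau|S].
    rewrite /Ev psum_wick big1 ?mulr0 // => k _.
    by rewrite mv_add !mv_monS !mulr0.
  case E : (p S) => [r|]; last exact: vge0.
  by case: none; exists (bits 5 S); rewrite size_bits /f0 bits_vecE E.
pose e := odd (count id X0); pose f X := f0 (twist e X).
have f_exch X Y : size X = 5%N -> size Y = 5%N -> texch f X Y.
  move=> sX sY i id; rewrite /f -!flip_twist => fi.
  have [sX' sY'] : size (twist e X) = 5%N /\ size (twist e Y) = 5%N by rewrite !size_twist.
  have [|j [jd ji le]] := f0_exch _ _ sX' sY' i _ fi; first by rewrite diffs_twist // sX sY.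
  exists j; rewrite -!flip_twist; split=> //.
  by move: jd; rewrite diffs_twist // sX sY.
have odd_diffs X Y : size X = 5%N -> size Y = 5%N ->
    odd (size (diffs X Y)) = odd (count id X) (+) odd (count id Y).
  by move=> sX sY; have /eqP := allbitsP (allbitsP odd_diffs_all sX) sY.
have evX0 : ~~ odd (count id (twist e X0)).
  by rewrite /e /twist; case E : (odd (count id X0)); rewrite ?odd_flip ?sX0 ?E.
have fX0' : f (twist e X0) <> None by rewrite /f twistK.
have f_even X : size X = 5%N -> f X <> None -> ~~ odd (count id X).
  move=> sX fX; have := even_diffs f_exch sX _ fX fX0'; rewrite size_twist => /(_ sX0).
  by rewrite odd_diffs ?size_twist // (negbTE evX0) addbF.
have eX0 : twist e X0 \in even5 by rewrite mem_even5 /even_bits size_twist sX0.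
have [|g [g_exch g_fin gf]] := @fill R f (twist e X0) B _ eX0 fX0'.
  by move=> X Y sX sY _; apply: f_exch.
have [W [hW Wodd Wval]] := finite_lift g_exch g_fin.
exists (fun S : sets => W (twist e (bits 5 S))); split=> [sigma tau|S]; first exact: wick_of_bits.
set X := twist e (bits 5 S).
have sX : size X = 5%N by rewrite size_twist size_bits.
have <- : f X = p S by rewrite /f /X twistK /f0 bits_vecE.
have [o|ev] := boolP (odd (count id X)).
  rewrite Wodd //; case E : (f X) => [r|]; last exact: vge0.
  by have := f_even X sX; rewrite E o => h; have /negP := h ltac:(by []).
have eX : X \in even5 by rewrite mem_even5 /even_bits sX.
(* A finite entry keeps its value in g; an infinite one was filled by a value at least B. *)
have := gf X eX; case: (f X) => [r gX|h]; first exact: Wval eX gX.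
case E : (g X) (g_fin X eX) => [s|] // _.
by apply: vge_le (h _ E) _; case: (Wval X s eX E).
Qed.

End SmallGroundSet.

Theorem theorem4p6 (R : realType) :
  (forall n : nat, (n <= 5)%N ->
     forall p : {set 'I_n} -> option R, TSpinPM p <-> DDr p) /\
  (forall n : nat, (7 <= n)%N ->
     (forall p : {set 'I_n} -> option R, TSpinPM p -> DDr p) /\
     (exists p : {set 'I_n} -> option R, DDr p /\ ~ TSpinPM p) /\
     (exists p : {set 'I_n} -> option R,
        DDrPlus p /\ supp p = [set S : {set 'I_n} | ~~ odd #|S|] /\ ~ TSpinPlus p)).
Proof.
split=> [n n5 p|n n7]; first by split; [exact: TSpinPM_DDr|exact: DDr_TSpinPM].
have hD := @fano_vec_DDr R n.
split; first exact: TSpinPM_DDr.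
split; exists (fano_vec R (n := n)); first by split=> //; apply: fano_not_trop.
split; [split=> // S|split].
- by rewrite /fano_vec; case: odd.
- exact: supp_fano_vec.
- by apply: fano_not_trop n7 _ _ => P; apply: ideal_spin_plus.
Qed.
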